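(* Let $\mathcal{G}=(V,E)$ be a $\Delta$-regular graph on $V=\{1,\ldots,n\}$ with uniform positive edge weights $w>0$, and consider the Max-Cut cost $C(z)=\frac12\sum_{(i,j)\in E}w(1-z_iz_j)$ for $z\in\{-1,1\}^n$. Let $p\in[0,1]$ and let $\rho=[\mathcal{C}]_{\mathcal{N}_{DP}}$ be the $n$-qubit state produced by the noisy version, with local depolarizing noise of strength $p$, of a depth-$D$ quantum circuit $\mathcal{C}$. Let $\Sigma_{ij}=\operatorname{tr}(\rho Z_iZ_j)$, let $\mathcal{A}(\mathcal{C})$ be the output distribution of the Gaussian rounding algorithm applied to $\Sigma$, and let $\mathcal{M}(\rho)$ be the computational-basis measurement distribution of $\rho$. Set $\varepsilon^2=2\sqrt{2}(1-p)^D$ with $\varepsilon\ge 0$, and suppose $\varepsilon\le x'=0.689$. Then $$\alpha_{MC'}=\frac{\mathbb{E}_{z\sim\mathcal{A}(\mathcal{C})}[C(z)]}{\mathbb{E}_{z\sim\mathcal{M}(\rho)}[C(z)]}\ \ge\ (1-\varepsilon)g(-\varepsilon)+\varepsilon\,\alpha_{GW}\ \ge\ 1-h(\varepsilon),$$ where $h(x)=1-x\alpha_{GW}-(1-x)\frac{2\arccos(-x)}{\pi(1+x)}$ satisfies $h(\varepsilon)\le 1-\alpha_{GW}$ and $h(\varepsilon)=O(\varepsilon)\to 0$ as $\varepsilon\to 0$.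
   Context: $Z_i$ is the Pauli $Z$ operator on qubit $i$. A depth-$D$ circuit is $\mathcal{C}=\mathcal{C}^{(D)}\circ\cdots\circ\mathcal{C}^{(1)}$ with each layer a unitary channel made of one- and two-qubit gates; its noisy version with local depolarizing noise of strength $p$ is $\mathcal{N}^{\otimes n}\circ\mathcal{C}^{(D)}\circ\cdots\circ\mathcal{N}^{\otimes n}\circ\mathcal{C}^{(1)}$ where $\mathcal{N}(\sigma)=(1-p)\sigma+p\operatorname{tr}(\sigma)I/2$, applied to some input state. The measurement distribution $\mathcal{M}(\rho)$ gives $z\in\{-1,1\}^n$ with probability $\langle z|\rho|z\rangle$, where $z_i=+1$ (resp. $-1$) corresponds to the $+1$ (resp. $-1$) eigenstate of $Z_i$; thus $\mathbb{E}_{z\sim\mathcal{M}(\rho)}[z_iz_j]=\Sigma_{ij}$. The Gaussian rounding algorithm: given the (positive semidefinite, unit-diagonal) matrix $\Sigma$, sample $y\sim\mathcal{N}(0,\Sigma)$ (multivariate Gaussian) and output $z$ with $z_i=+1$ if $y_i\ge0$ and $z_i=-1$ if $y_i<0$. The function $g$ is $g(x)=\frac{2\arccos x}{\pi(1-x)}$ on $[-1,1)$, and $\alpha_{GW}=\min_{x\in[-1,1)}g(x)\approx 0.87856$ (the Goemans–Williamson constant, attained near $x\approx-0.689$). *)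

(* Defs.v *)
From HB Require Import structures.
From mathcomp Require Import all_boot all_order all_algebra.
From mathcomp Require Import all_classical all_reals all_analysis.
From mathcomp Require Import complex.
From Stdlib Require List.

Set Implicit Arguments.
Unset Strict Implicit.
Unset Printing Implicit Defensive.

Import Order.TTheory GRing.Theory Num.Theory.
Local Open Scope classical_set_scope.
Local Open Scope ring_scope.
Local Open Scope complex_scope.

Section QDefs.
Variable R : realType.
Local Notation C := (R[i]).

(* A basis state is a bit string x : 'I_n -> bool ; bit false = |0>, which is
   the +1 eigenstate of Z, bit true = |1>, the -1 eigenstate of Z. *)
Definition bits (n : nat) := {ffun 'I_n -> bool}.
Definition dim (n : nat) := #|{: bits n}|.
Definition op (n : nat) := 'M[C]_(dim n).

Definition ent n (A : op n) (x y : bits n) : C := A (enum_rank x) (enum_rank y).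
Definition mkop n (f : bits n -> bits n -> C) : op n :=
  \matrix_(k, l) f (enum_val k) (enum_val l).

Definition adjmx m p (A : 'M[C]_(m, p)) : 'M[C]_(p, m) := (map_mx Num.conj A)^T.
Definition unitary m (U : 'M[C]_m) : Prop := U *m adjmx U = 1%:M.

(* positive semidefinite (hence Hermitian, over C) and density matrices *)
Definition psd m (A : 'M[C]_m) : Prop :=
  forall v : 'cV[C]_m, 0 <= (adjmx v *m A *m v) 0 0.
Definition density n (rho : op n) : Prop := psd rho /\ \tr rho = 1.

Definition bit2 (b : bool) : 'I_2 := inord (nat_of_bool b).
Definition bit4 (b c : bool) : 'I_4 := inord (2 * nat_of_bool b + nat_of_bool c).

Inductive gate (n : nat) :=
| G1 of 'I_n & 'M[C]_2
| G2 of 'I_n & 'I_n & 'M[C]_4.    (* two-qubit gate U on qubits (i,j), basis |b_i b_j> *)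

Definition gate_support n (g : gate n) : seq 'I_n :=
  match g with G1 i _ => [:: i] | G2 i j _ => [:: i; j] end.

Definition gate_wf n (g : gate n) : Prop :=
  match g with
  | G1 _ U => unitary U
  | G2 i j U => i != j /\ unitary U
  end.

(* the 2^n x 2^n unitary of a gate: U on its qubits tensored with identity *)
Definition gate_mx n (g : gate n) : op n :=
  match g with
  | G1 i U => mkop (fun x y =>
      U (bit2 (x i)) (bit2 (y i)) *
      (([forall k, (k != i) ==> (x k == y k)] : bool)%:R))
  | G2 i j U => mkop (fun x y =>
      U (bit4 (x i) (x j)) (bit4 (y i) (y j)) *
      (([forall k, ((k != i) && (k != j)) ==> (x k == y k)] : bool)%:R))
  end.

Definition layer (n : nat) := seq (gate n).
Definition layer_wf n (L : layer n) : Prop :=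
  (forall g, List.In g L -> gate_wf g) /\ uniq (flatten (map (@gate_support n) L)).
Definition layer_mx n (L : layer n) : op n :=
  \big[mulmx/1%:M]_(g <- L) gate_mx g.

Definition circuit (n : nat) := seq (layer n).
Definition circuit_wf n (c : circuit n) : Prop := forall L, List.In L c -> layer_wf L.

Definition setbit n (x : bits n) (i : 'I_n) (b : bool) : bits n :=
  [ffun k => if k == i then b else x k].

(* N acting on qubit i: sigma |-> (1-p) sigma + p (I/2)_i (x) tr_i(sigma) *)
Definition depol1 n (p : R) (i : 'I_n) (s : op n) : op n :=
  mkop (fun x y =>
    (1 - p)%:C * ent s x y +
    (p / 2)%:C * ((x i == y i : bool)%:R) *
      (ent s (setbit x i false) (setbit y i false) +
       ent s (setbit x i true) (setbit y i true))).

Definition depol n (p : R) (s : op n) : op n :=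
  foldr (@depol1 n p) s (enum 'I_n).

Definition noisy_state n (p : R) (c : circuit n) (rho0 : op n) : op n :=
  foldl (fun s L => depol p (layer_mx L *m s *m adjmx (layer_mx L))) rho0 c.

Definition spin n (x : bits n) (i : 'I_n) : R := if x i then -1 else 1.
Definition Zop n (i : 'I_n) : op n :=
  mkop (fun x y => ((x == y : bool)%:R) * (spin x i)%:C).
(* Sigma_ij = tr(rho Z_i Z_j) (a real number for Hermitian rho) *)
Definition Sigma n (rho : op n) (i j : 'I_n) : R :=
  complex.Re (\tr (rho *m (Zop i *m Zop j))).

Definition simple_graph n (e : rel 'I_n) : Prop :=
  (forall i j, e i j = e j i) /\ (forall i, ~~ e i i).
Definition regular n (e : rel 'I_n) (Delta : nat) : Prop :=
  forall i, #|[set j | e i j]| = Delta.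
(* C(z) = 1/2 sum_{(i,j) in E} w (1 - z_i z_j), each undirected edge once *)
Definition maxcut_cost n (e : rel 'I_n) (w : R) (z : 'I_n -> R) : R :=
  2^-1 * \sum_(i : 'I_n) \sum_(j : 'I_n | (i < j)%N && e i j) w * (1 - z i * z j).

Definition meas_expect n (e : rel 'I_n) (w : R) (rho : op n) : R :=
  \sum_(x : bits n) complex.Re (ent rho x x) * maxcut_cost e w (spin x).

Definition gauss_law (v : R) : set R -> \bar R :=
  if v == 0 then \d_(0:R) else normal_prob 0 (Num.sqrt v).

Definition gaussian_vector d (T : measurableType d) (P : probability T R) n
    (y : 'I_n -> T -> R) (S : 'I_n -> 'I_n -> R) : Prop :=
  (forall i, measurable_fun setT (y i)) /\
  forall a : 'I_n -> R, forall A : set R, measurable A ->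
    P ((fun t => \sum_i a i * y i t) @^-1` A) =
    gauss_law (\sum_i \sum_j a i * a j * S i j) A.

Definition round_sign n (y : 'I_n -> R) (i : 'I_n) : R := if 0 <= y i then 1 else -1.

Definition gfun (x : R) : R := 2 * acos x / (pi * (1 - x)).
Definition alpha_GW : R := inf [set gfun x | x in `[-1, 1[%classic].
Definition hfun (x : R) : R :=
  1 - x * alpha_GW - (1 - x) * (2 * acos (- x) / (pi * (1 + x))).
Definition xprime : R := 689 / 1000.

End QDefs.

(* Main.v *)
Require Import Defs.
From HB Require Import structures.
From mathcomp Require Import all_boot all_order all_algebra.
From mathcomp Require Import all_classical all_reals all_analysis.
From mathcomp Require Import complex ring lra measurable_realfun.
Import Order.TTheory GRing.Theory Num.Theory.
Import numFieldNormedType.Exports.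
Local Open Scope classical_set_scope.
Local Open Scope ring_scope.
Set Implicit Arguments.
Unset Strict Implicit.
Unset Printing Implicit Defensive.

(* The single-qubit depolarizing semigroup satisfies a modified logarithmic Sobolev
   inequality that tensorizes: it follows from a logarithmic Sobolev inequality for
   positive matrices, proved qubit by qubit with the infinitesimal form at p = 2 of the
   Ball-Carlen-Lieb uniform convexity inequality.  Hence each noisy layer contracts the
   relative entropy to the maximally mixed state by (1 - p)^2, so that after D layers it is
   at most (1 - p)^(2D) n ln 2.  Measuring does not increase it, and by the chain rule and
   a two-point Pinsker inequality the squared correlations over the edges of a regular
   graph sum to at most eps^4 times the number of edges.

   Gaussian rounding cuts an edge of correlation x with probability acos x / pi, by
   rotation invariance of the plane Gaussian law.  This invariance is obtained from the
   laws of linear combinations alone, sign functions being bounded pointwise limits of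
   trigonometric sums.  Finally acos x is bounded below by a quadratic function of x,
   and the bound on the sum of the squared correlations gives the ratio. *)

(** The exponent 2 in the contraction is forced: as [eps ^+ 2] is of order (1 - p)^D, the mean
    squared correlation must be of order (1 - p)^(2D), whereas plain convexity of the relative
    entropy gives a factor 1 - p per layer. The square comes from following the entropy as the noise
    strength varies, and needs the logarithmic Sobolev inequality with its sharp constant. The
    obstacle is tensorization for noncommuting matrices: at each qubit the matrix is cut into its
    two diagonal blocks and its off-diagonal part; the latter is not positive, so it is replaced by
    its absolute value, which keeps its entropy and does not raise the Dirichlet forms of the other
    qubits.

    Logarithms ask for full rank. Mixing the input with the identity, which every noisy layer fixes,
    provides it, and the weight of the mixture then tends to 0.

    A single edge need not satisfy the final ratio, because only the sum of the squared correlations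
    is controlled. The edge inequality is therefore relaxed by a multiple of [x ^+ 2 - eps ^+ 4],
    whose sum over the edges is nonpositive. *)

Local Notation "A ^H" := (adjmx A) (at level 8, format "A ^H").
Local Notation Re := complex.Re.
Local Notation Im := complex.Im.

(** * Functional calculus for Hermitian matrices *)

Section Hermitian.
Variable R : realType.
Local Notation C := (R[i]).
Local Open Scope complex_scope.

Definition nsq (z : C) : R := Re z ^+ 2 + Im z ^+ 2.

Lemma nsq_ge0 z : 0 <= nsq z.
Proof. by rewrite addr_ge0 ?sqr_ge0. Qed.

Lemma conjCE (z : C) : Num.conj z = z^*.
Proof. by []. Qed.

Lemma mulCJ (z : C) : z * Num.conj z = (nsq z)%:C.
Proof.
by rewrite conjCE; case: z => a b; apply/eqP; rewrite eq_complex /nsq /=;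
  apply/andP; split; apply/eqP; ring.
Qed.

Lemma nsqJ (z : C) : nsq (Num.conj z) = nsq z.
Proof. by case: z => a b; rewrite conjCE /nsq /= sqrrN. Qed.

Lemma nsqN (z : C) : nsq (- z) = nsq z.
Proof. by case: z => a b; rewrite /nsq /= !sqrrN. Qed.

Lemma ReD (x y : C) : Re (x + y) = Re x + Re y.
Proof. by case: x y => a b [c d]. Qed.
Lemma ReN (x : C) : Re (- x) = - Re x.
Proof. by case: x. Qed.
Lemma ReZ (k : R) (x : C) : Re (k%:C * x) = k * Re x.
Proof. by case: x => a b /=; rewrite mul0r subr0. Qed.
Lemma Re_sum (I : Type) (r : seq I) (P : pred I) (F : I -> C) :
  Re (\sum_(i <- r | P i) F i) = \sum_(i <- r | P i) Re (F i).
Proof. by elim/big_rec2: _ => // i y1 y2 _ <-; rewrite ReD. Qed.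
Lemma conj_real (x : R) : Num.conj (x%:C) = x%:C.
Proof. by rewrite conjCE; apply/eqP; rewrite eq_complex /= oppr0 !eqxx. Qed.

Lemma adjmxE m p (A : 'M[C]_(m, p)) i j : A^H i j = Num.conj (A j i).
Proof. by rewrite !mxE. Qed.

Lemma adjmxK m p (A : 'M[C]_(m, p)) : A^H^H = A.
Proof. by apply/matrixP => i j; rewrite !adjmxE conjCK. Qed.

Lemma adjmxM m p q (A : 'M[C]_(m, p)) (B : 'M[C]_(p, q)) :
  (A *m B)^H = B^H *m A^H.
Proof. by rewrite /adjmx map_mxM trmx_mul. Qed.

Lemma adjmxD m p (A B : 'M[C]_(m, p)) : (A + B)^H = A^H + B^H.
Proof. by rewrite /adjmx map_mxD linearD. Qed.

Lemma adjmxN m p (A : 'M[C]_(m, p)) : (- A)^H = - A^H.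
Proof. by rewrite /adjmx map_mxN linearN. Qed.

Lemma adjmxB m p (A B : 'M[C]_(m, p)) : (A - B)^H = A^H - B^H.
Proof. by rewrite adjmxD adjmxN. Qed.

Lemma adjmxZ m p (k : C) (A : 'M[C]_(m, p)) : (k *: A)^H = Num.conj k *: A^H.
Proof. by rewrite /adjmx map_mxZ linearZ. Qed.

Lemma adjmx1 m : (1%:M : 'M[C]_m)^H = 1%:M.
Proof. by rewrite /adjmx map_mx1 trmx1. Qed.

Lemma adjmx0 m p : (0 : 'M[C]_(m, p))^H = 0.
Proof. by rewrite /adjmx map_mx0 trmx0. Qed.

Lemma unitaryV m (U : 'M[C]_m) : unitary U -> U^H *m U = 1%:M.
Proof. exact: mulmx1C. Qed.

Lemma unitary_adj m (U : 'M[C]_m) : unitary U -> unitary U^H.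
Proof. by move=> /unitaryV; rewrite /unitary adjmxK. Qed.

Lemma unitaryM m (U V : 'M[C]_m) : unitary U -> unitary V -> unitary (U *m V).
Proof. by move=> hU hV; rewrite /unitary adjmxM mulmxA -(mulmxA U) hV mulmx1. Qed.

Lemma unitary1 m : unitary (1%:M : 'M[C]_m).
Proof. by rewrite /unitary adjmx1 mulmx1. Qed.

Definition rtr m (A : 'M[C]_m) : R := Re (\tr A).

Lemma rtrD m (A B : 'M[C]_m) : rtr (A + B) = rtr A + rtr B.
Proof. by rewrite /rtr mxtraceD ReD. Qed.
Lemma rtrN m (A : 'M[C]_m) : rtr (- A) = - rtr A.
Proof. by rewrite /rtr linearN ReN. Qed.
Lemma rtrB m (A B : 'M[C]_m) : rtr (A - B) = rtr A - rtr B.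
Proof. by rewrite rtrD rtrN. Qed.
Lemma rtrZ m (k : R) (A : 'M[C]_m) : rtr (k%:C *: A) = k * rtr A.
Proof. by rewrite /rtr mxtraceZ ReZ. Qed.
Lemma rtr0 m : rtr (0 : 'M[C]_m) = 0.
Proof. by rewrite /rtr mxtrace0. Qed.
Lemma rtrC m p (A : 'M[C]_(m, p)) (B : 'M[C]_(p, m)) : rtr (A *m B) = rtr (B *m A).
Proof. by rewrite /rtr mxtrace_mulC. Qed.
Lemma rtr_sum m (I : Type) (r : seq I) (P : pred I) (F : I -> 'M[C]_m) :
  rtr (\sum_(i <- r | P i) F i) = \sum_(i <- r | P i) rtr (F i).
Proof. by rewrite /rtr (raddf_sum (@mxtrace C m)) Re_sum. Qed.

Definition dg m (a : 'I_m -> R) : 'M[C]_m := diag_mx (\row_j (a j)%:C).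

Lemma dgE m (a : 'I_m -> R) i j : dg a i j = (a i)%:C *+ (i == j).
Proof. by rewrite !mxE; case: eqP => // ->. Qed.

Lemma mul_dg m p (a : 'I_m -> R) (X : 'M[C]_(m, p)) i j :
  (dg a *m X) i j = (a i)%:C * X i j.
Proof. by rewrite mul_diag_mx !mxE. Qed.

Lemma mul_mx_dg m p (a : 'I_m -> R) (X : 'M[C]_(p, m)) i j :
  (X *m dg a) i j = X i j * (a j)%:C.
Proof. by rewrite mul_mx_diag !mxE. Qed.

Lemma dg_adj m (a : 'I_m -> R) : (dg a)^H = dg a.
Proof.
apply/matrixP => i j; rewrite adjmxE !dgE eq_sym; have [->|_] := eqVneq.
  by rewrite !mulr1n conj_real.
by rewrite !mulr0n rmorph0.
Qed.

Lemma dgM m (a b : 'I_m -> R) : dg a *m dg b = dg (fun j => a j * b j).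
Proof.
by apply/matrixP => i j; rewrite mul_dg !dgE; case: eqP => [->|]; 
  rewrite ?mulr1n ?mulr0n ?mulr0 // rmorphM.
Qed.

Lemma dgD m (a b : 'I_m -> R) : dg a + dg b = dg (fun j => a j + b j).
Proof.
by apply/matrixP => i j; rewrite mxE !dgE -mulrnDl rmorphD.
Qed.

Lemma dg_const m (k : R) : dg (fun _ : 'I_m => k) = (k%:C)%:M.
Proof. by apply/matrixP => i j; rewrite dgE mxE. Qed.

Lemma dg0 m : dg (fun _ : 'I_m => 0) = 0.
Proof. by apply/matrixP => i j; rewrite dgE mxE mul0rn. Qed.

Lemma dgN m (a : 'I_m -> R) : - dg a = dg (fun j => - a j).
Proof. by apply/matrixP => i j; rewrite mxE !dgE -mulNrn rmorphN. Qed.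

Lemma eq_dg m (a b : 'I_m -> R) : a =1 b -> dg a = dg b.
Proof. by move=> e; apply/matrixP => i j; rewrite !dgE e. Qed.

Lemma rtr_dg m (a : 'I_m -> R) : rtr (dg a) = \sum_j a j.
Proof.
by rewrite /rtr /mxtrace Re_sum; apply: eq_bigr => j _; rewrite dgE eqxx mulr1n.
Qed.

(** Most trace inequalities below are reduced by this formula to scalar inequalities for pairs of
    eigenvalues, weighted by the squared moduli of the overlaps of two eigenbases. *)
Lemma rtr_dg_sandwich m (a b : 'I_m -> R) (X : 'M[C]_m) :
  rtr (dg a *m X *m dg b *m X^H) = \sum_k \sum_l a k * b l * nsq (X k l).
Proof.
rewrite /rtr /mxtrace Re_sum; apply: eq_bigr => k _.
rewrite mxE Re_sum; apply: eq_bigr => l _.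
rewrite mul_mx_dg mul_dg adjmxE.
have -> : (a k)%:C * X k l * (b l)%:C * Num.conj (X k l) =
   (a k)%:C * ((b l)%:C * (X k l * Num.conj (X k l))) by ring.
by rewrite !ReZ mulCJ mulrA.
Qed.

Lemma rtr_frob m (X : 'M[C]_m) : rtr (X *m X^H) = \sum_k \sum_l nsq (X k l).
Proof.
have := rtr_dg_sandwich (fun _ => 1) (fun _ => 1) X.
rewrite dg_const rmorph1 mul1mx mulmx1 => ->.
by apply: eq_bigr => k _; apply: eq_bigr => l _; rewrite !mul1r.
Qed.

Lemma unitary_row m (X : 'M[C]_m) k : unitary X -> \sum_l nsq (X k l) = 1.
Proof.
move=> /matrixP /(_ k k); rewrite !mxE eqxx => /(congr1 (@complex.Re R)) /=.
rewrite Re_sum => <-; apply: eq_bigr => l _.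
by rewrite adjmxE mulCJ.
Qed.

Lemma unitary_col m (X : 'M[C]_m) l : unitary X -> \sum_k nsq (X k l) = 1.
Proof.
move=> /unitary_adj /(@unitary_row _ _ l) <-; apply: eq_bigr => k _.
by rewrite adjmxE nsqJ.
Qed.

Definition herm m (A : 'M[C]_m) : Prop := A^H = A.

Definition spec m (U : 'M[C]_m) (a : 'I_m -> R) (A : 'M[C]_m) : Prop :=
  unitary U /\ A = U *m dg a *m U^H.

Definition eig m (A : 'M[C]_m) (j : 'I_m) : R := Re (spectral_diag A 0 j).
Definition eigv m (A : 'M[C]_m) : 'M[C]_m := (spectralmx A)^H.

Lemma hermP m (A : 'M[C]_m) : herm A -> spec (eigv A) (eig A) A.
Proof.
move=> hA.
have hs : A \is hermsymmx.
  by apply/is_hermitianmxP; rewrite expr0 scale1r -map_trmx; exact/esym.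
have hU := spectral_unitarymx A; split.
  by apply: unitary_adj; move/unitarymxP: hU; rewrite -map_trmx.
have := hermitian_normalmx hs => /orthomx_spectralP {1}->.
rewrite invmx_unitary // /eigv adjmxK; congr (_ *m _ *m _).
  by rewrite -map_trmx.
apply/matrixP => i j; rewrite dgE mxE; congr (_ *+ _).
have /mxOverP/(_ 0 i) := hermitian_spectral_diag_real hs.
by move=> /RRe_real.
Qed.

Definition fmx m (f : R -> R) (A : 'M[C]_m) : 'M[C]_m :=
  eigv A *m dg (fun j => f (eig A j)) *m (eigv A)^H.

Definition trf m (f : R -> R) (A : 'M[C]_m) : R := \sum_j f (eig A j).

Lemma spec_herm m (U : 'M[C]_m) a A : spec U a A -> herm A.
Proof. by move=> [_ ->]; rewrite /herm !adjmxM adjmxK dg_adj mulmxA. Qed.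

(** In the eigenbases, [X] has a nonzero entry only between equal eigenvalues, so applying [f] to
    both sides preserves the relation. The case [X = 1] shows that [fmx] does not depend on the
    diagonalization. *)
Lemma spec_intertwine m (f : R -> R) (U V X A B : 'M[C]_m) a b :
  spec U a A -> spec V b B -> X *m A = B *m X ->
  X *m (U *m dg (fun j => f (a j)) *m U^H) = (V *m dg (fun j => f (b j)) *m V^H) *m X.
Proof.
move=> [hU ->] [hV ->] h.
pose W := V^H *m X *m U.
have hW : W *m dg a = dg b *m W.
  have := congr1 (fun Y => V^H *m Y *m U) h.
  rewrite /W !mulmxA (unitaryV hV) mul1mx => <-.
  by rewrite -!mulmxA (unitaryV hU) mulmx1.
have hf : W *m dg (fun j => f (a j)) = dg (fun j => f (b j)) *m W.
  apply/matrixP => i j; have /matrixP /(_ i j) := hW.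
  rewrite !mul_dg !mul_mx_dg => e.
  have [->|nz] := eqVneq (W i j) 0; first by rewrite mulr0 mul0r.
  suff -> : b i = a j by rewrite mulrC.
  by apply: (@complexI R); apply: (mulIf nz); rewrite -e mulrC.
have := congr1 (fun Y => V *m Y *m U^H) hf.
rewrite /W !mulmxA hV mul1mx => ->.
by rewrite -!mulmxA hU mulmx1.
Qed.

Lemma fmxE m f (U : 'M[C]_m) a A :
  spec U a A -> fmx f A = U *m dg (fun j => f (a j)) *m U^H.
Proof.
move=> h; have := @spec_intertwine _ f _ _ 1%:M _ _ _ _ (hermP (spec_herm h)) h.
by rewrite mul1mx mulmx1 mul1mx mulmx1; exact.
Qed.

Lemma fmx_intertwine m f (X A B : 'M[C]_m) :
  herm A -> herm B -> X *m A = B *m X -> X *m fmx f A = fmx f B *m X.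
Proof. by move=> hA hB; apply: spec_intertwine; apply: hermP. Qed.

Lemma rtr_conj m (U X : 'M[C]_m) : unitary U -> rtr (U *m X *m U^H) = rtr X.
Proof. by move=> hU; rewrite rtrC mulmxA (unitaryV hU) mul1mx. Qed.

Lemma trf_fmx m f (A : 'M[C]_m) : herm A -> trf f A = rtr (fmx f A).
Proof. by move=> /hermP [hU _]; rewrite /fmx rtr_conj // rtr_dg. Qed.

Lemma trfE m f (U : 'M[C]_m) a A : spec U a A -> trf f A = \sum_j f (a j).
Proof.
move=> h; rewrite (trf_fmx _ (spec_herm h)).
by rewrite (fmxE _ h) rtr_conj ?rtr_dg //; case: h.
Qed.

Lemma spec_fmx m f (A : 'M[C]_m) : herm A ->
  spec (eigv A) (fun j => f (eig A j)) (fmx f A).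
Proof. by move=> /hermP []. Qed.

Lemma fmx_herm m f (A : 'M[C]_m) : herm A -> herm (fmx f A).
Proof. by move=> /(spec_fmx f) /spec_herm. Qed.

End Hermitian.

(** * Positive semidefinite matrices and their traces *)

Section Psd.
Variable R : realType.
Local Notation C := (R[i]).
Local Open Scope complex_scope.

Lemma spec_conj m (G U : 'M[C]_m) a A :
  unitary G -> spec U a A -> spec (G *m U) a (G *m A *m G^H).
Proof.
move=> hG [hU ->]; split; first exact: unitaryM.
by rewrite adjmxM !mulmxA.
Qed.

Lemma trf_conj m f (G A : 'M[C]_m) : unitary G -> herm A ->
  trf f (G *m A *m G^H) = trf f A.
Proof. by move=> hG /hermP hA; rewrite (trfE f (spec_conj hG hA)) (trfE f hA). Qed.

Lemma spec_shift m (U : 'M[C]_m) a A (k : R) :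
  spec U a A -> spec U (fun j => a j + k) (A + (k%:C)%:M).
Proof.
move=> [hU ->]; split => //.
by rewrite -dgD mulmxDr mulmxDl dg_const mul_mx_scalar -scalemxAl hU scalemx1.
Qed.

Lemma rtr_spec2 m (M U V A B : 'M[C]_m) a b f g :
  spec U a A -> spec V b B ->
  rtr (fmx f A *m M *m fmx g B *m M^H) =
  \sum_k \sum_l f (a k) * g (b l) * nsq ((U^H *m M *m V) k l).
Proof.
move=> hA hB; rewrite (fmxE f hA) (fmxE g hB) -rtr_dg_sandwich.
move: (dg _) (dg _) => D1 D2; rewrite !adjmxM adjmxK -!mulmxA rtrC.
by rewrite -!mulmxA.
Qed.

Lemma fmx_id m (A : 'M[C]_m) : herm A -> fmx id A = A.
Proof. by move=> /hermP h; rewrite (fmxE _ h); exact: (esym h.2). Qed.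

Lemma eq_fmx m f g (A : 'M[C]_m) : f =1 g -> fmx f A = fmx g A.
Proof. by move=> e; rewrite /fmx; congr (_ *m _ *m _); apply: eq_dg => j. Qed.

Lemma fmxM m f g (A : 'M[C]_m) : herm A ->
  fmx f A *m fmx g A = fmx (fun x => f x * g x) A.
Proof.
move=> /hermP [hU _]; rewrite /fmx -dgM.
move: (dg _) (dg _) => D1 D2; rewrite !mulmxA; congr (_ *m _ *m _).
by rewrite -mulmxA (unitaryV hU) mulmx1.
Qed.

Lemma herm0 m : herm (0 : 'M[C]_m).
Proof. by rewrite /herm adjmx0. Qed.

Lemma fmx0 m f : f 0 = 0 -> fmx f (0 : 'M[C]_m) = 0.
Proof.
move=> f0; have h : spec 1%:M (fun _ => 0) (0 : 'M[C]_m).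
  by split; [exact: unitary1 | rewrite dg0 mulmx0 mul0mx].
by rewrite (fmxE f h) f0 dg0 mulmx0 mul0mx.
Qed.

Lemma fmx_annihilate m f (X A : 'M[C]_m) :
  herm A -> f 0 = 0 -> X *m A = 0 -> X *m fmx f A = 0.
Proof.
move=> hA f0 h; rewrite (@fmx_intertwine _ _ f X A 0) ?mul0mx //.
  by rewrite (fmx0 _ f0) mul0mx.
exact: herm0.
Qed.

Lemma rtr_mulJ m (A : 'M[C]_m) : herm A -> rtr (A *m A) = \sum_k \sum_l nsq (A k l).
Proof. by move=> hA; rewrite -rtr_frob hA. Qed.

Lemma rtr_sq_ge0 m (A : 'M[C]_m) : herm A -> 0 <= rtr (A *m A).
Proof.
by move=> hA; rewrite rtr_mulJ //; apply: sumr_ge0 => k _; apply: sumr_ge0 => l _; exact: nsq_ge0.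
Qed.

Lemma rtr_sq_eq0 m (A : 'M[C]_m) : herm A -> rtr (A *m A) = 0 -> A = 0.
Proof.
move=> hA; rewrite rtr_mulJ // => /eqP.
rewrite psumr_eq0 => [|k _]; last by apply: sumr_ge0 => l _; exact: nsq_ge0.
move=> /allP h; apply/matrixP => k l; rewrite mxE.
have := h k (mem_index_enum _) => /=; rewrite psumr_eq0 => [|? _]; last exact: nsq_ge0.
move=> /allP /(_ l (mem_index_enum _)) /=; rewrite /nsq.
rewrite paddr_eq0 ?sqr_ge0 // !sqrf_eq0; case: (A k l) => x y /= /andP[/eqP -> /eqP ->] //.
Qed.

Lemma trf_sq m (A : 'M[C]_m) : herm A -> rtr (A *m A) = trf (fun x => x ^+ 2) A.
Proof.
move=> hA; by rewrite trf_fmx // -{1 2}(fmx_id hA) fmxM.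
Qed.

Lemma trf_id m (A : 'M[C]_m) : herm A -> rtr A = trf id A.
Proof. by move=> hA; rewrite trf_fmx // fmx_id. Qed.

Lemma rtr_mul_le m (A B : 'M[C]_m) : herm A -> herm B ->
  2 * rtr (A *m B) <= rtr (A *m A) + rtr (B *m B).
Proof.
move=> hA hB; have h : herm (A - B) by rewrite /herm adjmxB hA hB.
have := rtr_sq_ge0 h; rewrite mulmxBr !mulmxBl !rtrB (rtrC B A); lra.
Qed.

(** Polarization over C: the quadratic form is real, and its values at e_i, e_j, e_i + e_j and e_i +
    i e_j determine the relation between the entries (i, j) and (j, i). *)
Lemma psd_herm m (A : 'M[C]_m) : psd A -> herm A.
Proof.
move=> h.
have im (v : 'cV[C]_m) : Im ((v^H *m A *m v) 0 0) = 0 by apply: ger0_Im; exact: h.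
have [e en] : exists e : 'I_m -> 'cV[C]_m, forall k l, ((e k)^H *m A *m e l) 0 0 = A k l.
  exists (fun k => delta_mx k 0) => k l.
  have -> : (delta_mx k 0 : 'cV[C]_m)^H = delta_mx 0 k.
    by apply/matrixP => a b; rewrite !mxE andbC; case: (_ && _); rewrite /= ?rmorph1 ?rmorph0.
  by rewrite -rowE -colE !mxE.
have [N eN] : exists N : 'I_m -> 'I_m -> 'M[C]_1, forall k l, (e k)^H *m A *m e l = N k l.
  by exists (fun k l => (e k)^H *m A *m e l).
have nE k l : N k l 0 0 = A k l by rewrite -eN.
have q (i j : 'I_m) (s t : C) :
  ((s *: e i + t *: e j)^H *m A *m (s *: e i + t *: e j)) 0 0 =
  Num.conj s * s * A i i + Num.conj s * t * A i j + Num.conj t * s * A j i + Num.conj t * t * A j j.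
  rewrite adjmxD !adjmxZ !mulmxDl !mulmxDr -!scalemxAl -!scalemxAr.
  rewrite !eN !mxE !nE.
  move: (A i i) (A i j) (A j i) (A j j) (Num.conj s) (Num.conj t) => x1 x2 x3 x4 x5 x6.
  by ring.
apply/matrixP => i j; rewrite adjmxE.
have h1 := im (1 *: e i + 1 *: e j).
have h2 := im (1 *: e i + 'i%C *: e j).
have h3 := im (1 *: e i + 0 *: e j).
have h4 := im (0 *: e i + 1 *: e j).
rewrite q in h1; rewrite q in h2; rewrite q in h3; rewrite q in h4.
move: h1 h2 h3 h4; rewrite !conjCE.
move: (A i i) (A j j) (A i j) (A j i) => [a1 a2] [b1 b2] [c1 c2] [d1 d2] /=.
move=> h1 h2 h3 h4; apply/eqP; rewrite eq_complex /=; apply/andP; split; apply/eqP; lra.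
Qed.

Lemma spec_psd m (U : 'M[C]_m) a A : spec U a A -> (forall j, 0 <= a j) -> psd A.
Proof.
move=> [hU ->] ha v.
have -> : v^H *m (U *m dg a *m U^H) *m v = (U^H *m v)^H *m (dg a *m (U^H *m v)).
  by rewrite adjmxM adjmxK !mulmxA.
rewrite mxE; apply: sumr_ge0 => k _; rewrite adjmxE mul_dg.
rewrite mulrC -mulrA mulCJ -rmorphM ler0c mulr_ge0 ?ha ?nsq_ge0 //.
Qed.

Lemma psdD m (A B : 'M[C]_m) : psd A -> psd B -> psd (A + B).
Proof. by move=> hA hB v; rewrite mulmxDr mulmxDl mxE addr_ge0. Qed.

Lemma psdZ m (k : R) (A : 'M[C]_m) : 0 <= k -> psd A -> psd (k%:C *: A).
Proof. by move=> hk hA v; rewrite -scalemxAr -scalemxAl mxE mulr_ge0 // ler0c. Qed.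

Lemma psd_conj m (M A : 'M[C]_m) : psd A -> psd (M *m A *m M^H).
Proof.
move=> hA v; have := hA (M^H *m v).
by rewrite adjmxM adjmxK !mulmxA.
Qed.

Lemma psd_fmx m f (A : 'M[C]_m) : herm A -> (forall j, 0 <= f (eig A j)) -> psd (fmx f A).
Proof. by move=> /(spec_fmx f) /spec_psd. Qed.

Lemma psd_spec m (U : 'M[C]_m) a A j : psd A -> spec U a A -> 0 <= a j.
Proof.
move=> hA [hU e].
have : psd (dg a).
  have := psd_conj U^H hA; rewrite e adjmxK !mulmxA (unitaryV hU) mul1mx.
  by rewrite -mulmxA (unitaryV hU) mulmx1.
move=> /(_ (delta_mx j 0 : 'cV[C]_m)); rewrite -mulmxA mxE (bigD1 j) //= big1 => [|k /negbTE nk]; last first.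
  by rewrite mul_dg !mxE nk /= !mulr0.
rewrite addr0 mul_dg adjmxE mxE !eqxx /= rmorph1 mul1r mulr1.
by rewrite ler0c.
Qed.

Lemma psd_eig m (A : 'M[C]_m) j : psd A -> 0 <= eig A j.
Proof. by move=> h; apply: (psd_spec _ h (hermP (psd_herm h))). Qed.

End Psd.


(** * Scalar logarithmic inequalities *)

Section Derivatives.
Variable R : realType.
Implicit Types (f g : R -> R) (x a b : R).

(* A definition rather than the class itself, so that applying the lemmas below does
   not trigger instance search. *)
Definition deriv_at f x d : Prop := is_derive x 1 f d.

Lemma dv_eq f x a b : deriv_at f x a -> a = b -> deriv_at f x b.
Proof. by move=> h <-. Qed.

Lemma dvD f g x a b : deriv_at f x a -> deriv_at g x b ->
  deriv_at (fun t => f t + g t) x (a + b).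
Proof. by move=> *; exact: is_deriveD. Qed.

Lemma dvN f x a : deriv_at f x a -> deriv_at (fun t => - f t) x (- a).
Proof. by move=> *; exact: is_deriveN. Qed.

Lemma dvB f g x a b : deriv_at f x a -> deriv_at g x b ->
  deriv_at (fun t => f t - g t) x (a - b).
Proof. by move=> *; exact: is_deriveB. Qed.

Lemma dvM f g x a b : deriv_at f x a -> deriv_at g x b ->
  deriv_at (fun t => f t * g t) x (f x * b + g x * a).
Proof. by move=> *; exact: is_deriveM. Qed.

Lemma dvcst k x : deriv_at (fun _ => k) x (0 : R).
Proof. exact: is_derive_cst. Qed.

Lemma dvid x : deriv_at (fun t : R => t) x (1 : R).
Proof. exact: is_derive_id. Qed.

Lemma dvZ k f x a : deriv_at f x a -> deriv_at (fun t => k * f t) x (k * a).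
Proof. by move=> h; have := dvM (dvcst k x) h; rewrite mulr0 addr0. Qed.

Lemma dvln f x a : 0 < f x -> deriv_at f x a ->
  deriv_at (fun t => ln (f t)) x (a / f x).
Proof.
move=> fx h; have hl := is_derive1_ln fx.
by have := is_derive1_comp hl h; rewrite mulrC; exact.
Qed.

Lemma dvV f x a : f x != 0 -> deriv_at f x a ->
  deriv_at (fun t => (f t)^-1) x (- (f x) ^- 2 * a).
Proof. by move=> fx h; exact: is_deriveV. Qed.

Lemma dvX f x a (n : nat) : deriv_at f x a ->
  deriv_at (fun t => f t ^+ n) x (n%:R * f x ^+ n.-1 * a).
Proof.
move=> h; have -> : (fun t => f t ^+ n) = f ^+ n by apply/funext => t; rewrite exprfctE.
exact: is_deriveX.
Qed.

Lemma dv_sum (I : Type) (r : seq I) (F : I -> R -> R) (d : I -> R) x :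
  (forall i, deriv_at (F i) x (d i)) ->
  deriv_at (fun t => \sum_(i <- r) F i t) x (\sum_(i <- r) d i).
Proof.
move=> h; elim: r => [|i r IH].
  rewrite big_nil; under eq_fun do rewrite big_nil; exact: dvcst.
rewrite big_cons; under eq_fun do rewrite big_cons; exact: dvD.
Qed.

End Derivatives.

(** Builds the derivative by recursion on the shape of the function, leaving its value as a
    unification variable that [dv_eq] then compares with the intended formula. Positivity and
    nonvanishing conditions are left as goals. *)
Ltac dv :=
  lazymatch goal with
  | |- deriv_at (fun _ => ?k) _ _ => exact (dvcst k _)
  | |- deriv_at (fun t => t) _ _ => exact (dvid _)
  | |- deriv_at (fun t => @?f t - @?g t) ?x _ =>
      notypeclasses refine (@dvB _ f g x _ _ _ _); cbv beta; dv
  | |- deriv_at (fun t => @?f t + @?g t) ?x _ =>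
      notypeclasses refine (@dvD _ f g x _ _ _ _); cbv beta; dv
  | |- deriv_at (fun t => - @?f t) ?x _ =>
      notypeclasses refine (@dvN _ f x _ _); cbv beta; dv
  | |- deriv_at (fun t => @?f t * @?g t) ?x _ =>
      notypeclasses refine (@dvM _ f g x _ _ _ _); cbv beta; dv
  | |- deriv_at (fun t => (@?f t)^-1) ?x _ =>
      notypeclasses refine (@dvV _ f x _ _ _); cbv beta; dv
  | |- deriv_at (fun t => ln (@?f t)) ?x _ =>
      notypeclasses refine (@dvln _ f x _ _ _); cbv beta; dv
  | |- deriv_at (fun t => @?f t ^+ ?n) ?x _ =>
      notypeclasses refine (@dvX _ f x _ n _); cbv beta; dv
  | _ => idtac
  end.

Section Calculus.
Variable R : realType.
Implicit Types (f g : R -> R) (x a b : R).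

Lemma derive_ge0_le f df a b : a <= b ->
  (forall x, a <= x <= b -> deriv_at f x (df x)) ->
  (forall x, a <= x <= b -> 0 <= df x) -> f a <= f b.
Proof.
move=> ab hd h0.
have [x||c hc e] := @MVT_segment _ f df a b ab.
- by rewrite in_itv /= => /andP[ax xb]; apply: hd; rewrite !ltW.
- apply: derivable_within_continuous => x; rewrite in_itv /= => hx.
  by case: (hd x hx).
- by rewrite -subr_ge0 e mulr_ge0 ?subr_ge0 // h0 //; move: hc; rewrite in_itv.
Qed.

Lemma ln_le_sub1 x : 0 < x -> ln x <= x - 1.
Proof.
move=> x0; have := @le_ln1Dx R (x - 1); rewrite addrCA subrr addr0; apply; lra.
Qed.

Lemma lnD_bound (S x : R) : 0 < S -> 0 <= x -> 0 <= ln (x + S) - ln S <= x / S.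
Proof.
move=> S0 x0; have xS : 0 < x + S by rewrite ltr_wpDl.
rewrite -ln_div ?posrE //; apply/andP; split.
  by apply: ln_ge0; rewrite ler_pdivlMr // mul1r lerDr.
by apply: le_trans (ln_le_sub1 (divr_gt0 xS S0)) _; rewrite mulrDl divff ?gt_eqF // addrK.
Qed.

Lemma le0_of_le_div (a K : R) : (forall S, 1 <= S -> a <= K / S) -> a <= 0.
Proof.
move=> h; rewrite leNgt; apply/negP => a0.
have K0 : 0 < K by have := h 1 (lexx _); rewrite divr1; apply: lt_le_trans.
(* For this [S] the product [a * S] equals [a + 2 * K], which exceeds [K]. *)
pose S := 1 + 2 * (K / a).
have S1 : 1 <= S by rewrite lerDl mulr_ge0 // ltW // divr_gt0.
have := h S S1; rewrite ler_pdivlMr ?(lt_le_trans ltr01) // /S mulrDr mulr1.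
have -> : a * (2 * (K / a)) = 2 * K by field; rewrite gt_eqF.
lra.
Qed.

(** [psi] is the entropy integrand of a density and [eta] that of its square root, the variable of
    the logarithmic Sobolev inequality. As [eta] is even, it also makes sense for the indefinite
    off-diagonal parts. *)
Definition psi (x : R) : R := x * ln x.
Definition eta (x : R) : R := psi (x ^+ 2).

Lemma psi0 : psi 0 = 0. Proof. by rewrite /psi mul0r. Qed.
Lemma psi1 : psi 1 = 0. Proof. by rewrite /psi ln1 mulr0. Qed.
Lemma eta0 : eta 0 = 0. Proof. by rewrite /eta expr0n /= psi0. Qed.
Lemma eta_norm x : eta `|x| = eta x. Proof. by rewrite /eta real_normK // num_real. Qed.

Lemma etaE x : 0 <= x -> eta x = 2 * (x ^+ 2 * ln x).
Proof.
rewrite le_eqVlt => /predU1P[<-|x0]; first by rewrite eta0 expr0n /= mul0r mulr0.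
by rewrite /eta /psi lnXn // mulr2n; ring.
Qed.

(** The graph of the convex function [psi] lies above its tangent at [t]; the point [s = 0] is
    included since [psi] vanishes there. *)
Lemma psi_tangent (s t : R) : 0 <= s -> 0 < t -> psi t + (s - t) * (1 + ln t) <= psi s.
Proof.
move=> s0 t0; rewrite /psi.
move: s0; rewrite le_eqVlt => /predU1P[<-|s0]; first by rewrite mul0r; lra.
have := ln_le_sub1 (divr_gt0 t0 s0); rewrite ln_div ?posrE // => h.
have : s * (ln t - ln s) <= s * (t / s - 1) by rewrite ler_wpM2l // ltW.
have -> : s * (t / s - 1) = t - s by field; rewrite gt_eqF.
lra.
Qed.

Lemma psi_scale (k x : R) : 0 < k -> 0 <= x -> psi (k * x) = k * psi x + k * x * ln k.
Proof.
move=> k0; rewrite le_eqVlt => /predU1P[<-|x0].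
  by rewrite mulr0 psi0; ring.
by rewrite /psi lnM ?posrE //; ring.
Qed.


(** Gross's logarithmic Sobolev inequality on the two-point space with uniform measure. There is
    equality at [p = q], and the gap increases as the larger value moves away. *)
Lemma two_point_lsi (p q : R) : 0 <= p -> 0 <= q ->
  psi (p ^+ 2) + psi (q ^+ 2) - psi (p ^+ 2 + q ^+ 2) + ln 2 * (p ^+ 2 + q ^+ 2)
    <= (p - q) ^+ 2.
Proof.
wlog pq : p q / p <= q => [hw p0 q0|].
  have [h|/ltW h] := leP p q; first exact: hw.
  by have := hw q p h q0 p0; rewrite (addrC (q ^+ 2)) (addrC (psi (q ^+ 2))) -(sqrrN (q - p)) opprB.
move=> p0 _; move: p0; rewrite le_eqVlt => /predU1P[<-|p0].
  rewrite expr0n /= psi0 !add0r subrr add0r sqrrN ler_piMl ?sqr_ge0 //.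
  by have := @ln_le_sub1 2 (ltr0n _ 2); lra.
have ln2p : ln (p ^+ 2 + p ^+ 2) = ln 2 + 2 * ln p.
  have -> : p ^+ 2 + p ^+ 2 = 2 * p ^+ 2 by ring.
  by rewrite lnM ?posrE ?exprn_gt0 // lnXn // mulr_natl.
(* [K] is the derivative of the gap [G] below divided by [2 * t]. It vanishes at [p], and its own
   derivative is a square over a positive quantity. *)
pose K t := 1 - p / t - (ln 2 + 2 * ln t - ln (p ^+ 2 + t ^+ 2)).
have K_ge0 t : p <= t -> 0 <= K t.
  move=> pt.
  have -> : 0 = K p.
    by rewrite /K divff ?gt_eqF // ln2p; ring.
  apply: (@derive_ge0_le K (fun x => p * (p - x) ^+ 2 / (x ^+ 2 * (p ^+ 2 + x ^+ 2))) p t pt) => x /andP[px xt].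
    have x0 : 0 < x by apply: lt_le_trans px.
    have px0 : 0 < p ^+ 2 + x ^+ 2 by rewrite addr_gt0 ?exprn_gt0.
    apply: dv_eq; first by rewrite /K; dv; rewrite ?gt_eqF.
    by rewrite /=; field; rewrite !gt_eqF.
  have x0 : 0 < x by apply: lt_le_trans px.
  apply: divr_ge0; apply: mulr_ge0; [exact: ltW|exact: sqr_ge0|exact: sqr_ge0|].
  by rewrite addr_ge0 ?sqr_ge0.
pose G t := (p - t) ^+ 2 - (p ^+ 2 * (2 * ln p) + t ^+ 2 * (2 * ln t)
   - (p ^+ 2 + t ^+ 2) * ln (p ^+ 2 + t ^+ 2) + ln 2 * (p ^+ 2 + t ^+ 2)).
have q0 : 0 < q by apply: lt_le_trans pq.
suff : 0 <= G q by rewrite /G /psi !lnXn // !mulr2n; lra.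
have -> : 0 = G p.
  by rewrite /G ln2p; ring.
apply: (@derive_ge0_le G (fun x => 2 * x * K x) p q pq) => x /andP[px xt]; last first.
  by rewrite mulr_ge0 ?K_ge0 // mulr_ge0 // (le_trans (ltW p0)).
have x0 : 0 < x by apply: lt_le_trans px.
have px0 : 0 < p ^+ 2 + x ^+ 2 by rewrite addr_gt0 ?exprn_gt0.
apply: dv_eq; first by rewrite /G; dv.
by rewrite /K /=; field; rewrite !gt_eqF.
Qed.

(** The left side is the first term of the expansion of ln t as 2 artanh ((t - 1) / (t + 1)). *)
Lemma ln_ge_ratio (t : R) : 1 <= t -> 2 * (t - 1) / (t + 1) <= ln t.
Proof.
move=> t1; rewrite -subr_ge0.
pose G x : R := ln x - 2 * (1 - 2 * (x + 1)^-1).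
have h x : 1 <= x -> G x = ln x - 2 * (x - 1) / (x + 1).
  by move=> x1; rewrite /G; field; rewrite gt_eqF //; lra.
rewrite -h //; have -> : 0 = G 1 by rewrite /G ln1; field.
apply: (@derive_ge0_le G (fun x => (x - 1) ^+ 2 / (x * (x + 1) ^+ 2)) 1 t t1) => x /andP[x1 xt]; last first.
  apply: divr_ge0; first exact: sqr_ge0.
  by apply: mulr_ge0; [lra|exact: sqr_ge0].
have x0 : 0 < x by lra.
have x10 : 0 < x + 1 by lra.
apply: dv_eq; first by rewrite /G; dv; rewrite ?gt_eqF.
by rewrite /=; field; rewrite !gt_eqF.
Qed.

(** Scalar form of the Stroock-Varopoulos inequality: it compares the Dirichlet form of a square
    root with the entropy production of the density. *)
Lemma log_sqrt_ineq (u v : R) : 0 < u -> 0 < v ->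
  4 * (u - v) ^+ 2 <= (u ^+ 2 - v ^+ 2) * (ln (u ^+ 2) - ln (v ^+ 2)).
Proof.
wlog vu : u v / v <= u => [hw u0 v0|u0 v0].
  have [h|/ltW h] := leP v u; first exact: hw.
  have := hw v u h v0 u0; rewrite -(sqrrN (v - u)) opprB; lra.
rewrite !lnXn // -mulrnBl -ln_div ?posrE //.
have h : 1 <= u / v by rewrite ler_pdivlMr // mul1r.
have := ln_ge_ratio h.
have -> : 2 * (u / v - 1) / (u / v + 1) = 2 * (u - v) / (u + v).
  by field; rewrite !gt_eqF // addr_gt0.
move=> hl.
have k0 : 0 <= u ^+ 2 - v ^+ 2 by rewrite subr_sqr mulr_ge0 ?subr_ge0 // addr_ge0 // ltW.
have := ler_wpM2l k0 hl.
have -> : (u ^+ 2 - v ^+ 2) * (2 * (u - v) / (u + v)) = 2 * (u - v) ^+ 2.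
  by field; rewrite gt_eqF // addr_gt0.
rewrite mulr2n; lra.
Qed.

(** The right side is twice the relative entropy of the law ((1 + m) / 2, (1 - m) / 2) to the fair
    coin. The endpoint [m = 1] is treated apart because the logarithm of [1 - m] is not
    differentiable there. *)
Lemma two_point_pinsker (m : R) : -1 <= m <= 1 -> m ^+ 2 <= psi (1 + m) + psi (1 - m).
Proof.
suff H k : 0 <= k <= 1 -> k ^+ 2 <= psi (1 + k) + psi (1 - k).
  move=> /andP[m1 m2]; have [m0|/ltW m0] := leP 0 m; first by apply: H; rewrite m0.
  by have := H (- m); rewrite opprK sqrrN [psi _ + _]addrC; apply; lra.
move=> /andP[k0 k1].
have [k1'|k1'] := ltP k 1; last first.
  have -> : k = 1 by lra.
  rewrite subrr psi0 addr0 /psi expr1n.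
  have := @ln_ge_ratio 2 (ler1n _ 2).
  have -> : 2 * (2 - 1) / (2 + 1) = 2 / 3 :> R by field.
  have -> : 1 + 1 = 2 :> R by []; lra.
rewrite -subr_ge0; pose G x := (1 + x) * ln (1 + x) + (1 - x) * ln (1 - x) - x ^+ 2.
have -> : 0 = G 0 by rewrite /G addr0 subr0 ln1 mulr0 expr0n /= addr0 subr0.
apply: (@derive_ge0_le G (fun x => ln (1 + x) - ln (1 - x) - 2 * x) 0 k k0) => x /andP[x0 xk].
  have p1 : 0 < 1 + x by lra.
  have p2 : 0 < 1 - x by lra.
  apply: dv_eq; first by rewrite /G; dv.
  by rewrite /=; field; rewrite !gt_eqF.
have p1 : 0 < 1 + x by lra.
have p2 : 0 < 1 - x by lra.
have h : 1 <= (1 + x) / (1 - x) by rewrite ler_pdivlMr //; lra.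
have := ln_ge_ratio h; rewrite ln_div ?posrE //.
have -> : 2 * ((1 + x) / (1 - x) - 1) / ((1 + x) / (1 - x) + 1) = 2 * x.
  by field; rewrite !gt_eqF //; lra.
lra.
Qed.

End Calculus.

Arguments psi {R} x.
Arguments eta {R} x.


(** * The quantum logarithmic Sobolev inequality *)

Section TraceInequalities.
Variable R : realType.
Local Notation C := (R[i]).
Local Open Scope complex_scope.

Lemma nsq_herm m (c : 'M[C]_m) k l : herm c -> nsq (c l k) = nsq (c k l).
Proof. by move=> hc; rewrite -{1}hc adjmxE nsqJ. Qed.

Lemma sum_swap_herm m (c : 'M[C]_m) (F : 'I_m -> 'I_m -> R) : herm c ->
  \sum_k \sum_l nsq (c k l) * F k l = \sum_k \sum_l nsq (c k l) * F l k.
Proof.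
move=> hc; rewrite exchange_big; apply: eq_bigr => k _; apply: eq_bigr => l _.
by rewrite nsq_herm.
Qed.

(** Variational form of the trace of the inverse, with equality at [W = A^-1]. It allows trial
    matrices to be inserted in place of an inverse that has no closed form. *)
Lemma rtr_inv_ge m (U W : 'M[C]_m) a A : spec U a A -> (forall j, 0 < a j) ->
  2 * rtr W - rtr (W^H *m A *m W) <= \sum_j (a j)^-1.
Proof.
move=> [hU ->] ha; have [w ew] : exists w, w = U^H *m W *m U by eexists.
have -> : rtr W = rtr w by rewrite ew rtrC mulmxA hU mul1mx.
have -> : rtr (W^H *m (U *m dg a *m U^H) *m W) = \sum_k \sum_l a k * nsq (w k l).
  have := rtr_dg_sandwich a (fun _ => 1) w.
  rewrite dg_const rmorph1 mulmx1 => e.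
  transitivity (rtr (dg a *m (w *m w^H))).
    have -> : W^H *m (U *m dg a *m U^H) *m W = (W^H *m U) *m (dg a *m U^H *m W).
      by rewrite !mulmxA.
    have -> : w *m w^H = U^H *m W *m (W^H *m U).
      by rewrite ew !adjmxM adjmxK !mulmxA -(mulmxA _ U) hU mulmx1.
    by rewrite rtrC !mulmxA.
  by rewrite mulmxA e; apply: eq_bigr => k _; apply: eq_bigr => l _; rewrite mulr1.
rewrite /rtr /mxtrace Re_sum mulr_sumr -sumrB; apply: ler_sum => k _.
have h1 : a k * nsq (w k k) <= \sum_l a k * nsq (w k l).
  rewrite (bigD1 k) //= lerDl; apply: sumr_ge0 => l _.
  by rewrite mulr_ge0 ?nsq_ge0 // ltW.
apply: (@le_trans _ _ (2 * Re (w k k) - a k * nsq (w k k))); first by rewrite lerD2l lerN2.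
(* Completing the square in the diagonal entry of the trial matrix. *)
have : 0 <= (a k)^-1 * (a k * Re (w k k) - 1) ^+ 2 + a k * Im (w k k) ^+ 2.
  by rewrite addr_ge0 // mulr_ge0 ?sqr_ge0 ?invr_ge0 // ltW.
have -> : (a k)^-1 * (a k * Re (w k k) - 1) ^+ 2 =
   a k * Re (w k k) ^+ 2 - 2 * Re (w k k) + (a k)^-1 by field; rewrite gt_eqF.
rewrite /nsq; lra.
Qed.

(** The right side is (x + y) / (x y)^2, and x y is at most the square of the mean. *)
Lemma inv_mean_ineq (x y : R) : 0 < x -> 0 < y ->
  2 / ((x + y) / 2) ^+ 3 <= 1 / (x ^+ 2 * y) + 1 / (y ^+ 2 * x).
Proof.
move=> x0 y0.
have -> : 1 / (x ^+ 2 * y) + 1 / (y ^+ 2 * x) = (x + y) / (x * y) ^+ 2.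
  by field; rewrite !gt_eqF.
have xy : 0 < x + y by rewrite addr_gt0.
have -> : 2 / ((x + y) / 2) ^+ 3 = (x + y) / (((x + y) / 2) ^+ 2) ^+ 2.
  by field; rewrite !gt_eqF.
rewrite ler_pM2l // lef_pV2 ?posrE ?exprn_gt0 ?mulr_gt0 ?divr_gt0 //.
have e : ((x + y) / 2) ^+ 2 = x * y + (x - y) ^+ 2 / 4 by field.
rewrite ler_sqr ?nnegrE ?sqr_ge0 ?(mulr_ge0 (ltW x0) (ltW y0)) // e lerDl.
by rewrite divr_ge0 ?sqr_ge0.
Qed.

(** [D + D * c * D] is the Neumann series of the inverse of [b - c] cut after its second term; it
    serves as trial matrix. *)
Lemma resolvent_expandD (T : pzRingType) (D c b : T) : D * b = 1 ->
  (D + D * c * D) * (b - c) * (D + D * c * D) =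
   D + D * c * D - D * c * D * c * D - D * c * D * c * D * c * D.
Proof.
move=> DZ; have -> : (D + D * c * D) * (b - c) = 1 - D * c * D * c.
  rewrite mulrBr !mulrDl DZ -(mulrA (D * c) D b) DZ mulr1.
  by rewrite opprD addrA addrK.
by rewrite mulrBl mul1r mulrDr !mulrA opprD addrA.
Qed.

Lemma resolvent_expandB (T : pzRingType) (D c b : T) : D * b = 1 ->
  (D - D * c * D) * (b + c) * (D - D * c * D) =
   D - D * c * D - D * c * D * c * D + D * c * D * c * D * c * D.
Proof.
move=> DZ; have := @resolvent_expandD T D (- c) b DZ.
by rewrite !(mulrN, mulNr, opprK).
Qed.

(** Two-term Neumann approximations are inserted into the variational formula for both signs of [c].
    In the sum the odd orders cancel, and the remaining tr(D c D c D) is symmetrized and bounded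
    below by [inv_mean_ineq]. *)
Lemma resolvent_ineq m (b : 'I_m -> R) (c U U' : 'M[C]_m) a a' : herm c ->
  (forall j, 0 < b j) -> (forall j, 0 < a j) -> (forall j, 0 < a' j) ->
  spec U a (dg b + c) -> spec U' a' (dg b - c) ->
  2 * \sum_j (b j)^-1 + 2 * \sum_k \sum_l nsq (c k l) / ((b k + b l) / 2) ^+ 3
    <= \sum_j (a j)^-1 + \sum_j (a' j)^-1.
Proof.
have aux (d1 e1 f1 g1 T A A' : R) : 2 * (d1 - e1) - (d1 - e1 - f1 + g1) <= A ->
  2 * (d1 + e1) - (d1 + e1 - f1 - g1) <= A' -> T <= f1 -> 2 * d1 + 2 * T <= A + A' by lra.
move=> hc b0 a0 a'0 hA hA'; have cH : c^H = c := hc.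
have [D eD] : exists D, D = dg (fun j => (b j)^-1) by eexists.
have hD : D^H = D by rewrite eD; exact: dg_adj.
have DZ : D *m dg b = 1%:M.
  rewrite eD dgM (@eq_dg _ _ _ (fun _ => 1)) ?dg_const ?rmorph1 // => j.
  by rewrite mulVf // gt_eqF.
have eS : rtr (D *m c *m D *m c *m D) =
    \sum_k \sum_l nsq (c k l) * ((b k)^-1 * (b k)^-1 * (b l)^-1).
  have := rtr_dg_sandwich (fun j => (b j)^-1 * (b j)^-1) (fun j => (b j)^-1) c.
  rewrite -dgM -eD cH => e; transitivity (rtr (D *m D *m c *m D *m c)).
    by rewrite rtrC !mulmxA.
  by rewrite e; apply: eq_bigr => k _; apply: eq_bigr => l _; rewrite mulrC.
have trD : rtr D = \sum_j (b j)^-1 by rewrite eD; exact: rtr_dg.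
have adj1 : (D *m c *m D)^H = D *m c *m D by rewrite !adjmxM hD cH mulmxA.
have h1 := rtr_inv_ge (D - D *m c *m D) hA a0.
have h2 := rtr_inv_ge (D + D *m c *m D) hA' a'0.
have e1 : rtr ((D + D *m c *m D) *m (dg b - c) *m (D + D *m c *m D)) =
   rtr D + rtr (D *m c *m D) - rtr (D *m c *m D *m c *m D) - rtr (D *m c *m D *m c *m D *m c *m D).
  by rewrite [X in rtr X](resolvent_expandD c DZ) !rtrB rtrD.
have e2 : rtr ((D - D *m c *m D) *m (dg b + c) *m (D - D *m c *m D)) =
   rtr D - rtr (D *m c *m D) - rtr (D *m c *m D *m c *m D) + rtr (D *m c *m D *m c *m D *m c *m D).
  by rewrite [X in rtr X](resolvent_expandB c DZ) rtrD !rtrB.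
move: h1 h2; rewrite adjmxB adjmxD adj1 hD e1 e2 rtrB rtrD.
have eT : \sum_k \sum_l nsq (c k l) / ((b k + b l) / 2) ^+ 3 <= rtr (D *m c *m D *m c *m D).
  rewrite -(ler_pM2l (ltr0n R 2)) [leRHS]mulr_natl mulr2n eS.
  rewrite [X in _ <= _ + X](sum_swap_herm _ hc) -big_split mulr_sumr /=.
  apply: ler_sum => k _; rewrite -big_split mulr_sumr /=; apply: ler_sum => l _.
  rewrite -mulrDr mulrCA ler_wpM2l ?nsq_ge0 //.
  have := inv_mean_ineq (b0 k) (b0 l).
  have -> : 1 / (b k ^+ 2 * b l) = (b k)^-1 * (b k)^-1 * (b l)^-1.
    by rewrite expr2 mul1r !invfM.
  by have -> : 1 / (b l ^+ 2 * b k) = (b l)^-1 * (b l)^-1 * (b k)^-1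
    by rewrite expr2 mul1r !invfM.
by rewrite -trD => h1 h2; exact: aux h1 h2 eT.
Qed.

Lemma parallelogram (T : pzRingType) (b c : T) :
  (b + c) * (b + c) + (b - c) * (b - c) = b * b + b * b + (c * c + c * c).
Proof.
rewrite !mulrDl !mulrDr !mulNr !mulrN opprK addrACA; congr (_ + _).
  by rewrite addrACA subrr addr0.
by rewrite addrACA subrr add0r.
Qed.

(** Antiderivatives in [S] of S^2 / (x + S) and S^2 / (x + S)^3. At [S = 0] they are [eta x / 2] and
    ln x + 3/2, so integrating the resolvent inequality against S^2 over the half-line gives one for
    [eta]. *)
Definition wfun (x S : R) : R := x ^+ 2 * ln (x + S) + S ^+ 2 / 2 - x * S.
Definition vfun (x S : R) : R := ln (x + S) + 2 * x / (x + S) - x ^+ 2 / 2 / (x + S) ^+ 2.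

Lemma wfun_deriv (x S : R) : 0 < x -> 0 <= S -> deriv_at (wfun x) S (S ^+ 2 / (x + S)).
Proof.
move=> x0 S0; have xS : 0 < x + S by rewrite ltr_wpDr.
by apply: dv_eq; [rewrite /wfun; dv | rewrite /=; field; rewrite gt_eqF].
Qed.

Lemma vfun_deriv (x S : R) : 0 < x -> 0 <= S -> deriv_at (vfun x) S (S ^+ 2 / (x + S) ^+ 3).
Proof.
move=> x0 S0; have xS : 0 < x + S by rewrite ltr_wpDr.
apply: dv_eq; first by rewrite /vfun; dv; rewrite ?expf_neq0 ?gt_eqF.
by rewrite /=; field; rewrite gt_eqF.
Qed.

Lemma wfun_asymp (x S : R) : 0 <= x -> 1 <= S ->
  0 <= wfun x S - (x ^+ 2 * ln S + S ^+ 2 / 2 - x * S) <= x ^+ 3 / S.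
Proof.
move=> x0 S1; have S0 : 0 < S by apply: lt_le_trans S1.
have /andP[h1 h2] := lnD_bound S0 x0.
have -> : wfun x S - (x ^+ 2 * ln S + S ^+ 2 / 2 - x * S) = x ^+ 2 * (ln (x + S) - ln S).
  by rewrite /wfun; ring.
rewrite mulr_ge0 ?sqr_ge0 //=; apply: le_trans (ler_wpM2l (sqr_ge0 x) h2) _.
by rewrite mulrA -exprSr.
Qed.

Lemma vfun_asymp (x S : R) : 0 < x -> 1 <= S -> ln S - x ^+ 2 / S <= vfun x S.
Proof.
move=> x0 S1; have S0 : 0 < S by apply: lt_le_trans S1.
have /andP[h1 _] := lnD_bound S0 (ltW x0).
have xS : 0 < x + S by rewrite addr_gt0.
have h2 : 0 <= 2 * x / (x + S) by rewrite divr_ge0 ?mulr_ge0 // ltW.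
have h3 : x ^+ 2 / 2 / (x + S) ^+ 2 <= x ^+ 2 / S.
  rewrite -mulrA ler_wpM2l ?sqr_ge0 // -invfM lef_pV2 ?posrE ?mulr_gt0 ?exprn_gt0 //.
  have : S * S <= (x + S) * (x + S) by rewrite ler_pM ?lerDr // ltW.
  rewrite expr2; have := ler_pM2l S0 1 S; rewrite S1 mulr1 => h; lra.
rewrite /vfun; lra.
Qed.

(* The second-order Taylor expansion of [t |-> tr eta (B + t C)] at [t = 0] is an upper
   bound: its resolvent representation has even derivatives of constant sign. *)
Lemma eta_second_order m (b : 'I_m -> R) (c U U' : 'M[C]_m) a a' : herm c ->
  (forall j, 0 < b j) -> (forall j, 0 < a j) -> (forall j, 0 < a' j) ->
  spec U a (dg b + c) -> spec U' a' (dg b - c) ->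
  \sum_j eta (a j) + \sum_j eta (a' j) <= 2 * \sum_j eta (b j) +
    2 * \sum_k \sum_l nsq (c k l) * (2 * ln ((b k + b l) / 2) + 3).
Proof.
move=> hc b0 a0 a'0 hA hA'.
pose mu k l := (b k + b l) / 2.
have mu0 k l : 0 < mu k l by rewrite divr_gt0 ?addr_gt0.
(* [W 0] is half the gap to be bounded. [W] increases by the resolvent inequality for the spectra
   shifted by [S], and is at most a constant over [S], so [W 0 <= 0]. *)
pose W S := \sum_j wfun (a j) S + \sum_j wfun (a' j) S - 2 * \sum_j wfun (b j) S
   - 2 * \sum_k \sum_l nsq (c k l) * vfun (mu k l) S.
pose dW S := S ^+ 2 * (\sum_j (a j + S)^-1 + \sum_j (a' j + S)^-1
   - (2 * \sum_j (b j + S)^-1 + 2 * \sum_k \sum_l nsq (c k l) / (mu k l + S) ^+ 3)).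
have hW S : 0 <= S -> deriv_at W S (dW S).
  move=> S0; apply: dv_eq.
    apply: dvB; first apply: dvB; first apply: dvD.
    - by apply: dv_sum => j; exact: wfun_deriv.
    - by apply: dv_sum => j; exact: wfun_deriv.
    - by apply: dvZ; apply: dv_sum => j; exact: wfun_deriv.
    - apply: dvZ; apply: dv_sum => k; apply: dv_sum => l; apply: dvZ.
      exact: vfun_deriv.
  rewrite /dW -!mulr_sumr.
  have -> : \sum_k \sum_l nsq (c k l) * (S ^+ 2 / (mu k l + S) ^+ 3) =
     S ^+ 2 * \sum_k \sum_l nsq (c k l) / (mu k l + S) ^+ 3.
    rewrite mulr_sumr; apply: eq_bigr => k _; rewrite mulr_sumr; apply: eq_bigr => l _.
    by rewrite mulrCA.
  by ring.
have dW0 S : 0 <= S -> 0 <= dW S.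
  move=> S0; rewrite /dW mulr_ge0 ?sqr_ge0 // subr_ge0.
  have hAS : spec U (fun j => a j + S) (dg (fun j => b j + S) + c).
    by rewrite -dgD dg_const addrAC; exact: spec_shift.
  have hAS' : spec U' (fun j => a' j + S) (dg (fun j => b j + S) - c).
    by rewrite -dgD dg_const addrAC; exact: spec_shift.
  have p (d : 'I_m -> R) : (forall j : 'I_m, 0 < d j) -> forall j, 0 < d j + S.
    by move=> h j; rewrite ltr_wpDr.
  have := resolvent_ineq hc (p _ b0) (p _ a0) (p _ a'0) hAS hAS'.
  have em : \sum_k \sum_l nsq (c k l) / ((b k + S + (b l + S)) / 2) ^+ 3 =
     \sum_k \sum_l nsq (c k l) / (mu k l + S) ^+ 3.
    apply: eq_bigr => k _; apply: eq_bigr => l _; congr (_ / _ ^+ 3).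
    by rewrite /mu; field.
  by rewrite em.
(* The terms of [W] that grow like ln S and S cancel because of these two moment identities. *)
have sq : \sum_j a j ^+ 2 + \sum_j a' j ^+ 2 =
   2 * \sum_j b j ^+ 2 + 2 * \sum_k \sum_l nsq (c k l).
  rewrite -(trfE (fun x => x ^+ 2) hA) -(trfE (fun x => x ^+ 2) hA').
  rewrite -(trf_sq (spec_herm hA)) -(trf_sq (spec_herm hA')) -(rtr_mulJ hc).
  have -> : \sum_j b j ^+ 2 = rtr (dg b *m dg b).
    by rewrite dgM rtr_dg; apply: eq_bigr => j _; rewrite expr2.
  by rewrite -rtrD [X in rtr X](parallelogram (dg b) c) !rtrD; ring.
have tr : \sum_j a j + \sum_j a' j = 2 * \sum_j b j.
  rewrite -(trfE id hA) -(trfE id hA') -(trf_id (spec_herm hA)) -(trf_id (spec_herm hA')).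
  by rewrite -(rtr_dg b) rtrD rtrB; ring.
have hK : W 0 <= 0.
  apply: (@le0_of_le_div _ _ (\sum_j a j ^+ 3 + \sum_j a' j ^+ 3 +
    2 * \sum_k \sum_l nsq (c k l) * mu k l ^+ 2)) => S S1.
  have S0 : 0 <= S by apply: le_trans S1.
  apply: (@le_trans _ _ (W S)).
    by apply: (@derive_ge0_le _ W dW 0 S S0) => x /andP[x0 _]; [exact: hW|exact: dW0].
  have up (d : 'I_m -> R) : (forall j, 0 < d j) ->
     \sum_j wfun (d j) S <= ln S * \sum_j d j ^+ 2 + m%:R * (S ^+ 2 / 2) - S * \sum_j d j
        + (\sum_j d j ^+ 3) / S.
    move=> d0; have -> : m%:R * (S ^+ 2 / 2) = \sum_(j < m) S ^+ 2 / 2.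
      by rewrite sumr_const card_ord mulr_natl.
    rewrite !mulr_sumr mulr_suml -big_split -sumrB -big_split /=; apply: ler_sum => j _.
    by have /andP[_] := wfun_asymp (ltW (d0 j)) S1; rewrite lerBlDl; lra.
  have lo : ln S * \sum_j b j ^+ 2 + m%:R * (S ^+ 2 / 2) - S * \sum_j b j <= \sum_j wfun (b j) S.
    have -> : m%:R * (S ^+ 2 / 2) = \sum_(j < m) S ^+ 2 / 2.
      by rewrite sumr_const card_ord mulr_natl.
    rewrite !mulr_sumr -big_split -sumrB /=; apply: ler_sum => j _.
    by have /andP[+ _] := wfun_asymp (ltW (b0 j)) S1; lra.
  have lv : ln S * \sum_k \sum_l nsq (c k l) - (\sum_k \sum_l nsq (c k l) * mu k l ^+ 2) / S
      <= \sum_k \sum_l nsq (c k l) * vfun (mu k l) S.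
    rewrite mulr_sumr mulr_suml -sumrB; apply: ler_sum => k _.
    rewrite mulr_sumr mulr_suml -sumrB; apply: ler_sum => l _.
    rewrite mulrC -mulrA -mulrBr ler_wpM2l ?nsq_ge0 //.
    exact: vfun_asymp.
  have := up a a0; have := up a' a'0; rewrite /W !mulrDl -mulrA.
  set la := \sum_j wfun (a j) S; set la' := \sum_j wfun (a' j) S.
  have e1 : ln S * \sum_j a j ^+ 2 + ln S * \sum_j a' j ^+ 2 =
      2 * (ln S * \sum_j b j ^+ 2) + 2 * (ln S * \sum_k \sum_l nsq (c k l)).
    by rewrite -mulrDr sq; ring.
  have e2 : S * \sum_j a j + S * \sum_j a' j = 2 * (S * \sum_j b j).
    by rewrite -mulrDr tr; ring.
  lra.
have ew d : 0 < d -> eta d = 2 * wfun d 0.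
  by move=> d0; rewrite etaE ?ltW // /wfun addr0 expr0n /= mul0r mulr0; ring.
have ev k l : 2 * ln ((b k + b l) / 2) + 3 = 2 * vfun (mu k l) 0.
  rewrite /vfun addr0 -/(mu k l); have := mu0 k l; move: (mu k l) => x x0.
  by field; rewrite gt_eqF.
have es (d : 'I_m -> R) : (forall j, 0 < d j) -> \sum_j eta (d j) = 2 * \sum_j wfun (d j) 0.
  by move=> d0; rewrite mulr_sumr; apply: eq_bigr => j _; exact: ew.
rewrite (es a a0) (es a' a'0) (es b b0).
have -> : \sum_k \sum_l nsq (c k l) * (2 * ln ((b k + b l) / 2) + 3) =
   2 * \sum_k \sum_l nsq (c k l) * vfun (mu k l) 0.
  rewrite mulr_sumr; apply: eq_bigr => k _; rewrite mulr_sumr; apply: eq_bigr => l _.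
  by rewrite ev mulrCA.
move: hK; rewrite /W; lra.
Qed.


Lemma two_Re_conj_le (z w : C) (x : R) : 0 < x ->
  2 * Re (z * Num.conj w) <= nsq z / x + x * nsq w.
Proof.
move=> x0; rewrite conjCE; case: z w => z1 z2 [w1 w2] /=; rewrite /nsq /=.
have : 0 <= ((z1 - x * w1) ^+ 2 + (z2 - x * w2) ^+ 2) / x.
  by rewrite divr_ge0 ?addr_ge0 ?sqr_ge0 // ltW.
have -> : ((z1 - x * w1) ^+ 2 + (z2 - x * w2) ^+ 2) / x =
  (z1 ^+ 2 + z2 ^+ 2) / x + x * (w1 ^+ 2 + w2 ^+ 2) - 2 * (z1 * w1 + z2 * w2).
  by field; rewrite gt_eqF.
lra.
Qed.

(* [X |-> <C, log ((L_X + R_X)/2) C>] is concave and its maximum on a Hilbert-Schmidt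
   sphere is at [X = |C|]; this is the resulting tangent inequality. *)
Lemma log_mean_le m (b y : 'I_m -> R) (c U : 'M[C]_m) :
  (forall j, 0 < b j) -> spec U y c ->
  \sum_k \sum_l nsq (c k l) * (2 * ln ((b k + b l) / 2)) <=
  \sum_j eta (y j) + \sum_j b j ^+ 2 - \sum_j y j ^+ 2.
Proof.
move=> b0 hC; have hc := spec_herm hC; have [hU eC] := hC.
pose mu k l := (b k + b l) / 2.
have mu0 k l : 0 < mu k l by rewrite divr_gt0 ?addr_gt0.
pose beta j := \sum_k b k * nsq (U k j).
(* [beta j] is the expectation of [dg b] in the j-th eigenvector of [c]. *)
have beta0 j : 0 <= beta j.
  by apply: sumr_ge0 => k _; rewrite mulr_ge0 ?nsq_ge0 // ltW.
(* [T j s] is the tangent at [|y j|] of the concave map x -> ln (x + s), evaluated at [beta j] and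
   weighted by [y j ^+ 2]. The weight removes the singular case [y j = 0]. The inequality sought is
   [F 0 <= 0], obtained from [F] increasing and being bounded by a constant over [s]. *)
pose T j s := y j ^+ 2 * (ln (`|y j| + s) + (beta j - `|y j|) / (`|y j| + s)).
pose dT j s := y j ^+ 2 * ((`|y j| + s)^-1 - (beta j - `|y j|) / (`|y j| + s) ^+ 2).
pose F s := \sum_k \sum_l nsq (c k l) * ln (mu k l + s) - \sum_j T j s.
pose dF s := \sum_k \sum_l nsq (c k l) * (mu k l + s)^-1 - \sum_j dT j s.
have hF s : 0 <= s -> deriv_at F s (dF s).
  move=> s0; apply: dvB.
    apply: dv_sum => k; apply: dv_sum => l; apply: dvZ.
    have p : 0 < mu k l + s by rewrite ltr_wpDr.
    by apply: dv_eq; [dv | rewrite /=; field; rewrite gt_eqF].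
  apply: dv_sum => j; rewrite /T /dT; have [->|nz] := eqVneq (y j) 0.
    rewrite expr0n /= mul0r; set f := (X in deriv_at X _ _).
    suff -> : f = (fun _ : R => 0 : R) by exact: dvcst.
    by apply: funext => t; rewrite /f mul0r.
  have p : 0 < `|y j| + s by rewrite ltr_wpDr ?normr_gt0.
  apply: dv_eq; first by dv; rewrite ?gt_eqF.
  by rewrite /=; field; rewrite gt_eqF.
have nc : \sum_k \sum_l nsq (c k l) = \sum_j y j ^+ 2.
  by rewrite -rtr_mulJ // trf_sq // (trfE _ hC).
have dF0 s : 0 <= s -> 0 <= dF s.
  move=> s0; rewrite /dF subr_ge0.
  (* The trial matrix c (|c| + s)^-1: for [dg b = |c|] the weighted Young inequality used below is
     an equality at it. *)
  pose om j := y j / (`|y j| + s).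
  have [W eW] : exists W, W = U *m dg om *m U^H by eexists.
  have hW : spec U om W by [].
  have WH : W^H = W := spec_herm hW.
  have e1 : \sum_k \sum_l Re (c k l * Num.conj (W k l)) = \sum_j y j * om j.
    transitivity (rtr (c *m W)).
      rewrite /rtr /mxtrace Re_sum; apply: eq_bigr => k _; rewrite mxE Re_sum.
      by apply: eq_bigr => l _; rewrite -{2}WH adjmxE.
    transitivity (rtr (dg y *m dg om)); last by rewrite dgM rtr_dg.
    rewrite -(rtr_conj (dg y *m dg om) hU) eC eW !mulmxA.
    by rewrite -(mulmxA _ U^H U) (unitaryV hU) mulmx1.
  have e2 : \sum_k \sum_l (mu k l + s) * nsq (W k l) = \sum_j om j ^+ 2 * (beta j + s).
    have eb : \sum_k \sum_l b k * nsq (W k l) = \sum_j om j ^+ 2 * beta j.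
      have := rtr_dg_sandwich b (fun _ => 1) W.
      rewrite dg_const rmorph1 mulmx1 WH => e.
      transitivity (rtr (dg b *m W *m W)).
        by rewrite e; apply: eq_bigr => k _; apply: eq_bigr => l _; rewrite mulr1.
      have := rtr_dg_sandwich b (fun j => om j ^+ 2) U => e'.
      transitivity (rtr (dg b *m U *m dg (fun j => om j ^+ 2) *m U^H)).
        have -> : dg (fun j => om j ^+ 2) = dg om *m dg om by rewrite dgM; exact: eq_dg.
        by rewrite eW !mulmxA -(mulmxA _ U^H U) (unitaryV hU) mulmx1.
      rewrite e' exchange_big; apply: eq_bigr => j _; rewrite mulr_sumr.
      by apply: eq_bigr => k _; ring.
    have en : \sum_k \sum_l nsq (W k l) = \sum_j om j ^+ 2.
      by rewrite -rtr_mulJ // trf_sq // (trfE _ hW).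
    have hWh : herm W := WH.
    have ebl : \sum_k \sum_l b l * nsq (W k l) = \sum_j om j ^+ 2 * beta j.
      rewrite -eb exchange_big; apply: eq_bigr => k _; apply: eq_bigr => l _.
      by rewrite nsq_herm.
    transitivity (2^-1 * (\sum_k \sum_l b k * nsq (W k l)) +
       2^-1 * (\sum_k \sum_l b l * nsq (W k l)) + s * \sum_k \sum_l nsq (W k l)).
      rewrite !mulr_sumr -!big_split; apply: eq_bigr => k _.
      rewrite !mulr_sumr -!big_split; apply: eq_bigr => l _.
      by rewrite /mu /=; ring.
    rewrite eb ebl en; under [RHS]eq_bigr do rewrite mulrDr.
    by rewrite big_split /= -mulr_suml; field.
  have h : 2 * (\sum_k \sum_l Re (c k l * Num.conj (W k l))) -
      \sum_k \sum_l (mu k l + s) * nsq (W k l) <= \sum_k \sum_l nsq (c k l) * (mu k l + s)^-1.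
    rewrite lerBlDr mulr_sumr -big_split; apply: ler_sum => k _.
    rewrite mulr_sumr -big_split; apply: ler_sum => l _ /=.
    by apply: two_Re_conj_le; rewrite ltr_wpDr.
  apply: le_trans h; rewrite e1 e2 mulr_sumr -sumrB; apply: ler_sum => j _.
  rewrite /dT /om; have [->|nz] := eqVneq (y j) 0.
    by rewrite expr0n /= !mul0r expr0n /= mul0r mulr0 subrr.
  have p : 0 < `|y j| + s by rewrite ltr_wpDr ?normr_gt0.
  rewrite le_eqVlt; apply/orP; left; apply/eqP; move: `|y j| p => ay p.
  by field; rewrite gt_eqF.
have F0 : F 0 <= 0.
  apply: (@le0_of_le_div _ _ (\sum_k \sum_l nsq (c k l) * mu k l +
      \sum_j y j ^+ 2 * `|y j|)) => s s1.
  have s0 : 0 < s by apply: lt_le_trans s1.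
  apply: (@le_trans _ _ (F s)).
    by apply: (@derive_ge0_le _ F dF 0 s (ltW s0)) => x /andP[x0 _]; [exact: hF|exact: dF0].
  have h1 : \sum_k \sum_l nsq (c k l) * ln (mu k l + s) <=
     (\sum_k \sum_l nsq (c k l)) * ln s + (\sum_k \sum_l nsq (c k l) * mu k l) / s.
    rewrite !mulr_suml -big_split; apply: ler_sum => k _.
    rewrite !mulr_suml -big_split; apply: ler_sum => l _ /=.
    rewrite -mulrA -mulrDr ler_wpM2l ?nsq_ge0 //.
    by have /andP[_] := lnD_bound s0 (ltW (mu0 k l)); rewrite lerBlDl.
  have h2 : (\sum_j y j ^+ 2) * ln s - (\sum_j y j ^+ 2 * `|y j|) / s <= \sum_j T j s.
    rewrite !mulr_suml -sumrB; apply: ler_sum => j _ /=.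
    rewrite -mulrA -mulrBr ler_wpM2l ?sqr_ge0 //.
    have /andP[+ _] := lnD_bound s0 (normr_ge0 (y j)); rewrite subr_ge0 => h.
    apply: lerD => //; rewrite mulrBl.
    have p : 0 < `|y j| + s by rewrite ltr_wpDl.
    have q1 : 0 <= beta j / (`|y j| + s) by rewrite divr_ge0 // ltW.
    have q2 : `|y j| / (`|y j| + s) <= `|y j| / s.
      by rewrite ler_wpM2l // lef_pV2 ?posrE // lerDr.
    by apply: (le_trans _ (lerD q1 (lexx _))); rewrite add0r lerN2.
  rewrite mulrDl /F; move: h1; rewrite nc; lra.
(* This use of the arithmetic-geometric mean inequality produces the two sums of squares of the
   conclusion. *)
have hb : \sum_j `|y j| * beta j <= 2^-1 * (\sum_j y j ^+ 2) + 2^-1 * (\sum_j b j ^+ 2).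
  have -> : \sum_j y j ^+ 2 = \sum_j \sum_k y j ^+ 2 * nsq (U k j).
    by apply: eq_bigr => j _; rewrite -mulr_sumr unitary_col // mulr1.
  have -> : \sum_j b j ^+ 2 = \sum_j \sum_k b k ^+ 2 * nsq (U k j).
    by rewrite exchange_big; apply: eq_bigr => j _; rewrite -mulr_sumr unitary_row // mulr1.
  rewrite !mulr_sumr -big_split; apply: ler_sum => j _ /=.
  rewrite !mulr_sumr -big_split; apply: ler_sum => k _ /=.
  rewrite !mulrA -mulrDl ler_wpM2r ?nsq_ge0 //.
  have := sqr_ge0 (`|y j| - b k); rewrite sqrrB real_normK ?num_real // mulr2n; lra.
have eT : \sum_j T j 0 = 2^-1 * (\sum_j eta (y j)) + \sum_j `|y j| * beta j - \sum_j y j ^+ 2.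
  rewrite mulr_sumr -big_split -sumrB; apply: eq_bigr => j _ /=.
  rewrite /T addr0 -(eta_norm (y j)) etaE //.
  have [->|nz] := eqVneq (y j) 0.
    by rewrite normr0 expr0n /= !mul0r !mulr0 !addr0 subr0.
  have p : `|y j| != 0 by rewrite normr_eq0.
  rewrite -[y j ^+ 2]real_normK ?num_real //; move: `|y j| p => a p.
  by field.
have eL : \sum_k \sum_l nsq (c k l) * (2 * ln ((b k + b l) / 2)) =
   2 * \sum_k \sum_l nsq (c k l) * ln (mu k l + 0).
  rewrite mulr_sumr; apply: eq_bigr => k _; rewrite mulr_sumr; apply: eq_bigr => l _.
  by rewrite addr0 mulrCA.
move: F0; rewrite /F eT eL; lra.
Qed.

End TraceInequalities.

(** * Entropy of a matrix against its even and odd parts *)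

Section EntropySplit.
Variable R : realType.
Local Notation C := (R[i]).
Local Open Scope complex_scope.

Lemma hermD m (A B : 'M[C]_m) : herm A -> herm B -> herm (A + B).
Proof. by rewrite /herm adjmxD => -> ->. Qed.

Lemma herm_scalar m (k : R) : herm ((k%:C)%:M : 'M[C]_m).
Proof. by rewrite /herm -dg_const dg_adj. Qed.

Lemma conjM m (Z A B : 'M[C]_m) : unitary Z ->
  Z *m (A *m B) *m Z^H = (Z *m A *m Z^H) *m (Z *m B *m Z^H).
Proof.
by move=> /unitaryV h; rewrite !mulmxA -(mulmxA _ Z^H Z) h mulmx1.
Qed.

Lemma odd_rtr0 m (Z A : 'M[C]_m) : unitary Z -> Z *m A *m Z^H = - A -> rtr A = 0.
Proof.
by move=> hZ e; have := rtr_conj A hZ; rewrite e rtrN; lra.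
Qed.

Lemma odd_even_rtr0 m (Z A B : 'M[C]_m) : unitary Z ->
  Z *m A *m Z^H = A -> Z *m B *m Z^H = - B -> rtr (A *m B) = 0.
Proof.
by move=> hZ eA eB; apply: (odd_rtr0 hZ); rewrite conjM // eA eB mulmxN.
Qed.

Lemma rtr_sqD m (B D : 'M[C]_m) : rtr (B *m D) = 0 ->
  rtr ((B + D) *m (B + D)) = rtr (B *m B) + rtr (D *m D).
Proof.
move=> h; rewrite mulmxDl !mulmxDr !rtrD (rtrC D B) h; ring.
Qed.

(* The derivative at [p = 2] of the Ball-Carlen-Lieb uniform convexity inequality. *)
Lemma entropy_split_pos m (B D Z : 'M[C]_m) : herm B -> herm D -> unitary Z ->
  Z *m B *m Z^H = B -> Z *m D *m Z^H = - D ->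
  (forall j, 0 < eig (B + D) j) -> (forall j, 0 < eig B j) ->
  trf eta (B + D) - psi (rtr ((B + D) *m (B + D))) <=
  (trf eta B - psi (rtr (B *m B))) + (trf eta D - psi (rtr (D *m D))) + 2 * rtr (D *m D).
Proof.
have aux1 (ta tb S g2 b2 ty p pb pg : R) : ta + ta <= 2 * tb + 2 * (S + 3 * g2) ->
  S <= ty - g2 * (ln g2 - ln b2) -> pb + g2 * (1 + ln b2) <= p -> pg = g2 * ln g2 ->
  ta - p <= tb - pb + (ty - pg) + 2 * g2 by lra.
move=> hB hD hZ eB eD pA pB.
have oBD := odd_even_rtr0 hZ eB eD.
rewrite (rtr_sqD oBD).
have [g0|] := leP (rtr (D *m D)) 0.
  have {}g0 : rtr (D *m D) = 0 by apply/le_anti; rewrite g0 rtr_sq_ge0.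
  rewrite g0 (rtr_sq_eq0 hD g0) !addr0 psi0 subr0 mulr0 addr0 lerDl.
  have h0 : spec 1%:M (fun _ => 0) (0 : 'M[C]_m).
    by split; [exact: unitary1 | rewrite dg0 mulmx0 mul0mx].
  by rewrite (trfE _ h0) big1 // => j _; rewrite eta0.
move=> g0.
have hA := hermD hB hD.
have sA := hermP hA; have sB := hermP hB; have sD := hermP hD.
have [V [b [eV eb]]] : exists V b, V = eigv B /\ b = eig B by do 2 eexists.
rewrite -eV -eb in sB; have [hV eBs] := sB.
have hVa := unitary_adj hV.
have b0 j : 0 < b j by rewrite eb.
have [c ec] : exists c, c = V^H *m D *m V^H^H by eexists.
have sc : spec (V^H *m eigv D) (eig D) c by rewrite ec; exact: spec_conj.
have dB : V^H *m B *m V^H^H = dg b.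
  by rewrite eBs adjmxK !mulmxA (unitaryV hV) mul1mx -mulmxA (unitaryV hV) mulmx1.
have s1 : spec (V^H *m eigv (B + D)) (eig (B + D)) (dg b + c).
  by have := spec_conj hVa sA; rewrite mulmxDr mulmxDl dB -ec.
(* Conjugation by [Z] turns [B + D] into [B - D], so both have the same eigenvalues and the
   symmetric second-order bound concerns [B + D] alone. *)
have s2 : spec (V^H *m (Z *m eigv (B + D))) (eig (B + D)) (dg b - c).
  have := spec_conj hVa (spec_conj hZ sA).
  by rewrite (mulmxDr Z) mulmxDl eB eD mulmxBr mulmxBl dB -ec.
have H1 := eta_second_order (spec_herm sc) b0 pA pA s1 s2.
have eg : \sum_k \sum_l nsq (c k l) = rtr (D *m D).
  by rewrite -(rtr_mulJ (spec_herm sc)) (trf_sq (spec_herm sc)) (trfE _ sc) (trf_sq hD).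
have ey : \sum_j eig D j ^+ 2 = rtr (D *m D) by rewrite (trf_sq hD).
have eb2 : \sum_j b j ^+ 2 = rtr (B *m B) by rewrite (trf_sq hB) (trfE _ sB).
have bb0 : 0 < rtr (B *m B).
  rewrite lt_neqAle rtr_sq_ge0 // andbT; apply/eqP => e.
  have [j _|nj] := pickP (fun j : 'I_m => true); last first.
    by move: g0; rewrite -ey (big_pred0 _ _ _ _ nj) ltxx.
  have := eb2; rewrite -e => /eqP; rewrite psumr_eq0 => [/allP /(_ j (mem_index_enum _))|? _].
    by rewrite /= sqrf_eq0 gt_eqF.
  exact: sqr_ge0.
(* Scaling [b] by [t] gives [t B] the Hilbert-Schmidt norm of [D], which is where the two sums of
   squares in [log_mean_le] cancel. *)
have [t et] : exists t, t = Num.sqrt (rtr (D *m D) / rtr (B *m B)) by eexists.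
have t0 : 0 < t by rewrite et sqrtr_gt0 divr_gt0.
have t2 : t ^+ 2 = rtr (D *m D) / rtr (B *m B) by rewrite et sqr_sqrtr // ltW // divr_gt0.
have lt : 2 * ln t = ln (rtr (D *m D)) - ln (rtr (B *m B)).
  by rewrite mulr_natl -lnXn // t2 ln_div ?posrE.
have H2 := @log_mean_le _ _ (fun j => t * b j) _ _ _ (fun j => mulr_gt0 t0 (b0 j)) sc.
have eS : \sum_k \sum_l nsq (c k l) * (2 * ln ((t * b k + t * b l) / 2)) =
   \sum_k \sum_l nsq (c k l) * (2 * ln ((b k + b l) / 2)) +
   rtr (D *m D) * (ln (rtr (D *m D)) - ln (rtr (B *m B))).
  rewrite -lt -eg mulr_suml -big_split; apply: eq_bigr => k _.
  rewrite mulr_suml -big_split; apply: eq_bigr => l _ /=.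
  have -> : (t * b k + t * b l) / 2 = t * ((b k + b l) / 2) by rewrite -mulrDr mulrA.
  have bkl : 0 < (b k + b l) / 2 by rewrite divr_gt0 ?addr_gt0.
  by rewrite (@lnM _ t) ?posrE //; ring.
have eT : \sum_j (t * b j) ^+ 2 = rtr (D *m D).
  under eq_bigr do rewrite exprMn.
  by rewrite -mulr_sumr eb2 t2 divfK // gt_eqF.
move: H2; rewrite eS eT ey => H2.
have eS3 : \sum_k \sum_l nsq (c k l) * (2 * ln ((b k + b l) / 2) + 3) =
  \sum_k \sum_l nsq (c k l) * (2 * ln ((b k + b l) / 2)) + 3 * rtr (D *m D).
  rewrite -eg mulr_sumr -big_split; apply: eq_bigr => k _.
  rewrite mulr_sumr -big_split; apply: eq_bigr => l _ /=.
  by rewrite mulrDr [_ * 3]mulrC.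
move: H1; rewrite eS3 => H1.
(* Convexity of [psi] at tr(B^2) absorbs the logarithm of the ratio of the two norms. *)
have ht := psi_tangent (addr_ge0 (ltW bb0) (ltW g0)) bb0.
rewrite addrAC subrr add0r in ht.
rewrite (trfE _ sB) [trf eta (B + D)]/trf [trf eta D]/trf.
apply: (aux1 _ _ _ _ _ _ _ _ _ H1 _ ht erefl).
by rewrite lerBrDr; apply: le_trans H2 _; rewrite addrK.
Qed.

(** A one-sided Lipschitz bound at 0. It is stable under sums, and [lip0_le] uses it to pass
    inequalities to the limit [d = 0]. *)
Definition lip0 (f : R -> R) := exists K, forall d, 0 < d <= 1 -> `|f d - f 0| <= K * d.

Lemma lip0D f g : lip0 f -> lip0 g -> lip0 (fun d => f d + g d).
Proof.
move=> [K hK] [L hL]; exists (K + L) => d hd; rewrite opprD addrACA mulrDl.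
by apply: le_trans (ler_normD _ _) (lerD (hK _ hd) (hL _ hd)).
Qed.

Lemma lip0N f : lip0 f -> lip0 (fun d => - f d).
Proof. by move=> [K hK]; exists K => d hd; rewrite -opprD normrN hK. Qed.

Lemma lip0_sum (I : Type) (r : seq I) (F : I -> R -> R) :
  (forall i, lip0 (F i)) -> lip0 (fun d => \sum_(i <- r) F i d).
Proof.
move=> h; elim: r => [|i r [K IH]].
  by exists 0 => d _; rewrite !big_nil subrr normr0 mul0r.
have [L hL] := h i; exists (L + K) => d hd; rewrite !big_cons opprD addrACA mulrDl.
by apply: le_trans (ler_normD _ _) (lerD (hL _ hd) (IH _ hd)).
Qed.

Lemma lip0_le f (c : R) : lip0 f -> (forall d, 0 < d <= 1 -> f d <= c) -> f 0 <= c.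
Proof.
move=> [K hK] h; rewrite -subr_le0; apply: (@le0_of_le_div _ _ K) => S S1.
have S0 : 0 < S by apply: lt_le_trans S1.
have hd : 0 < S^-1 <= 1 by rewrite invr_gt0 S0 invf_le1.
have := h _ hd; have := hK _ hd; rewrite ler_norml => /andP[h1 _] h2.
rewrite -/(K / S) in h1 *; lra.
Qed.

(** The increment lies between the tangent estimates of [psi] at its two endpoints. *)
Lemma psi_lip (t k d D : R) : 0 < t -> 0 <= k -> 0 < d <= 1 -> 0 <= D <= k * d ->
  `|psi (t + D) - psi t| <= k * (t + k + `|1 + ln t|) * d.
Proof.
move=> t0 k0 /andP[d0 d1] /andP[D0 Dk].
have s0 : 0 < t + D by rewrite ltr_wpDr.
have h1 := psi_tangent (ltW s0) t0; have h2 := psi_tangent (ltW t0) s0.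
have kd : k * d <= k by rewrite ler_piMr.
have l1 : 1 + ln (t + D) <= t + k.
  by have := ln_le_sub1 s0; lra.
have p1 : D * (1 + ln (t + D)) <= k * d * (t + k).
  apply: (@le_trans _ _ (D * (t + k))); first by rewrite ler_wpM2l.
  by rewrite ler_wpM2r // addr_ge0 // ltW.
have p2 : - (k * d * `|1 + ln t|) <= D * (1 + ln t).
  apply: (@le_trans _ _ (- (D * `|1 + ln t|))).
    by rewrite lerN2 ler_wpM2r.
  by rewrite -mulrN ler_wpM2l // lerNl -normrN ler_norm.
have q1 : 0 <= k * d * (t + k) by rewrite !mulr_ge0 ?addr_ge0 // ltW.
have q2 : 0 <= k * d * `|1 + ln t| by rewrite !mulr_ge0 // ltW.
have -> : k * (t + k + `|1 + ln t|) * d = k * d * (t + k) + k * d * `|1 + ln t| by ring.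
have e1 : t + D - t = D by ring.
have e2 : (t - (t + D)) = - D by ring.
rewrite e1 in h1; rewrite e2 in h2.
by rewrite ler_norml; apply/andP; split; lra.
Qed.

Lemma lip0_eta (x : R) : 0 <= x -> lip0 (fun d => eta (x + d)).
Proof.
rewrite le_eqVlt => /predU1P[<-|x0].
  (* At the origin [eta d] is 2 d (d ln d), and d ln d stays between -1 and 0. *)
  exists 2 => d /andP[d0 d1]; rewrite !add0r eta0 subr0 (etaE (ltW d0)).
  have h1 : ln d <= 0 by apply: ln_le0.
  have h2 : 1 - d^-1 <= ln d.
    have di : 0 < d^-1 by rewrite invr_gt0.
    by have := ln_le_sub1 di; rewrite lnV ?posrE //; lra.
  have h3 : -1 <= d * ln d.
    apply: (@le_trans _ _ (d * (1 - d^-1))); last by rewrite ler_wpM2l // ltW.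
    by rewrite mulrBr divff ?gt_eqF //; lra.
  have h4 : d * ln d <= 0 by rewrite pmulr_rle0.
  have -> : 2 * (d ^+ 2 * ln d) = 2 * d * (d * ln d) by ring.
  have d2 : 0 <= 2 * d by rewrite mulr_ge0 // ltW.
  rewrite ler_norml; apply/andP; split; last by rewrite ler_piMr // (le_trans h4).
  by rewrite -mulrN1 ler_wpM2l.
exists ((2 * x + 1) * (x ^+ 2 + (2 * x + 1) + `|1 + ln (x ^+ 2)|)) => d hd.
rewrite addr0 /eta sqrrD -addrA; apply: psi_lip => //; rewrite ?exprn_gt0 //.
  by rewrite addr_ge0 // mulr_ge0 // ltW.
case/andP: hd => d0 d1; rewrite mulr2n; apply/andP; split.
  by rewrite addr_ge0 ?sqr_ge0 // addr_ge0 // mulr_ge0 // ltW.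
have : d ^+ 2 <= d by rewrite expr2 ler_piMr // ltW.
rewrite mulrDl mul1r; lra.
Qed.

Lemma rtr_shift_sq m (A : 'M[C]_m) (d : R) :
  rtr ((A + (d%:C)%:M) *m (A + (d%:C)%:M)) = rtr (A *m A) + (2 * d * rtr A + m%:R * d ^+ 2).
Proof.
rewrite mulmxDl !mulmxDr mul_mx_scalar mul_scalar_mx !rtrD rtrZ.
have -> : rtr ((d%:C)%:M *m (d%:C)%:M : 'M[C]_m) = m%:R * d ^+ 2.
  rewrite -scalar_mxM -rmorphM -dg_const rtr_dg sumr_const card_ord.
  by rewrite expr2 mulr_natl.
ring.
Qed.

Lemma lip0_entropy m (A : 'M[C]_m) : psd A -> 0 < rtr (A *m A) ->
  lip0 (fun d => trf eta (A + (d%:C)%:M) - psi (rtr ((A + (d%:C)%:M) *m (A + (d%:C)%:M)))).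
Proof.
move=> hA a0; have sA := hermP (psd_herm hA).
have -> : (fun d => trf eta (A + (d%:C)%:M) - psi (rtr ((A + (d%:C)%:M) *m (A + (d%:C)%:M)))) =
  (fun d => \sum_j eta (eig A j + d) - psi (rtr (A *m A) + (2 * d * rtr A + m%:R * d ^+ 2))).
  by apply/funext => d; rewrite (trfE _ (spec_shift d sA)) rtr_shift_sq.
apply: lip0D; first by apply: lip0_sum => j; apply: lip0_eta; exact: psd_eig.
apply: lip0N.
have tA : 0 <= rtr A.
  by rewrite (trf_id (psd_herm hA)) sumr_ge0 // => j _; exact: psd_eig.
exists ((2 * rtr A + m%:R) * (rtr (A *m A) + (2 * rtr A + m%:R) + `|1 + ln (rtr (A *m A))|)).
move=> d hd; have -> : rtr (A *m A) + (2 * 0 * rtr A + m%:R * 0 ^+ 2) = rtr (A *m A).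
  by rewrite expr0n /=; ring.
apply: psi_lip => //; first by rewrite addr_ge0 // mulr_ge0.
case/andP: hd => d0 d1; apply/andP; split.
  by rewrite addr_ge0 // !mulr_ge0 ?sqr_ge0 // ltW.
rewrite [leRHS]mulrDl; apply: lerD; first by rewrite mulrAC.
by rewrite ler_wpM2l // expr2 ler_piMr // ltW.
Qed.

Lemma psd_shift_eig m (A : 'M[C]_m) (d : R) : psd A -> 0 < d ->
  forall j, 0 < eig (A + (d%:C)%:M) j.
Proof.
move=> hA d0 j.
have hd : herm (A + (d%:C)%:M) by apply: hermD; [exact: psd_herm|exact: herm_scalar].
have := spec_shift (- d) (hermP hd).
have -> : A + (d%:C)%:M + ((- d)%:C)%:M = A.
  rewrite -addrA -!dg_const dgD (@eq_dg _ _ _ (fun _ => 0)) ?dg0 ?addr0 // => k.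
  exact: subrr.
move=> /(psd_spec j hA); rewrite subr_ge0; exact: lt_le_trans.
Qed.

(** The strictly positive case is applied to [B + d] and [D]. The shift is even, so the grading is
    kept, and [d] tends to 0. *)
Lemma entropy_split m (B D Z : 'M[C]_m) : psd (B + D) -> psd B -> herm D -> unitary Z ->
  Z *m B *m Z^H = B -> Z *m D *m Z^H = - D ->
  trf eta (B + D) - psi (rtr ((B + D) *m (B + D))) <=
  (trf eta B - psi (rtr (B *m B))) + (trf eta D - psi (rtr (D *m D))) + 2 * rtr (D *m D).
Proof.
have aux (x y z t : R) : x <= y + z + t -> x + - y <= z + t by lra.
have aux2 (x y z t : R) : x + - y <= z + t -> x <= y + z + t by lra.
move=> hA hB hD hZ eB eD; have hBh := psd_herm hB.
have oBD := odd_even_rtr0 hZ eB eD.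
(* The limit needs a nonzero [B], since [psi] is not Lipschitz at 0. When [B = 0], the matrix [D] is
   positive semidefinite with zero trace, hence zero. *)
have [b0|] := leP (rtr (B *m B)) 0.
  have {}b0 : B = 0 by apply: rtr_sq_eq0 => //; apply/le_anti; rewrite b0 rtr_sq_ge0.
  have tD := odd_rtr0 hZ eD.
  suff D0 : D = 0.
    rewrite b0 D0 !addr0 mul0mx rtr0 psi0 mulr0 addr0.
    have h0 : spec 1%:M (fun _ => 0) (0 : 'M[C]_m).
      by split; [exact: unitary1 | rewrite dg0 mulmx0 mul0mx].
    by rewrite (trfE _ h0) big1 ?subr0 ?addr0 // => j _; rewrite eta0.
  move: hA; rewrite b0 add0r => hA; apply: (rtr_sq_eq0 hD).
  move: tD; rewrite (trf_id hD) (trf_sq hD) /trf => /eqP.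
  rewrite psumr_eq0 => [/allP h|j _]; last exact: psd_eig.
  by apply: big1 => j _; rewrite (eqP (h j (mem_index_enum _))) expr0n.
move=> b0.
have a0 : 0 < rtr ((B + D) *m (B + D)) by rewrite (rtr_sqD oBD) ltr_wpDr // rtr_sq_ge0.
have L := lip0D (lip0_entropy hA a0) (lip0N (lip0_entropy hB b0)).
have sh0 (M : 'M[C]_m) : M + ((0 : R)%:C)%:M = M by rewrite -dg_const dg0 addr0.
apply: aux2; move: L => /lip0_le; rewrite !sh0; apply => d /andP[d0 _].
apply: aux.
have cz : Z *m (B + (d%:C)%:M) *m Z^H = B + (d%:C)%:M.
  by rewrite mulmxDr mulmxDl eB mul_mx_scalar -scalemxAl hZ scalemx1.
have := @entropy_split_pos _ (B + (d%:C)%:M) D Z (hermD hBh (herm_scalar _ _)) hD hZ cz eD.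
rewrite addrAC; apply; exact: psd_shift_eig.
Qed.

End EntropySplit.

(** * Block decomposition along two complementary projections *)

Section Blocks.
Variable R : realType.
Local Notation C := (R[i]).
Local Open Scope complex_scope.
Variable m : nat.
Variables p q : 'M[C]_m.
Hypotheses (ph : p^H = p) (qh : q^H = q) (pp : p *m p = p) (qq : q *m q = q).
Hypotheses (pq : p *m q = 0) (qp : q *m p = 0) (pq1 : p + q = 1%:M).

Variable K : 'M[C]_m.
Hypothesis KE : K = p - q.

Lemma Kp : K *m p = p. Proof. by rewrite KE mulmxBl pp qp subr0. Qed.
Lemma pK : p *m K = p. Proof. by rewrite KE mulmxBr pp pq subr0. Qed.
Lemma Kq : K *m q = - q. Proof. by rewrite KE mulmxBl qq pq sub0r. Qed.
Lemma qK : q *m K = - q. Proof. by rewrite KE mulmxBr qq qp sub0r. Qed.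
Lemma Kh : K^H = K. Proof. by rewrite KE adjmxB ph qh. Qed.
Lemma KK : K *m K = 1%:M. Proof. by rewrite {2}KE mulmxBr Kp Kq opprK. Qed.
Lemma K_unitary : unitary K. Proof. by rewrite /unitary Kh KK. Qed.

Definition evenp (A : 'M[C]_m) := p *m A *m p + q *m A *m q.
Definition oddp (A : 'M[C]_m) := p *m A *m q + q *m A *m p.

Lemma even_odd A : A = evenp A + oddp A.
Proof.
rewrite /evenp /oddp -{1}(mul1mx A) -{1}(mulmx1 (1%:M *m A)) -pq1.
by rewrite !mulmxDl !mulmxDr -!addrA; congr (_ + _); rewrite addrA addrC.
Qed.

Lemma evenpK A : K *m evenp A *m K^H = evenp A.
Proof.
rewrite Kh /evenp mulmxDr mulmxDl !mulmxA Kp Kq -!(mulmxA _ _ K) pK qK.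
by rewrite !mulNmx !mulmxN opprK.
Qed.

Lemma oddpK A : K *m oddp A *m K^H = - oddp A.
Proof.
rewrite Kh /oddp mulmxDr mulmxDl !mulmxA Kp Kq -!(mulmxA _ _ K) pK qK.
by rewrite !mulNmx !mulmxN opprD.
Qed.

Lemma psd_sandwich (r A : 'M[C]_m) : r^H = r -> psd A -> psd (r *m A *m r).
Proof. by move=> rh hA; have := psd_conj r hA; rewrite rh. Qed.

Lemma oddp_herm A : herm A -> herm (oddp A).
Proof.
by rewrite /herm /oddp adjmxD !adjmxM ph qh => ->; rewrite !mulmxA addrC.
Qed.

Lemma blocks_mul0 A B : (p *m A *m p) *m (q *m B *m q) = 0.
Proof. by rewrite !mulmxA -(mulmxA _ p q) pq mulmx0 !mul0mx. Qed.

(** The condition [f 0 = 0] reflects that each block, as a full-size matrix, vanishes on the range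
    of the other projection. *)
Lemma fmx_block f (P Q : 'M[C]_m) : herm P -> herm Q -> f 0 = 0 ->
  p *m P = P -> P *m p = P -> q *m Q = Q -> Q *m q = Q ->
  fmx f (P + Q) = fmx f P + fmx f Q.
Proof.
move=> hP hQ f0 pP Pp qQ Qq.
have hPQ : herm (P + Q) by exact: hermD.
have qP : q *m P = 0 by rewrite -pP mulmxA qp mul0mx.
have pQ : p *m Q = 0 by rewrite -qQ mulmxA pq mul0mx.
have i1 := fmx_intertwine f hPQ hP (_ : p *m (P + Q) = P *m p).
have i2 := fmx_intertwine f hPQ hQ (_ : q *m (P + Q) = Q *m q).
have a1 : fmx f P *m q = 0.
  have := congr1 (@adjmx R m m) (fmx_annihilate hP f0 qP).
  by rewrite adjmxM qh (fmx_herm f hP) adjmx0.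
have a2 : fmx f Q *m p = 0.
  have := congr1 (@adjmx R m m) (fmx_annihilate hQ f0 pQ).
  by rewrite adjmxM ph (fmx_herm f hQ) adjmx0.
rewrite -(mul1mx (fmx f (P + Q))) -{1}pq1 mulmxDl i1 ?i2; last first.
- by rewrite mulmxDr pP pQ addr0 Pp.
- by rewrite mulmxDr qP qQ add0r Qq.
congr (_ + _).
  by rewrite -[RHS]mulmx1 -pq1 mulmxDr a1 addr0.
by rewrite -[RHS]mulmx1 -pq1 mulmxDr a2 add0r.
Qed.

Lemma sandP (r A : 'M[C]_m) : r *m r = r -> r *m (r *m A *m r) = r *m A *m r.
Proof. by move=> e; rewrite !mulmxA e. Qed.
Lemma sandP' (r A : 'M[C]_m) : r *m r = r -> (r *m A *m r) *m r = r *m A *m r.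
Proof. by move=> e; rewrite -!mulmxA e. Qed.
Lemma sand_herm (r A : 'M[C]_m) : r^H = r -> herm A -> herm (r *m A *m r).
Proof. by move=> e; rewrite /herm !adjmxM e => ->; rewrite mulmxA. Qed.

Lemma trf_even f A : herm A -> f 0 = 0 ->
  trf f (evenp A) = trf f (p *m A *m p) + trf f (q *m A *m q).
Proof.
move=> hA f0; have hP := sand_herm ph hA; have hQ := sand_herm qh hA.
rewrite (trf_fmx _ hP) (trf_fmx _ hQ) (trf_fmx _ (hermD hP hQ)) -rtrD; congr rtr.
by apply: fmx_block; rewrite ?sandP ?sandP'.
Qed.

Lemma rtr_even_sq A : rtr (evenp A *m evenp A) =
  rtr (p *m A *m p *m (p *m A *m p)) + rtr (q *m A *m q *m (q *m A *m q)).
Proof.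
rewrite rtr_sqD // blocks_mul0; exact: rtr0.
Qed.

(** The overlap of [A] with its conjugate by [G], with [G] a Pauli operator in the applications; the
    Dirichlet forms are assembled from such terms. *)
Definition qform (G A : 'M[C]_m) : R := rtr (A *m G *m A *m G^H).

Lemma qformD (G B D : 'M[C]_m) : qform G (B + D) =
  qform G B + rtr (B *m G *m D *m G^H) + rtr (D *m G *m B *m G^H) + qform G D.
Proof.
have e : (B + D) *m G *m (B + D) *m G^H =
    B *m G *m B *m G^H + B *m G *m D *m G^H + D *m G *m B *m G^H + D *m G *m D *m G^H.
  by rewrite (mulmxDl B D G) mulmxDr (mulmxDl _ _ B) (mulmxDl _ _ D) addrACA addrA
    (mulmxDl _ _ G^H) (mulmxDl _ _ G^H) (mulmxDl _ _ G^H) addrAC.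
by rewrite /qform e !rtrD.
Qed.

(** As [G] commutes with the reflection [K], the cross terms change sign under conjugation by [K]
    and have zero trace. *)
Lemma qform_even_odd (G A : 'M[C]_m) : K *m G = G *m K ->
  qform G A = qform G (evenp A) + qform G (oddp A).
Proof.
move=> cG.
have hK := K_unitary.
have eG : K *m G *m K^H = G by rewrite cG -mulmxA hK mulmx1.
have eGH : K *m G^H *m K^H = G^H by rewrite -{2}eG !adjmxM adjmxK mulmxA.
have cross (B D : 'M[C]_m) : K *m B *m K^H = B -> K *m D *m K^H = - D ->
   rtr (B *m G *m D *m G^H) = 0 /\ rtr (D *m G *m B *m G^H) = 0.
  move=> eB eD; split; apply: (odd_rtr0 hK); rewrite !conjM // eB eD eG eGH.
    by rewrite mulmxN mulNmx.
  by rewrite !mulNmx.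
have [c1 c2] := cross _ _ (evenpK A) (oddpK A).
by rewrite {1}(even_odd A) qformD c1 c2 !addr0.
Qed.

Lemma qform_blocks (G A : 'M[C]_m) : K *m G = G *m K ->
  qform G (evenp A) = qform G (p *m A *m p) + qform G (q *m A *m q).
Proof.
move=> cG.
have cross (B D : 'M[C]_m) : B *m K = B -> K *m D = - D -> rtr (B *m G *m D *m G^H) = 0.
  move=> e1 e2; have e : B *m G *m D *m G^H = - (B *m G *m D *m G^H).
    by rewrite -{1}e1 -(mulmxA B K G) cG !mulmxA -(mulmxA _ K D) e2 mulmxN mulNmx.
  by have := congr1 (@rtr R m) e; rewrite rtrN; lra.
have cross' (B D : 'M[C]_m) : B *m K = - B -> K *m D = D -> rtr (B *m G *m D *m G^H) = 0.
  move=> e1 e2; have e : B *m G *m D *m G^H = - (B *m G *m D *m G^H).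
    have e3 : B = - (B *m K) by rewrite e1 opprK.
    by rewrite {1}e3 !mulNmx -(mulmxA B K G) cG !mulmxA -(mulmxA _ K D) e2.
  by have := congr1 (@rtr R m) e; rewrite rtrN; lra.
have e1 : p *m A *m p *m K = p *m A *m p by rewrite -(mulmxA _ p K) pK.
have e2 : K *m (p *m A *m p) = p *m A *m p by rewrite !mulmxA Kp.
have e3 : q *m A *m q *m K = - (q *m A *m q) by rewrite -(mulmxA _ q K) qK mulmxN.
have e4 : K *m (q *m A *m q) = - (q *m A *m q) by rewrite !mulmxA Kq !mulNmx.
by rewrite /evenp qformD (cross _ _ e1 e4) (cross' _ _ e3 e2) !addr0.
Qed.

End Blocks.

(** * Absolute value of a Hermitian matrix *)

Section Absolute.
Variable R : realType.
Local Notation C := (R[i]).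
Local Open Scope complex_scope.
Variable m : nat.

Definition absmx (A : 'M[C]_m) : 'M[C]_m := fmx Num.norm A.

Lemma absmx_psd A : herm A -> psd (absmx A).
Proof. by move=> hA; apply: psd_fmx => // j; exact: normr_ge0. Qed.

Lemma absmx_sq A : herm A -> absmx A *m absmx A = A *m A.
Proof.
move=> hA; rewrite -{3 4}(fmx_id hA) !fmxM //; apply: eq_fmx => x.
by rewrite -!expr2 real_normK ?num_real.
Qed.

Lemma trf_absmx A : herm A -> trf eta (absmx A) = trf eta A.
Proof.
move=> hA; rewrite (trfE _ (spec_fmx Num.norm hA)).
by apply: eq_bigr => j _; rewrite eta_norm.
Qed.

Lemma fmxN f (A : 'M[C]_m) : herm A -> fmx f (- A) = fmx (fun x => f (- x)) A.
Proof.
move=> hA; have [hU e] := hermP hA.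
have s : spec (eigv A) (fun j => - eig A j) (- A).
  by split=> //; rewrite -dgN mulmxN mulNmx -e.
by rewrite (fmxE f s).
Qed.

Lemma absmx_commute (K A : 'M[C]_m) : herm A -> K *m A = - A *m K ->
  K *m absmx A = absmx A *m K.
Proof.
move=> hA e; have hN : herm (- A) by rewrite /herm adjmxN hA.
have eN : fmx Num.norm (- A) = absmx A.
  by rewrite (fmxN _ hA); apply: eq_fmx => x; rewrite normrN.
by rewrite /absmx (fmx_intertwine _ hA hN e) eN.
Qed.

(** In the eigenbasis the overlap is a sum of products of eigenvalues with nonnegative weights, so
    taking absolute values can only increase it. *)
Lemma qform_absmx (G A : 'M[C]_m) : herm A -> qform G A <= qform G (absmx A).
Proof.
move=> hA; have := rtr_spec2 G id id (hermP hA) (hermP hA).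
rewrite (fmx_id hA) /qform => ->.
rewrite (rtr_spec2 G Num.norm Num.norm (hermP hA) (hermP hA)).
apply: ler_sum => k _; apply: ler_sum => l _.
by rewrite ler_wpM2r ?nsq_ge0 // -normrM ler_norm.
Qed.

Lemma rtr_scaleM (k l : R) (A B : 'M[C]_m) :
  rtr ((k%:C *: A) *m (l%:C *: B)) = k * l * rtr (A *m B).
Proof. by rewrite -scalemxAl rtrZ -scalemxAr rtrZ mulrA. Qed.

Lemma rtr_CS (A B : 'M[C]_m) : herm A -> herm B ->
  rtr (A *m B) <= Num.sqrt (rtr (A *m A)) * Num.sqrt (rtr (B *m B)).
Proof.
move=> hA hB; have a0 := rtr_sq_ge0 hA; have b0 := rtr_sq_ge0 hB.
have := a0; rewrite le_eqVlt => /predU1P[e|a1].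
  by rewrite (rtr_sq_eq0 hA (esym e)) !mul0mx rtr0 sqrtr0 mul0r.
have := b0; rewrite le_eqVlt => /predU1P[e|b1].
  by rewrite (rtr_sq_eq0 hB (esym e)) !mulmx0 rtr0 sqrtr0 mulr0.
have sa : 0 < Num.sqrt (rtr (A *m A)) by rewrite sqrtr_gt0.
have sb : 0 < Num.sqrt (rtr (B *m B)) by rewrite sqrtr_gt0.
have hz (k : R) (M : 'M[C]_m) : herm M -> herm (k%:C *: M).
  by rewrite /herm adjmxZ conj_real => ->.
have := rtr_mul_le (hz (Num.sqrt (rtr (B *m B))) _ hA) (hz (Num.sqrt (rtr (A *m A))) _ hB).
rewrite !rtr_scaleM.
have := sqr_sqrtr a0; have := sqr_sqrtr b0.
move: (Num.sqrt _) (Num.sqrt _) sa sb => u v u0 v0 <- <- h.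
rewrite -(ler_pM2l (_ : 0 < 2 * (u * v))) ?mulr_gt0 //.
by move: h; rewrite !expr2; lra.
Qed.

End Absolute.

(** * Splitting off one qubit *)

Section OneQubit.
Variable R : realType.
Local Notation C := (R[i]).
Local Open Scope complex_scope.
Variable m : nat.
Variables p q K X : 'M[C]_m.
Hypotheses (ph : p^H = p) (qh : q^H = q) (pp : p *m p = p) (qq : q *m q = q).
Hypotheses (pq : p *m q = 0) (qp : q *m p = 0) (pq1 : p + q = 1%:M).
Hypothesis KE : K = p - q.
Hypotheses (Xh : X^H = X) (XX : X *m X = 1%:M) (Xp : X *m p = q *m X) (Xq : X *m q = p *m X).

(** This is tr(A (A - E A)), where E averages over the conjugations by 1, Z, X and ZX: the Dirichlet
    form of depolarizing noise on one qubit. *)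
Definition dirq (Z X A : 'M[C]_m) : R :=
  4^-1 * (3 * rtr (A *m A) - qform Z A - qform X A - qform (Z *m X) A).

Let hK : unitary K := K_unitary ph qh pp qq pq qp pq1 KE.
Let hKh : K^H = K := Kh ph qh KE.
Let hX : unitary X. Proof. by rewrite /unitary Xh XX. Qed.

Lemma XK : X *m K = - (K *m X).
Proof. by rewrite KE mulmxBr mulmxBl Xp Xq opprB. Qed.

Lemma conjK_odd (D : 'M[C]_m) : K *m D *m K^H = - D -> K *m (X *m D *m X) *m K^H = - (X *m D *m X).
Proof.
rewrite hKh => e.
have -> : K *m (X *m D *m X) *m K = (K *m X) *m D *m (X *m K) by rewrite !mulmxA.
have -> : (K *m X) *m D *m (X *m K) = (X *m K) *m D *m (K *m X).
  by rewrite XK mulmxN !mulNmx.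
have -> : X *m K *m D *m (K *m X) = X *m (K *m D *m K) *m X by rewrite !mulmxA.
by rewrite e mulmxN mulNmx.
Qed.

Lemma qform_K (B D : 'M[C]_m) : K *m B *m K^H = B -> K *m D *m K^H = - D ->
  qform K (B + D) = rtr (B *m B) - rtr (D *m D).
Proof.
move=> eB eD; rewrite /qform -!mulmxA (mulmxA K) mulmxDr mulmxDl eB eD.
by rewrite mulmxDl !mulmxBr rtrD !rtrB (rtrC D B); ring.
Qed.

(** The contributions of the odd part to the two overlaps cancel, since conjugation by [K] changes
    its sign. *)
Lemma qform_X (B D : 'M[C]_m) : K *m B *m K^H = B -> K *m D *m K^H = - D ->
  qform X (B + D) + qform (K *m X) (B + D) = 2 * rtr (B *m (X *m B *m X)).
Proof.
move=> eB eD; have cz := odd_even_rtr0 hK eB (conjK_odd eD).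
have -> : qform X (B + D) = rtr ((B + D) *m (X *m (B + D) *m X)).
  by rewrite /qform Xh !mulmxA.
have -> : qform (K *m X) (B + D) = rtr ((B - D) *m (X *m (B + D) *m X)).
  have -> : (B - D) = K *m (B + D) *m K^H by rewrite mulmxDr mulmxDl eB eD.
  rewrite /qform adjmxM Xh hKh; move: (B + D) => M.
  by rewrite (mulmxA _ X K) rtrC !mulmxA.
rewrite mulmxDl mulmxBl rtrD rtrB.
have -> : rtr (B *m (X *m (B + D) *m X)) = rtr (B *m (X *m B *m X)).
  by rewrite (mulmxDr X) mulmxDl mulmxDr rtrD cz addr0.
by move: (rtr _) (rtr _) => x y; ring.
Qed.

(** [X] exchanges the two diagonal blocks, so only the overlap of one block with the flipped other
    one survives, and Cauchy-Schwarz bounds it. *)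
Lemma rtr_flip (A : 'M[C]_m) : herm A ->
  rtr (evenp p q A *m (X *m evenp p q A *m X)) <=
  2 * (Num.sqrt (rtr (p *m A *m p *m (p *m A *m p))) *
       Num.sqrt (rtr (q *m A *m q *m (q *m A *m q)))).
Proof.
move=> hA; rewrite /evenp (mulmxDr X) (mulmxDl _ _ X).
have e1 : X *m (p *m A *m p) *m X = q *m (X *m A *m X) *m q.
  by rewrite !mulmxA Xp -(mulmxA _ p X) -Xq !mulmxA.
have e2 : X *m (q *m A *m q) *m X = p *m (X *m A *m X) *m p.
  by rewrite !mulmxA Xq -(mulmxA _ q X) -Xp !mulmxA.
have hP := sand_herm ph hA; have hQ := sand_herm qh hA.
have z1 : p *m A *m p *m (X *m (p *m A *m p) *m X) = 0 by rewrite e1 (blocks_mul0 pq).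
have z2 : q *m A *m q *m (X *m (q *m A *m q) *m X) = 0 by rewrite e2 (blocks_mul0 qp).
have sw : rtr (q *m A *m q *m (X *m (p *m A *m p) *m X)) =
          rtr (p *m A *m p *m (X *m (q *m A *m q) *m X)).
  move: (p *m A *m p) (q *m A *m q) => P Q.
  by rewrite (mulmxA Q) (mulmxA Q) rtrC (mulmxA X) (mulmxA X) rtrC !mulmxA.
have hXQ : herm (X *m (q *m A *m q) *m X) by exact: sand_herm.
have nx : rtr (X *m (q *m A *m q) *m X *m (X *m (q *m A *m q) *m X)) =
          rtr (q *m A *m q *m (q *m A *m q)).
  move: (q *m A *m q) => Q; have := conjM Q Q hX; rewrite Xh => <-.
  by have := rtr_conj (Q *m Q) hX; rewrite Xh.
have := rtr_CS hP hXQ; rewrite nx; clear e1 e2 hP hQ nx hXQ.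
move: (p *m A *m p) (q *m A *m q) z1 z2 sw => P Q z1 z2 sw h.
by rewrite mulmxDl (mulmxDr P) (mulmxDr Q) z1 z2 add0r addr0 rtrD sw mulr_natl mulr2n lerD.
Qed.

(** [D] anticommutes with [K], so [|D|] commutes with it and is block diagonal. The two blocks have
    the same norm because tr(D^2 K) = 0. *)
Lemma rtr_odd_blocks (D : 'M[C]_m) : herm D -> K *m D *m K^H = - D ->
  rtr (p *m absmx D *m p *m (p *m absmx D *m p)) = rtr (D *m D) / 2 /\
  rtr (q *m absmx D *m q *m (q *m absmx D *m q)) = rtr (D *m D) / 2 /\
  absmx D = evenp p q (absmx D).
Proof.
move=> hD eD.
have KD : K *m D = - D *m K.
  by have := congr1 (fun M => M *m K) eD; rewrite /= -(mulmxA _ K^H K) (unitaryV hK) mulmx1.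
have cK := absmx_commute hD KD.
have aE : absmx D = evenp p q (absmx D).
  have e0 : p *m absmx D *m q = 0 /\ q *m absmx D *m p = 0.
    move: (absmx D) cK => M cK; split.
      have h : p *m M *m q = - (p *m M *m q).
        by rewrite -{1}(pK pp pq KE) -(mulmxA p K M) cK !mulmxA -(mulmxA _ K q) (Kq qq pq KE) mulmxN.
      by apply/matrixP => i j; have /matrixP/(_ i j) := h; rewrite !mxE; move/eqP; rewrite -addr_eq0 -mulr2n mulrn_eq0 /= => /eqP.
    have h : q *m M *m p = - (q *m M *m p).
      have e1 := qK qq qp KE; have e2 : q = - (q *m K) by rewrite e1 opprK.
      by rewrite {1}e2 !mulNmx -(mulmxA q K M) cK !mulmxA -(mulmxA _ K p) (Kp pp qp KE).
    by apply/matrixP => i j; have /matrixP/(_ i j) := h; rewrite !mxE; move/eqP; rewrite -addr_eq0 -mulr2n mulrn_eq0 /= => /eqP.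
  by rewrite {1}(even_odd pq1 (absmx D)) /oddp e0.1 e0.2 !addr0.
have s1 := rtr_even_sq pq (absmx D); rewrite -aE absmx_sq // in s1.
have s2 : rtr (p *m absmx D *m p *m (p *m absmx D *m p)) =
          rtr (q *m absmx D *m q *m (q *m absmx D *m q)).
  have z : rtr (D *m D *m K) = 0.
    have DK : D *m K = - (K *m D) by rewrite KD mulNmx opprK.
    have : rtr (D *m D *m K) = - rtr (D *m D *m K).
      by rewrite -{1}(mulmxA D D K) DK mulmxN rtrN (mulmxA D K D) rtrC mulmxA.
    by move: (rtr _) => x; lra.
  have e : rtr (D *m D *m K) = rtr (p *m absmx D *m p *m (p *m absmx D *m p)) -
          rtr (q *m absmx D *m q *m (q *m absmx D *m q)).
    rewrite -absmx_sq // {1 2}aE /evenp; move: (absmx D) => M.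
    rewrite -mulmxA mulmxDl (mulmxDl _ _ K).
    rewrite -(mulmxA (p *m M) p K) (pK pp pq KE) -(mulmxA (q *m M) q K) (qK qq qp KE) mulmxN.
    by rewrite !mulmxBr (blocks_mul0 pq) (blocks_mul0 qp) subr0 sub0r rtrD rtrN.
  by apply/eqP; rewrite -subr_eq0 -e z.
have half (x y z : R) : z = x + y -> x = y -> x = z / 2 /\ y = z / 2.
  by move=> -> ->; split; field.
by have [? ?] := half _ _ _ s1 s2; split; [|split].
Qed.

(** The cost of the splitting is exactly the Dirichlet form. The entropy split contributes 2
    tr(D^2), and the two-point inequality contributes (x - y)^2, where x and y are the norms of the
    diagonal blocks. The blocks of [|D|] have equal norms, so their two-point entropy accounts for
    ln 2 tr(D^2) with no loss. *)
Lemma one_qubit_entropy (A : 'M[C]_m) (D := oddp p q A) : psd A ->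
  trf eta A - psi (rtr (A *m A)) + ln 2 * rtr (A *m A) <=
  (trf eta (p *m A *m p) - psi (rtr (p *m A *m p *m (p *m A *m p)))) +
  (trf eta (q *m A *m q) - psi (rtr (q *m A *m q *m (q *m A *m q)))) +
  (trf eta (p *m absmx D *m p) - psi (rtr (p *m absmx D *m p *m (p *m absmx D *m p)))) +
  (trf eta (q *m absmx D *m q) - psi (rtr (q *m absmx D *m q *m (q *m absmx D *m q)))) +
  2 * dirq K X A.
Proof.
have aux (eA pA l a eB eP eQ pB b x y pP pQ eD pD d eY eW pY pW f1 f2 sx dd : R) :
  eA - pA <= eB - pB + (eD - pD) + 2 * d -> a = b + d -> eB = eP + eQ ->
  pP + pQ - pB + l * b <= (x - y) ^+ 2 -> eD = eY + eW ->
  pD = pY + pW + l * d -> f1 = b - d -> f2 = 2 * sx -> sx <= 2 * (x * y) ->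
  b = x ^+ 2 + y ^+ 2 -> dd = 4^-1 * (3 * a - f1 - f2) ->
  eA - pA + l * a <= eP - pP + (eQ - pQ) + (eY - pY) + (eW - pW) + 2 * dd.
  by move=> h1 -> h3 h4 h5 h6 -> -> h9 hb ->; rewrite sqrrB in h4; lra.
move=> hA; have hAh := psd_herm hA.
have eA := even_odd pq1 A.
have eB := evenpK ph qh pp qq pq qp KE A.
have eD := oddpK ph qh pp qq pq qp KE A.
have hD := oddp_herm ph qh hAh.
have hB : psd (evenp p q A) by apply: psdD; apply: psd_sandwich.
have [y1 [y2 aE]] := rtr_odd_blocks hD eD.
have d0 := rtr_sq_ge0 hD.
have hP := rtr_sq_ge0 (sand_herm ph hAh); have hQ := rtr_sq_ge0 (sand_herm qh hAh).
have h1 : trf eta A - psi (rtr (A *m A)) <=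
  (trf eta (evenp p q A) - psi (rtr (evenp p q A *m evenp p q A))) +
  (trf eta D - psi (rtr (D *m D))) + 2 * rtr (D *m D).
  have := @entropy_split _ _ (evenp p q A) (oddp p q A) K; rewrite -eA; exact.
have fK := qform_K eB eD; rewrite -eA in fK.
have fX := qform_X eB eD; rewrite -eA in fX.
apply: (aux _ _ _ _ _ _ _ _ _ _ _ _ _ _ _ _ _ _ _ _ _ _ _ _ h1).
- by rewrite {1 2}eA; apply: rtr_sqD; exact: odd_even_rtr0 hK eB eD.
- by apply: (trf_even ph qh pp qq pq qp pq1 hAh); exact: eta0.
- have := two_point_lsi (sqrtr_ge0 (rtr (p *m A *m p *m (p *m A *m p))))
    (sqrtr_ge0 (rtr (q *m A *m q *m (q *m A *m q)))).
  by rewrite !sqr_sqrtr // -(rtr_even_sq pq A); exact.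
- by rewrite -(trf_absmx hD) {1}aE; apply: (trf_even ph qh pp qq pq qp pq1); [exact: psd_herm (absmx_psd hD)|exact: eta0].
- rewrite y1 y2 -/D; have x0 : 0 <= rtr (D *m D) / 2 by rewrite divr_ge0.
  have -> : rtr (D *m D) = 2 * (rtr (D *m D) / 2) by field.
  by rewrite psi_scale //; move: (rtr _ / 2) => x; rewrite (_ : 2 * x / 2 = x); [ring|field].
- exact: fK.
- exact: fX.
- exact: rtr_flip.
- by rewrite !sqr_sqrtr //; exact: rtr_even_sq.
- by rewrite /dirq opprD !addrA.
Qed.

Lemma one_qubit_sq (A : 'M[C]_m) (D := oddp p q A) : herm A ->
  rtr (A *m A) = rtr (p *m A *m p *m (p *m A *m p)) + rtr (q *m A *m q *m (q *m A *m q)) +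
   rtr (p *m absmx D *m p *m (p *m absmx D *m p)) + rtr (q *m absmx D *m q *m (q *m absmx D *m q)).
Proof.
move=> hA; have eB := evenpK ph qh pp qq pq qp KE A.
have eD := oddpK ph qh pp qq pq qp KE A.
have [y1 [y2 _]] := rtr_odd_blocks (oddp_herm ph qh hA) eD.
rewrite y1 y2 {1 2}(even_odd pq1 A) (rtr_sqD (odd_even_rtr0 hK eB eD)) (rtr_even_sq pq) -/D.
by field.
Qed.

Lemma qform_one_qubit (G A : 'M[C]_m) (D := oddp p q A) : herm A -> K *m G = G *m K ->
  qform G A <= qform G (p *m A *m p) + qform G (q *m A *m q) +
    qform G (p *m absmx D *m p) + qform G (q *m absmx D *m q).
Proof.
move=> hA cG; have hD := oddp_herm ph qh hA.
have eD := oddpK ph qh pp qq pq qp KE A.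
have [_ [_ aE]] := rtr_odd_blocks hD eD.
rewrite (qform_even_odd ph qh pp qq pq qp pq1 KE A cG) (qform_blocks pp qq pq qp KE A cG).
rewrite -[leRHS]addrA lerD2l -(qform_blocks pp qq pq qp KE (absmx D) cG) -aE.
exact: qform_absmx.
Qed.

(** Passing to the four blocks preserves the total squared norm and can only increase the overlaps,
    so the Dirichlet forms of the other qubits add up to no more than before. This makes the
    induction over qubits possible. *)
Lemma dirq_one_qubit (Z' X' A : 'M[C]_m) (D := oddp p q A) : herm A ->
  K *m Z' = Z' *m K -> K *m X' = X' *m K ->
  dirq Z' X' (p *m A *m p) + dirq Z' X' (q *m A *m q) +
  dirq Z' X' (p *m absmx D *m p) + dirq Z' X' (q *m absmx D *m q) <= dirq Z' X' A.
Proof.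
move=> hA cZ cX; have cZX : K *m (Z' *m X') = Z' *m X' *m K.
  by rewrite mulmxA cZ -mulmxA cX mulmxA.
have := qform_one_qubit hA cZ; have := qform_one_qubit hA cX; have := qform_one_qubit hA cZX.
rewrite /dirq (one_qubit_sq hA) -/D.
move: (qform _ _) (qform _ _) (qform _ _) (qform _ _) (qform _ _).
move: (qform _ _) (qform _ _) (qform _ _) (qform _ _) (qform _ _).
move: (qform _ _) (qform _ _) (qform _ _) (qform _ _) (qform _ _).
move: (rtr _) (rtr _) (rtr _) (rtr _) => *; lra.
Qed.

End OneQubit.

(** * Logarithmic Sobolev inequalities for several qubits *)

Section LogSobolev.
Variable R : realType.
Local Notation C := (R[i]).
Local Open Scope complex_scope.
Variables m n : nat.
Variables Z X : 'I_n -> 'M[C]_m.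
Hypotheses (Zh : forall i, (Z i)^H = Z i) (Xh : forall i, (X i)^H = X i).
Hypotheses (ZZ : forall i, Z i *m Z i = 1%:M) (XX : forall i, X i *m X i = 1%:M).
Hypothesis XZ : forall i, X i *m Z i = - (Z i *m X i).
Hypothesis cZZ : forall i j, Z i *m Z j = Z j *m Z i.
Hypothesis cZX : forall i j, i != j -> Z i *m X j = X j *m Z i.
Hypothesis joint_eigenspace : forall (A : 'M[C]_m) (s : 'I_n -> R), psd A ->
  (forall i, Z i *m A = (s i)%:C *: A /\ A *m Z i = (s i)%:C *: A) ->
  trf eta A = psi (rtr (A *m A)).

Definition zproj (b : bool) i : 'M[C]_m :=
  (2^-1)%:C *: (1%:M + (if b then - Z i else Z i)).

Lemma half_half m' (M : 'M[C]_m') : (2^-1)%:C *: M + (2^-1)%:C *: M = M.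
Proof.
rewrite -scalerDl -rmorphD (_ : 2^-1 + 2^-1 = 1 :> R) ?rmorph1 ?scale1r //.
by field.
Qed.

Lemma zproj_adj b i : (zproj b i)^H = zproj b i.
Proof.
rewrite /zproj adjmxZ conj_real adjmxD adjmx1.
by case: b; rewrite ?adjmxN Zh.
Qed.

Lemma zprojZ b i : Z i *m zproj b i = (if b then -1 else 1)%:C *: zproj b i.
Proof.
rewrite /zproj -scalemxAr mulmxDr mulmx1; case: b; rewrite ?mulmxN ZZ.
  by rewrite rmorphN rmorph1 scaleN1r -scalerN opprD opprK addrC.
by rewrite rmorph1 scale1r addrC.
Qed.

Lemma zproj_com b i (M : 'M[C]_m) : Z i *m M = M *m Z i -> zproj b i *m M = M *m zproj b i.
Proof.
move=> e; rewrite /zproj -scalemxAl -scalemxAr mulmxDl mulmxDr mul1mx mulmx1.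
by case: b; rewrite ?mulNmx ?mulmxN e.
Qed.

Lemma zprojZr b i : zproj b i *m Z i = (if b then -1 else 1)%:C *: zproj b i.
Proof. by rewrite -zprojZ zproj_com. Qed.

Lemma zproj_idem b i : zproj b i *m zproj b i = zproj b i.
Proof.
rewrite {1}/zproj -scalemxAl mulmxDl mul1mx.
have -> : (if b then - Z i else Z i) *m zproj b i = zproj b i.
  case: b; rewrite ?mulNmx zprojZ; last by rewrite rmorph1 scale1r.
  by rewrite rmorphN rmorph1 scaleN1r opprK.
by rewrite scalerDr half_half.
Qed.

Lemma zproj_orth b i : zproj b i *m zproj (~~ b) i = 0.
Proof.
rewrite {1}/zproj -scalemxAl mulmxDl mul1mx.
have -> : (if b then - Z i else Z i) *m zproj (~~ b) i = - zproj (~~ b) i.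
  case: b; rewrite ?mulNmx zprojZ /=; first by rewrite rmorph1 scale1r.
  by rewrite rmorphN rmorph1 scaleN1r.
by rewrite subrr scaler0.
Qed.

Lemma zproj_sum i : zproj false i + zproj true i = 1%:M.
Proof.
rewrite /zproj !scalerDr addrACA half_half scalerN subrr addr0 //.
Qed.

Lemma zproj_diff i : Z i = zproj false i - zproj true i.
Proof.
by rewrite /zproj -scalerBr opprD opprK addrACA subrr add0r scalerDr half_half.
Qed.

Lemma zproj_flip b i : X i *m zproj b i = zproj (~~ b) i *m X i.
Proof.
rewrite /zproj -scalemxAr -scalemxAl mulmxDr mulmxDl mulmx1 mul1mx.
by case: b; rewrite /= ?mulmxN ?mulNmx XZ ?opprK.
Qed.

(** Every qubit from [k] on is confined, on both sides, to one eigenspace of its [Z], so only the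
    first [k] qubits are free. *)
Definition pat (k : nat) (s : 'I_n -> R) (A : 'M[C]_m) := forall i : 'I_n, (k <= i)%N ->
  Z i *m A = (s i)%:C *: A /\ A *m Z i = (s i)%:C *: A.

Definition upd (s : 'I_n -> R) (k : 'I_n) (x : R) i := if i == k then x else s i.

Lemma eig_sandl (r t A M : 'M[C]_m) (x : C) : r *m M = M *m r -> M *m A = x *: A ->
  M *m (r *m A *m t) = x *: (r *m A *m t).
Proof.
move=> c e; have -> : M *m (r *m A *m t) = r *m (M *m A) *m t by rewrite !mulmxA -c.
by rewrite e -scalemxAr -scalemxAl.
Qed.

Lemma eig_sandr (r t A M : 'M[C]_m) (x : C) : t *m M = M *m t -> A *m M = x *: A ->
  r *m A *m t *m M = x *: (r *m A *m t).
Proof.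
move=> c e; have -> : r *m A *m t *m M = r *m (A *m M) *m t by rewrite -mulmxA c !mulmxA.
by rewrite e -scalemxAr -scalemxAl.
Qed.

Lemma pat_block (k : 'I_n) s A b : pat k.+1 s A ->
  pat k (upd s k (if b then -1 else 1)) (zproj b k *m A *m zproj b k).
Proof.
move=> h i; rewrite leq_eqVlt => /orP[/eqP/val_inj ki|ki].
  rewrite -ki /upd eqxx; split; first by rewrite !mulmxA zprojZ -!scalemxAl.
  by rewrite -(mulmxA _ _ (Z k)) zprojZr -scalemxAr.
have [h1 h2] := h i ki; rewrite /upd ifF; last by apply/eqP => e; rewrite e ltnn in ki.
have c := zproj_com b (cZZ k i).
by split; [exact: eig_sandl|exact: eig_sandr].
Qed.

Lemma pat_odd (k : 'I_n) s A : pat k.+1 s A ->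
  pat k.+1 s (oddp (zproj false k) (zproj true k) A).
Proof.
move=> h i ki; have [h1 h2] := h i ki.
have c b := zproj_com b (cZZ k i).
rewrite /oddp mulmxDr mulmxDl scalerDr.
by split; congr (_ + _); [exact: eig_sandl|exact: eig_sandl|exact: eig_sandr|exact: eig_sandr].
Qed.

Lemma pat_absmx k s (D : 'M[C]_m) : herm D -> pat k s D -> pat k s (absmx D).
Proof.
move=> hD h i ki; have [h1 _] := h i ki.
have e1 : (Z i - (s i)%:C%:M) *m absmx D = 0.
  apply: fmx_annihilate => //; first exact: normr0.
  by rewrite mulmxBl h1 mul_scalar_mx subrr.
have e2 : Z i *m absmx D = (s i)%:C *: absmx D.
  by apply/eqP; rewrite -subr_eq0 -mul_scalar_mx -mulmxBl e1.
split=> //; have := congr1 (@adjmx R m m) e2.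
by rewrite adjmxM adjmxZ conj_real Zh (fmx_herm Num.norm hD).
Qed.

(** Induction on the number of free qubits. Splitting along qubit [k] leaves four positive matrices
    in which that qubit is fixed too; with no free qubit, the entropy term vanishes by
    [joint_eigenspace]. *)
Lemma log_sobolev_pat (k : nat) : (k <= n)%N -> forall A s, psd A -> pat k s A ->
  trf eta A - psi (rtr (A *m A)) + k%:R * ln 2 * rtr (A *m A) <=
  2 * \sum_(i < n | (i < k)%N) dirq (Z i) (X i) A.
Proof.
have aux (e0 e1 e2 e3 e4 a p1 p2 p3 p4 l k' S S1 S2 S3 S4 d : R) :
  e0 + l * a <= e1 + e2 + e3 + e4 + 2 * d -> a = p1 + p2 + p3 + p4 ->
  e1 + k' * l * p1 <= 2 * S1 -> e2 + k' * l * p2 <= 2 * S2 ->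
  e3 + k' * l * p3 <= 2 * S3 -> e4 + k' * l * p4 <= 2 * S4 ->
  S1 + S2 + S3 + S4 <= S -> e0 + (k' + 1) * l * a <= 2 * (d + S).
  by move=> h1 ha; rewrite ha in h1 * => *; lra.
elim: k => [_|k IH kn] A s hA hp.
  rewrite (@joint_eigenspace A s) // => [|i]; last exact: hp.
  by rewrite subrr add0r !mul0r big_pred0 ?mulr0 // => i; rewrite ltn0.
have {}IH := IH (ltnW kn); pose k0 := Ordinal kn.
have ph := zproj_adj false k0; have qh := zproj_adj true k0.
have pp := zproj_idem false k0; have qq := zproj_idem true k0.
have pq := zproj_orth false k0; have qp := zproj_orth true k0.
have pq1 := zproj_sum k0; have KE := zproj_diff k0.
have Xp := zproj_flip false k0; have Xq := zproj_flip true k0.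
have hAh := psd_herm hA.
have hD := oddp_herm ph qh hAh.
have step := one_qubit_entropy ph qh pp qq pq qp pq1 KE (Xh k0) (XX k0) Xp Xq hA.
have sq := one_qubit_sq ph qh pp qq pq qp pq1 KE hAh.
have hpD := pat_absmx hD (pat_odd (k := k0) hp).
have hDa := absmx_psd hD.
have I1 := IH _ _ (psd_sandwich ph hA) (pat_block false (k := k0) hp).
have I2 := IH _ _ (psd_sandwich qh hA) (pat_block true (k := k0) hp).
have I3 := IH _ _ (psd_sandwich ph hDa) (pat_block false (k := k0) hpD).
have I4 := IH _ _ (psd_sandwich qh hDa) (pat_block true (k := k0) hpD).
rewrite (bigD1 k0) /= ?ltnSn // -natr1.
rewrite (eq_bigl (fun i : 'I_n => (i < k)%N)); last first.
  move=> i; rewrite ltnS leq_eqVlt; case: eqP => [e|ne] /=.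
    by rewrite (_ : i = k0) ?eqxx ?ltnn //; apply: val_inj.
  by rewrite andb_idr // => ik; apply/eqP => e; rewrite e ltnn in ik.
apply: (aux _ _ _ _ _ _ _ _ _ _ _ _ _ _ _ _ _ _ step sq I1 I2 I3 I4).
rewrite -!big_split /=; apply: ler_sum => i ik.
have ne : i != k0 by apply: contraTneq ik => ->; rewrite ltnn.
apply: (dirq_one_qubit ph qh pp qq pq qp pq1 KE hAh); first exact: cZZ.
by apply: cZX; rewrite eq_sym.
Qed.

Lemma log_sobolev (A : 'M[C]_m) : psd A ->
  trf eta A - psi (rtr (A *m A)) + n%:R * ln 2 * rtr (A *m A) <=
  2 * \sum_(i < n) dirq (Z i) (X i) A.
Proof.
move=> hA; have := @log_sobolev_pat n (leqnn n) A (fun=> 0) hA.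
rewrite (eq_bigl xpredT) => [|i]; last by rewrite ltn_ord.
by apply => i; rewrite leqNgt ltn_ord.
Qed.

Definition logmx (A : 'M[C]_m) := fmx (@ln R) A.

(** In the eigenbasis of [rho] both sides become double sums with weights |W_kl|^2. The condition on
    the adjoint of [G], which admits the anti-Hermitian product ZX, makes the weights symmetric;
    after symmetrization [log_sqrt_ineq] applies term by term. *)
Lemma unitary_conj_log (G rho : 'M[C]_m) : unitary G -> (G^H = G \/ G^H = - G) ->
  herm rho -> (forall j, 0 < eig rho j) ->
  4 * (rtr rho - qform G (fmx Num.sqrt rho)) <=
  rtr (rho *m logmx rho) - rtr (G *m rho *m G^H *m logmx rho).
Proof.
have aux (a b : R) : 4 * (a + a) <= b + b -> 4 * a <= b by lra.
have aux3 (x1 x2 x3 x4 x5 x6 : R) : 4 * (x3 - (x5 * x6 + x5 * x6) + x4) <= (x3 - x4) * (x1 - x2) ->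
  4 * (x3 - x5 * x6 + (x4 - x6 * x5)) <= x3 * x1 - x1 * x4 + (x4 * x2 - x2 * x3) by lra.
move=> hG sG hr r0; have [hU _] := hermP hr.
have [W eW] : exists W, W = (eigv rho)^H *m G *m eigv rho by eexists.
have hW : unitary W by rewrite eW; apply: unitaryM => //; apply: unitaryM => //; exact: unitary_adj.
have sW k l : nsq (W l k) = nsq (W k l).
  have e : W^H = W \/ W^H = - W.
    by rewrite eW !adjmxM adjmxK; case: sG => ->; [left|right]; rewrite ?mulNmx ?mulmxN !mulmxA.
  by case: e => e; rewrite -(nsqJ (W l k)) -adjmxE e // mxE nsqN.
have row k := unitary_row k hW; have col k := unitary_col k hW.
have sp2 f g : rtr (fmx f rho *m G *m fmx g rho *m G^H) =
   \sum_k \sum_l f (eig rho k) * g (eig rho l) * nsq (W k l).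
  by rewrite (rtr_spec2 G f g (hermP hr) (hermP hr)) eW.
have e1 : rtr (G *m rho *m G^H *m logmx rho) =
   \sum_k \sum_l nsq (W k l) * (ln (eig rho k) * eig rho l).
  rewrite rtrC !mulmxA -{2}(fmx_id hr) sp2.
  by apply: eq_bigr => k _; apply: eq_bigr => l _; rewrite mulrC.
have e2 : rtr (rho *m logmx rho) = \sum_k \sum_l nsq (W k l) * (eig rho k * ln (eig rho k)).
  rewrite -{1}(fmx_id hr) fmxM // -trf_fmx //; apply: eq_bigr => k _.
  by rewrite -mulr_suml row mul1r.
have e3 : qform G (fmx Num.sqrt rho) =
   \sum_k \sum_l nsq (W k l) * (Num.sqrt (eig rho k) * Num.sqrt (eig rho l)).
  by rewrite /qform sp2; apply: eq_bigr => k _; apply: eq_bigr => l _; rewrite mulrC.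
have e4 : rtr rho = \sum_k \sum_l nsq (W k l) * eig rho k.
  by rewrite (trf_id hr); apply: eq_bigr => k _; rewrite -mulr_suml row mul1r.
have sw (F : 'I_m -> 'I_m -> R) : \sum_k \sum_l nsq (W k l) * F k l =
   \sum_k \sum_l nsq (W k l) * F l k.
  rewrite exchange_big; apply: eq_bigr => k _; apply: eq_bigr => l _.
  by rewrite sW.
have comb (F G' : 'I_m -> 'I_m -> R) : \sum_k \sum_l nsq (W k l) * F k l -
    \sum_k \sum_l nsq (W k l) * G' k l = \sum_k \sum_l nsq (W k l) * (F k l - G' k l).
  rewrite -sumrB; apply: eq_bigr => k _; rewrite -sumrB; apply: eq_bigr => l _.
  by rewrite mulrBr.
have dbl (F : 'I_m -> 'I_m -> R) : \sum_k \sum_l nsq (W k l) * F k l +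
    \sum_k \sum_l nsq (W k l) * F k l = \sum_k \sum_l nsq (W k l) * (F k l + F l k).
  rewrite [X in _ + X]sw -big_split; apply: eq_bigr => k _ /=; rewrite -big_split.
  by apply: eq_bigr => l _; rewrite mulrDr.
rewrite e1 e2 e3 e4 !comb; apply: aux; rewrite !dbl mulr_sumr.
apply: ler_sum => k _; rewrite mulr_sumr; apply: ler_sum => l _.
rewrite mulrCA ler_wpM2l ?nsq_ge0 //.
have sk : 0 < Num.sqrt (eig rho k) by rewrite sqrtr_gt0.
have sl : 0 < Num.sqrt (eig rho l) by rewrite sqrtr_gt0.
have h := log_sqrt_ineq sk sl.
have a1 := sqr_sqrtr (ltW (r0 k)); have a2 := sqr_sqrtr (ltW (r0 l)).
rewrite sqrrB a1 a2 mulr2n in h.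
exact: aux3 h.
Qed.


(** Composing the averages over conjugation by Z_i and by X_i twirls qubit [i] over the Pauli group,
    so [Eq i] replaces that qubit by the maximally mixed state. *)
Definition pinch (U A : 'M[C]_m) := (2^-1)%:C *: (A + U *m A *m U).
Definition Eq i A := pinch (Z i) (pinch (X i) A).

Lemma pinchD U A B : pinch U (A + B) = pinch U A + pinch U B.
Proof. by rewrite /pinch mulmxDr mulmxDl addrACA scalerDr. Qed.

Lemma pinchZ U (k : C) A : pinch U (k *: A) = k *: pinch U A.
Proof. by rewrite /pinch -scalemxAr -scalemxAl -scalerDr !scalerA mulrC. Qed.

Lemma pinch_idem U A : U *m U = 1%:M -> pinch U (pinch U A) = pinch U A.
Proof.
move=> UU; have e : U *m pinch U A *m U = pinch U A.
  rewrite /pinch -scalemxAr -scalemxAl mulmxDr mulmxDl !mulmxA UU mul1mx -(mulmxA A U U) UU mulmx1.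
  by rewrite addrC.
by rewrite {1}/pinch e scalerDr half_half.
Qed.

Lemma pinch2E U V A : pinch U (pinch V A) = (2^-1)%:C *: ((2^-1)%:C *:
  (A + V *m A *m V + (U *m A *m U + (U *m V) *m A *m (V *m U)))).
Proof. by rewrite /pinch -scalemxAr -scalemxAl -scalerDr mulmxDr mulmxDl !mulmxA. Qed.

Lemma pinch_com U V A : U *m V = V *m U \/ U *m V = - (V *m U) ->
  pinch U (pinch V A) = pinch V (pinch U A).
Proof.
move=> c; have T : U *m V *m A *m (V *m U) = V *m U *m A *m (U *m V).
  by case: c => ->; rewrite ?mulmxN ?mulNmx.
by rewrite (pinch2E U V) (pinch2E V U) T (addrACA A).
Qed.

Lemma EqD i A B : Eq i (A + B) = Eq i A + Eq i B.
Proof. by rewrite /Eq !pinchD. Qed.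
Lemma EqZ i (k : C) A : Eq i (k *: A) = k *: Eq i A.
Proof. by rewrite /Eq !pinchZ. Qed.
Lemma Eq_idem i A : Eq i (Eq i A) = Eq i A.
Proof.
rewrite /Eq (@pinch_com (X i) (Z i)); last by right; exact: XZ.
by rewrite (pinch_idem _ (ZZ i)) (pinch_idem _ (XX i)).
Qed.
Hypothesis cXX : forall i j, X i *m X j = X j *m X i.
Lemma Eq_com i j A : Eq i (Eq j A) = Eq j (Eq i A).
Proof.
have czx k l : Z k *m X l = X l *m Z k \/ Z k *m X l = - (X l *m Z k).
  by have [->|h] := eqVneq k l; [right; rewrite XZ opprK|left; exact: cZX].
have cxz k l : X k *m Z l = Z l *m X k \/ X k *m Z l = - (Z l *m X k).
  by have [->|h] := eqVneq k l; [right; rewrite XZ|left; rewrite cZX // eq_sym].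
rewrite /Eq (pinch_com _ (cxz i j)) (@pinch_com (Z i) (Z j)); last by left; exact: cZZ.
rewrite (@pinch_com (X i) (X j)); last by left; exact: cXX.
by rewrite (pinch_com _ (czx i j)).
Qed.

Lemma rtr_Eq_log i (rho L : 'M[C]_m) :
  rtr ((rho - Eq i rho) *m L) = 4^-1 * (
   (rtr (rho *m L) - rtr (Z i *m rho *m (Z i)^H *m L)) +
   (rtr (rho *m L) - rtr (X i *m rho *m (X i)^H *m L)) +
   (rtr (rho *m L) - rtr (Z i *m X i *m rho *m (Z i *m X i)^H *m L))).
Proof.
have aux (a b c d : R) : a - 4^-1 * (a + c + (b + d)) = 4^-1 * ((a - b) + (a - c) + (a - d)).
  by field.
have aux2 (a : R) : 2^-1 * (2^-1 * a) = 4^-1 * a by field.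
rewrite adjmxM Zh Xh mulmxBl rtrB -aux; congr (_ - _).
by rewrite /Eq pinch2E -!scalemxAl !rtrZ aux2 !mulmxDl !rtrD.
Qed.

(** For trace 1 in dimension 2^n, this is the relative entropy to the maximally mixed state. *)
Definition relent (rho : 'M[C]_m) : R := trf psi rho + n%:R * ln 2.

(** The logarithmic Sobolev inequality at the square root of [rho] bounds [relent] by twice the sum
    of the Dirichlet forms, and four times each form is at most the corresponding entropy
    production. The resulting constant 2 is the exponent of the contraction. *)
Lemma modified_log_sobolev (rho : 'M[C]_m) : herm rho -> (forall j, 0 < eig rho j) ->
  rtr rho = 1 -> 2 * relent rho <= \sum_(i < n) rtr ((rho - Eq i rho) *m logmx rho).
Proof.
have aux (e S T : R) : e <= 2 * S -> 4 * S <= T -> 2 * e <= T by lra.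
have aux2 (a1 a2 a3 t q1 q2 q3 : R) : 4 * (t - q1) <= a1 -> 4 * (t - q2) <= a2 ->
  4 * (t - q3) <= a3 -> 4 * (4^-1 * (3 * t - q1 - q2 - q3)) <= 4^-1 * (a1 + a2 + a3) by lra.
move=> hr r0 tr.
have [A eA] : exists A, A = fmx Num.sqrt rho by eexists.
have hA : psd A by rewrite eA; apply: psd_fmx => // j; exact: sqrtr_ge0.
have AA : rtr (A *m A) = rtr rho.
  rewrite eA fmxM // -trf_fmx // (trf_id hr); apply: eq_bigr => j _.
  by rewrite -expr2 sqr_sqrtr // ltW.
have tA : trf eta A = trf psi rho.
  rewrite eA (trfE _ (spec_fmx Num.sqrt hr)); apply: eq_bigr => j _.
  by rewrite /eta sqr_sqrtr // ltW.
have := log_sobolev hA; rewrite tA AA tr psi1 subr0 mulr1 => h.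
apply: aux h _; rewrite mulr_sumr; apply: ler_sum => i _.
rewrite rtr_Eq_log /dirq AA eA.
have uZ : unitary (Z i) by rewrite /unitary Zh ZZ.
have uX : unitary (X i) by rewrite /unitary Xh XX.
apply: aux2; apply: unitary_conj_log => //; first by left.
- by left.
- exact: unitaryM.
by right; rewrite adjmxM Zh Xh XZ.
Qed.

End LogSobolev.


(** * Entropy contraction under depolarizing noise *)

Lemma iterate_ineq (R : realType) (c' ck' e0 e1 e2 kk a : R) : 0 <= c' ->
  ck' * e0 <= e1 + kk * ck' * a -> c' * e1 <= e2 + a -> a <= c' * ck' * a ->
  c' * ck' * e0 <= e2 + (kk + 1) * (c' * ck') * a.
Proof. by move=> h1 /(ler_wpM2l h1) h2 h3 h4; lra. Qed.

Lemma le0_of_le_divn (R : realType) (a K : R) (N0 : nat) : 0 <= K ->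
  (forall N : nat, (N0 <= N)%N -> (0 < N)%N -> a <= K / N%:R) -> a <= 0.
Proof.
move=> K0 h; apply: (@le0_of_le_div _ _ K) => S S1.
have S0 : 0 < S by apply: lt_le_trans S1.
pose N := maxn N0 (Num.bound S).
have SN : S <= N%:R.
  apply: (le_trans (ltW (archi_boundP (ltW S0)))); rewrite ler_nat; exact: leq_maxr.
have Np : (0 < N)%N by rewrite -(ltr0n R) (lt_le_trans S0).
apply: le_trans (h N (leq_maxl _ _) Np) _.
by rewrite ler_wpM2l // lef_pV2 ?posrE // ltr0n.
Qed.


(** A discrete Gronwall argument: the multiplicative step is iterated [N] times from [r] to 1, with
    a total error of order 1 / N. *)
Lemma contraction_of_step (R : realType) (f : R -> R) (K r : R) : 0 <= K -> 0 < r <= 1 ->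
  (forall t c, 0 <= t -> 1 <= c <= 2 -> c * t <= 1 -> c ^+ 2 * f t <= f (c * t) + K * (c - 1) ^+ 2) ->
  f r <= r ^+ 2 * f 1.
Proof.
move=> K0 /andP[r0 r1] hK.
pose q := r^-1 - 1.
have q0 : 0 <= q by rewrite subr_ge0 invf_ge1.
suff : r ^- 2 * f r - f 1 <= 0.
  by rewrite subr_le0 mulrC ler_pdivrMr ?exprn_gt0 // mulrC.
apply: (@le0_of_le_divn _ _ (r ^- 2 * K * q ^+ 2) (Num.bound q)).
  by rewrite !mulr_ge0 ?sqr_ge0 // invr_ge0 sqr_ge0.
move=> N hN N0.
have N0' : 0 < N%:R :> R by rewrite ltr0n.
have qN : q <= N%:R by apply: (le_trans (ltW (archi_boundP q0))); rewrite ler_nat.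
(* The N-th root of 1 / r. Bernoulli's inequality below gives N (c - 1) <= 1 / r - 1, hence [c <= 2]
   for [N] beyond that value. *)
pose c := expR (- ln r / N%:R).
have cN : c ^+ N = r^-1.
  by rewrite /c -expRM_natl mulrC divfK ?gt_eqF // expRN lnK ?posrE.
have c1 : 1 <= c.
  by rewrite -expR0 ler_expR divr_ge0 ?ler0n // oppr_ge0 ln_le0.
have bern k : 1 + k%:R * (c - 1) <= c ^+ k.
  elim: k => [|k IH]; first by rewrite mul0r addr0 expr0.
  rewrite exprS; apply: (@le_trans _ _ (c * (1 + k%:R * (c - 1)))); last by rewrite ler_wpM2l // (le_trans ler01).
  have -> : c * (1 + k%:R * (c - 1)) = 1 + k.+1%:R * (c - 1) + k%:R * (c - 1) ^+ 2 by rewrite -natr1; ring.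
  by rewrite lerDl mulr_ge0 ?sqr_ge0.
have cq : N%:R * (c - 1) <= q by have := bern N; rewrite cN /q; lra.
have c2 : c <= 2.
  have : N%:R * (c - 1) <= N%:R * 1 by rewrite mulr1 (le_trans cq).
  by rewrite ler_pM2l //; lra.
have it k : (k <= N)%N -> c ^+ (2 * k) * f r <= f (c ^+ k * r) + k%:R * c ^+ (2 * k) * (K * (c - 1) ^+ 2).
  elim: k => [_|k IH kN]; first by rewrite muln0 !expr0 !mul1r mul0r mul0r addr0.
  have {}IH := IH (ltnW kN).
  have ck : c * (c ^+ k * r) <= 1.
    rewrite mulrA -exprS -(mulVf (lt0r_neq0 r0)) -cN ler_wpM2r ?(ltW r0) //.
    by rewrite ler_weXn2l.
  have tk0 : 0 <= c ^+ k * r by rewrite mulr_ge0 ?exprn_ge0 ?(le_trans ler01 c1) // ltW.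
  have st := hK _ c tk0 (introT andP (conj c1 c2)) ck.
  have ek : c ^+ k.+1 * r = c * (c ^+ k * r) by rewrite exprS mulrA.
  rewrite ek -natr1 mulnS exprD; apply: iterate_ineq IH st _; first exact: sqr_ge0.
  by rewrite -exprD ler_peMl ?exprn_ege1 // mulr_ge0 ?sqr_ge0.
have := it N (leqnn N); rewrite mulnC exprM cN mulVf ?lt0r_neq0 // exprVn => h.
rewrite lerBlDl; apply: le_trans h _; rewrite lerD2l.
have -> : N%:R * r ^- 2 * (K * (c - 1) ^+ 2) = r ^- 2 * K * ((N%:R * (c - 1)) ^+ 2 / N%:R).
  by field; rewrite gt_eqF // lt0r_neq0.
rewrite -[leRHS]mulrA ler_wpM2l ?mulr_ge0 ?invr_ge0 ?sqr_ge0 //.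
rewrite ler_wpM2r ?invr_ge0 ?ler0n // ler_sqr ?nnegrE //.
by rewrite mulr_ge0 // subr_ge0.
Qed.

(** * Contraction for commuting conditional expectations *)

Section Contraction.
Variable R : realType.
Local Notation C := (R[i]).
Local Open Scope complex_scope.
Variables m n : nat.
Variable E : 'I_n -> 'M[C]_m -> 'M[C]_m.
Hypothesis ED : forall i A B, E i (A + B) = E i A + E i B.
Hypothesis EZ : forall i (k : C) A, E i (k *: A) = k *: E i A.
Hypothesis E_idem : forall i A, E i (E i A) = E i A.
Hypothesis E_com : forall i j A, E i (E j A) = E j (E i A).
Hypothesis E_psd : forall i A, psd A -> psd (E i A).
Hypothesis E_rtr : forall i A, rtr (E i A) = rtr A.
Hypothesis E1 : forall i, E i 1%:M = 1%:M.
Hypothesis mlsi : forall rho, herm rho -> (forall j, 0 < eig rho j) -> rtr rho = 1 ->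
  2 * relent n rho <= \sum_(i < n) rtr ((rho - E i rho) *m logmx rho).

Definition dep (r : R) i (A : 'M[C]_m) := r%:C *: A + (1 - r)%:C *: E i A.
Definition depl (r : R) (l : seq 'I_n) (A : 'M[C]_m) := foldr (dep r) A l.

Lemma E0 i : E i 0 = 0.
Proof. by have := EZ i 0 0; rewrite !scale0r. Qed.

Lemma EN i A : E i (- A) = - E i A.
Proof. by rewrite -scaleN1r EZ scaleN1r. Qed.

Lemma E_sum i N (F : 'I_N -> 'M[C]_m) : E i (\sum_(k < N) F k) = \sum_(k < N) E i (F k).
Proof.
elim: N F => [|N IH] F; first by rewrite !big_ord0 E0.
by rewrite !big_ord_recr /= ED IH.
Qed.

(** The complement of the projection [E i]. Summed over the sites, it multiplies the weight [k]
    component by [k], and so acts on the noisy state as r d/dr. *)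
Definition Mi i A := A - E i A.

Lemma dep_split r i A : dep r i A = E i A + r%:C *: Mi i A.
Proof.
rewrite /dep /Mi rmorphB rmorph1 scalerBl scale1r scalerBr.
by rewrite addrCA.
Qed.

Lemma Mi_dep r i A : Mi i (dep r i A) = r%:C *: Mi i A.
Proof.
rewrite {1}/Mi dep_split ED EZ E_idem {2}/Mi ED EN E_idem subrr scaler0 addr0.
by rewrite addrC addKr.
Qed.

Lemma dep_E r i j A : E j (dep r i A) = dep r i (E j A).
Proof. by rewrite /dep ED !EZ E_com. Qed.

Lemma dep_sum r i (I : Type) (s : seq I) (F : I -> 'M[C]_m) :
  dep r i (\sum_(k <- s) F k) = \sum_(k <- s) dep r i (F k).
Proof.
elim: s => [|k s IH]; first by rewrite !big_nil /dep E0 !scaler0 addr0.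
by rewrite !big_cons -IH /dep ED !scalerDr addrACA.
Qed.

(* The noise acts diagonally on the decomposition of an operator into components of
   Pauli weight [k]. *)
Lemma depl_poly (l : seq 'I_n) (rho : 'M[C]_m) : exists sg : nat -> 'M[C]_m,
  (forall k, (size l < k)%N -> sg k = 0) /\ forall r : R,
  depl r l rho = \sum_(k < (size l).+1) (r ^+ k)%:C *: sg k /\
  \sum_(i <- l) Mi i (depl r l rho) = \sum_(k < (size l).+1) (k%:R * r ^+ k)%:C *: sg k.
Proof.
elim: l => [|i l [sg [sg0 IH]]].
  exists (fun k => if k == 0%N then rho else 0); split=> [[]//|r].
  rewrite big_nil !big_ord_recl !big_ord0 /= !addr0 expr0 mul0r rmorph0 scale0r.
  by rewrite rmorph1 scale1r.
(* Site [i] either carries the identity, leaving the weight unchanged, or a nontrivial factor,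
   raising the weight by one. *)
exists (fun k => E i (sg k) + (if k is k'.+1 then Mi i (sg k') else 0)); split.
  by case=> // k hk; rewrite !sg0 // ?(ltnW hk) // /Mi E0 subr0 addr0.
move=> r; have [h1 h2] := IH r; rewrite /= -/(depl r l rho).
have sp (w : nat -> R) (v : nat -> R) : (forall k, w k.+1 = v k) ->
   \sum_(k < (size l).+2) (w k)%:C *: (E i (sg k) + (if (k : nat) is k'.+1 then Mi i (sg k') else 0)) =
   \sum_(k < (size l).+1) (w k)%:C *: E i (sg k) + \sum_(k < (size l).+1) (v k)%:C *: Mi i (sg k).
  move=> wv; under eq_bigr do rewrite scalerDr.
  rewrite big_split /=; congr (_ + _).
    by rewrite big_ord_recr /= (sg0 (size l).+1) // E0 scaler0 addr0.
  rewrite big_ord_recl /= scaler0 add0r; apply: eq_bigr => k _.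
  by rewrite -wv.
have Ms N (F : 'I_N -> 'M[C]_m) : Mi i (\sum_(k < N) F k) = \sum_(k < N) Mi i (F k).
  by rewrite /Mi E_sum sumrB.
have MZ (k : C) A : Mi i (k *: A) = k *: Mi i A by rewrite /Mi EZ scalerBr.
have main (w : nat -> R) : dep r i (\sum_(k < (size l).+1) (w k)%:C *: sg k) =
  \sum_(k < (size l).+1) (w k)%:C *: E i (sg k) + \sum_(k < (size l).+1) (r * w k)%:C *: Mi i (sg k).
  rewrite dep_split E_sum Ms scaler_sumr; congr (_ + _); apply: eq_bigr => k _; first exact: EZ.
  by rewrite MZ scalerA -rmorphM.
split.
  by rewrite (sp (fun k => r ^+ k) (fun k => r * r ^+ k)) => [|k]; rewrite ?exprS // h1 main.
rewrite big_cons Mi_dep.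
have -> : \sum_(j <- l) Mi j (dep r i (depl r l rho)) = dep r i (\sum_(j <- l) Mi j (depl r l rho)).
  rewrite dep_sum; apply: eq_bigr => j _; rewrite {1}/Mi dep_E /Mi /dep ED EN !scalerBr.
  by rewrite opprD addrACA.
rewrite h2 (main (fun k => k%:R * r ^+ k)).
rewrite (sp (fun k => k%:R * r ^+ k) (fun k => k.+1%:R * (r * r ^+ k))) => [|k]; last by rewrite exprS.
rewrite addrCA; congr (_ + _).
rewrite h1 Ms scaler_sumr -big_split; apply: eq_bigr => k _ /=.
rewrite MZ scalerA -rmorphM -scalerDl -rmorphD -natr1; congr (_%:C *: _); ring.
Qed.

Lemma dep_psd r i A : 0 <= r <= 1 -> psd A -> psd (dep r i A).
Proof.
move=> /andP[r0 r1] hA; apply: psdD; apply: psdZ => //; first by rewrite subr_ge0.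
exact: E_psd.
Qed.

Lemma depl_facts r l A (d : R) : 0 <= r <= 1 -> psd A -> psd (A - (d%:C)%:M) ->
  [/\ psd (depl r l A), psd (depl r l A - (d%:C)%:M) & rtr (depl r l A) = rtr A].
Proof.
move=> hr hA hd; elim: l => [//|i l [h1 h2 h3]] /=.
have e : dep r i (depl r l A) - (d%:C)%:M = dep r i (depl r l A - (d%:C)%:M).
  rewrite /dep ED EN -scalemx1 EZ E1 !scalerBr addrACA -opprD; congr (_ - _).
  by rewrite !scalemx1 -scalerDl -rmorphD addrC subrK rmorph1 scale1r.
split; [exact: dep_psd|by rewrite e; exact: dep_psd|].
by rewrite /dep rtrD !rtrZ E_rtr h3 -mulrDl addrC subrK mul1r.
Qed.

(** Klein's inequality: [psi_tangent] is summed over pairs of eigenvalues weighted by the overlaps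
    of the two eigenbases. Equal traces remove the constant 1 from the derivative 1 + ln of
    [psi]. *)
Lemma klein (s r : 'M[C]_m) : psd s -> herm r -> (forall j, 0 < eig r j) -> rtr s = rtr r ->
  rtr ((s - r) *m logmx r) <= trf psi s - trf psi r.
Proof.
move=> hs hr r0 tr; have hsh := psd_herm hs.
have e1 : rtr (r *m logmx r) = trf psi r.
  by rewrite -{1}(fmx_id hr) fmxM // -trf_fmx.
rewrite mulmxBl rtrB e1 lerD2r.
have [hU _] := hermP hsh; have [hV _] := hermP hr.
have [W eW] : exists W, W = (eigv s)^H *m eigv r by eexists.
have hW : unitary W by rewrite eW; apply: unitaryM => //; exact: unitary_adj.
have row k := unitary_row k hW; have col k := unitary_col k hW.
have := rtr_spec2 1%:M id (@ln R) (hermP hsh) (hermP hr).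
rewrite adjmx1 !mulmx1 (fmx_id hsh) -eW => ->.
have -> : trf psi s = \sum_k \sum_l psi (eig s k) * nsq (W k l).
  by apply: eq_bigr => k _; rewrite -mulr_sumr row mulr1.
have z : \sum_k \sum_l (eig s k - eig r l) * nsq (W k l) = 0.
  transitivity (\sum_k \sum_l eig s k * nsq (W k l) - \sum_k \sum_l eig r l * nsq (W k l)).
    rewrite -sumrB; apply: eq_bigr => k _; rewrite -sumrB; apply: eq_bigr => l _.
    by rewrite mulrBl.
  rewrite [X in _ - X]exchange_big /=.
  under eq_bigr do rewrite -mulr_sumr row mulr1.
  under [X in _ - X]eq_bigr do rewrite -mulr_sumr col mulr1.
  by apply/eqP; rewrite subr_eq0; apply/eqP; move: tr; rewrite (trf_id hsh) (trf_id hr).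
have -> : \sum_k \sum_l id (eig s k) * ln (eig r l) * nsq (W k l) =
  \sum_k \sum_l (eig s k * ln (eig r l) + (eig s k - eig r l)) * nsq (W k l).
  transitivity (\sum_k \sum_l eig s k * ln (eig r l) * nsq (W k l) +
     \sum_k \sum_l (eig s k - eig r l) * nsq (W k l)); first by rewrite z addr0.
  rewrite -big_split; apply: eq_bigr => k _; rewrite -big_split; apply: eq_bigr => l _ /=.
  by rewrite -mulrDl.
apply: ler_sum => k _; apply: ler_sum => l _; rewrite ler_wpM2r ?nsq_ge0 //.
by have := psi_tangent (psd_eig k hs) (r0 l); rewrite /psi /=; lra.
Qed.

Lemma rtr_log_bound (sg r : 'M[C]_m) (L : R) : herm r -> (forall j, `|ln (eig r j)| <= L) ->
  `|rtr (sg *m logmx r)| <= L * (m%:R * (1 + rtr (sg *m sg^H))).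
Proof.
move=> hr hL; have [hU _] := hermP hr.
have [w ew] : exists w, w = (eigv r)^H *m sg *m eigv r by eexists.
have F : rtr (sg *m sg^H) = \sum_k \sum_l nsq (w k l).
  rewrite -rtr_frob -(rtr_conj _ (unitary_adj hU)) adjmxK; congr rtr.
  by rewrite ew !adjmxM adjmxK !mulmxA -(mulmxA _ (eigv r) (eigv r)^H) hU mulmx1.
have -> : rtr (sg *m logmx r) = \sum_j ln (eig r j) * Re (w j j).
  rewrite /logmx /fmx !mulmxA rtrC !mulmxA -ew /rtr /mxtrace Re_sum.
  by apply: eq_bigr => j _; rewrite mul_mx_dg mulrC ReZ.
apply: le_trans (ler_norm_sum _ _ _) _.
have -> : L * (m%:R * (1 + rtr (sg *m sg^H))) = \sum_(j < m) L * (1 + rtr (sg *m sg^H)).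
  by rewrite sumr_const card_ord mulrCA mulr_natl.
apply: ler_sum => j _.
rewrite normrM; apply: ler_pM => //.
have h1 : nsq (w j j) <= rtr (sg *m sg^H).
  rewrite F (bigD1 j) //= (bigD1 j) //= -addrA lerDl addr_ge0 //.
    by apply: sumr_ge0 => *; exact: nsq_ge0.
  by apply: sumr_ge0 => *; apply: sumr_ge0 => *; exact: nsq_ge0.
(* The crude bound |x| <= 1 + |w|^2 for the real part x of w is enough, since only a constant
   independent of the noise strength is wanted. *)
apply: le_trans (_ : 1 + nsq (w j j) <= _); last by rewrite lerD2l.
rewrite /nsq; move: (Re (w j j)) (complex.Im (w j j)) => x y.
have := sqr_ge0 (x - 1); have := sqr_ge0 (x + 1); have := sqr_ge0 y.
by rewrite sqrrB sqrrD !mulr2n ler_norml => ? ? ?; apply/andP; split; lra.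
Qed.

Lemma pow_second_order (k : nat) : exists2 B : R, 0 <= B & forall c : R, 1 <= c <= 2 ->
  0 <= c ^+ k - 1 - k%:R * (c - 1) <= B * (c - 1) ^+ 2.
Proof.
elim: k => [|k [B B0 IH]]; first by exists 0 => // c _; rewrite expr0 mul0r; lra.
exists (2 * B + k%:R) => [|c hc]; first by rewrite addr_ge0 ?mulr_ge0.
have /andP[h1 h2] := IH c hc; have /andP[c1 c2] := hc.
have -> : c ^+ k.+1 - 1 - k.+1%:R * (c - 1) =
   c * (c ^+ k - 1 - k%:R * (c - 1)) + k%:R * (c - 1) ^+ 2.
  by rewrite exprS -natr1; ring.
have s0 := sqr_ge0 (c - 1).
have k0 : 0 <= k%:R * (c - 1) ^+ 2 by rewrite mulr_ge0.
apply/andP; split; first by rewrite addr_ge0 // mulr_ge0 //; lra.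
rewrite mulrDl lerD2r -mulrA; apply: ler_pM => //; lra.
Qed.

Section Fixed.
Variables (rho : 'M[C]_m) (d : R).
Hypotheses (d0 : 0 < d) (hrho : psd rho) (hd : psd (rho - (d%:C)%:M)) (tr1 : rtr rho = 1).
Let l := enum 'I_n.
Let rh r := depl r l rho.
Let en r := relent n (rh r).

Lemma rh_facts r : 0 <= r <= 1 ->
  [/\ herm (rh r), psd (rh r), forall j, d <= eig (rh r) j <= 1 & rtr (rh r) = 1].
Proof.
move=> hr; have [h1 h2 h3] := depl_facts l hr hrho hd.
have hh := psd_herm h1; split=> // [j|]; last by rewrite h3.
apply/andP; split.
  have := spec_shift (- d) (hermP hh).
  have -> : depl r l rho + ((- d)%:C)%:M = depl r l rho - (d%:C)%:M.
    by rewrite -!dg_const dgN.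
  by move=> /(psd_spec j h2); rewrite subr_ge0.
rewrite -tr1 -h3 (trf_id hh) /trf (bigD1 j) //= lerDl; apply: sumr_ge0 => k _.
exact: psd_eig.
Qed.

Lemma en_le r : 0 <= r <= 1 -> en r <= n%:R * ln 2.
Proof.
move=> hr; have [_ _ h _] := rh_facts hr; rewrite /en /relent gerDr.
apply: sumr_le0 => j _; have /andP[h1 h2] := h j.
by rewrite /psi mulr_ge0_le0 ?ln_le0 // (le_trans (ltW d0)).
Qed.

(** Klein's inequality bounds the entropy increment from below by a trace linear in the increment of
    the state, so no matrix entropy is differentiated. In Pauli weights the trace is a sum of (c^k -
    1) t^k x_k. Its first-order part in c - 1 is the entropy production, at least [2 * en t]; the
    rest is quadratic in c - 1, uniformly because the eigenvalues stay above [d]. *)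
Lemma en_step : exists2 K : R, 0 <= K & forall t c, 0 <= t -> 1 <= c <= 2 -> c * t <= 1 ->
  c ^+ 2 * en t <= en (c * t) + K * (c - 1) ^+ 2.
Proof.
have aux (e1 e2 D S T K1 q s2 : R) : D <= e2 - e1 -> D = q * S + T -> 2 * e1 <= S ->
  0 <= q -> - T <= K1 * s2 -> e1 * s2 <= s2 * (n%:R * ln 2) -> s2 = q ^+ 2 ->
  (q + 1) ^+ 2 * e1 <= e2 + (K1 + n%:R * ln 2) * s2.
  move=> h1 h2 h3 h4 + + h7; rewrite h7 => h5 h6; have := ler_wpM2l h4 h3.
  have -> : (q + 1) ^+ 2 * e1 = q ^+ 2 * e1 + q * (2 * e1) + e1 by ring.
  lra.
have enB s t : en s - en t = trf psi (rh s) - trf psi (rh t).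
  by have a2 (x y z : R) : x + z - (y + z) = x - y by [lra]; exact: a2.
have [sg [_ hsg]] := depl_poly l rho.
pose L := - ln d.
pose Bk k := L * (m%:R * (1 + rtr (sg k *m (sg k)^H))).
have [B hB] : exists B : nat -> R, forall k, 0 <= B k /\ forall c : R, 1 <= c <= 2 ->
    0 <= c ^+ k - 1 - k%:R * (c - 1) <= B k * (c - 1) ^+ 2.
  have h k : exists B : R, 0 <= B /\ forall c : R, 1 <= c <= 2 ->
    0 <= c ^+ k - 1 - k%:R * (c - 1) <= B * (c - 1) ^+ 2.
    by have [B ? ?] := pow_second_order k; exists B.
  by have [B hB] := choice h; exists B.
(* In positive dimension [d] lies below an eigenvalue, itself at most 1, so [L] is nonnegative; in
   dimension 0 the bounds [Bk] vanish. *)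
have d1 : m = 0%N \/ d <= 1.
  have [j _|nj] := pickP (fun j : 'I_m => true).
    by right; have [_ _ /(_ j) /andP[a b] _] := @rh_facts 0 (introT andP (conj (lexx _) ler01)); apply: le_trans a b.
  by left; case: (m) nj => // m' /(_ ord0).
have Bk0 k : 0 <= Bk k.
  rewrite /Bk /L; case: d1 => [h|d1]; first by have e : m%:R = 0 :> R by [rewrite h]; rewrite e ?(mul0r, mulr0).
  rewrite mulr_ge0 ?oppr_ge0 ?ln_le0 // mulr_ge0 // addr_ge0 // rtr_frob.
  by apply: sumr_ge0 => *; apply: sumr_ge0 => *; exact: nsq_ge0.
exists (\sum_(k < (size l).+1) B k * Bk k + n%:R * ln 2).
  rewrite addr_ge0 ?mulr_ge0 ?ln_ge0 ?ler1n //; apply: sumr_ge0 => k _.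
  by rewrite mulr_ge0 //; have [] := hB k.
move=> t c t0 hc ct; have /andP[c1 c2] := hc.
have ht : 0 <= t <= 1.
  by rewrite t0 /= (le_trans _ ct) // ler_peMl.
have hct : 0 <= c * t <= 1 by rewrite ct mulr_ge0 // (le_trans ler01).
have [th tp te tt] := rh_facts ht; have [ch cp ce ctr] := rh_facts hct.
have te0 j : 0 < eig (rh t) j by have /andP[h _] := te j; apply: lt_le_trans h.
have [P1 P2] := hsg t; have [P3 _] := hsg (c * t).
have K1 := klein cp th te0 (etrans ctr (esym tt)).
have M1 := mlsi th te0 tt.
have bd k : `|rtr (sg k *m logmx (rh t))| <= Bk k.
  apply: rtr_log_bound => // j; have /andP[h1 h2] := te j.
  by rewrite /L ler0_norm ?ln_le0 // lerN2 ler_ln ?posrE.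
pose x k := rtr (sg k *m logmx (rh t)).
have e1 : rtr ((rh (c * t) - rh t) *m logmx (rh t)) =
    \sum_(k < (size l).+1) (c ^+ k - 1) * t ^+ k * x k.
  rewrite /rh P1 P3 -sumrB mulmx_suml rtr_sum; apply: eq_bigr => k _.
  by rewrite -scalerBl -rmorphB -scalemxAl rtrZ exprMn /x /rh -P1; congr (_ * _); ring.
have e2 : \sum_(i < n) rtr ((rh t - E i (rh t)) *m logmx (rh t)) =
    \sum_(k < (size l).+1) k%:R * t ^+ k * x k.
  have -> : \sum_(i < n) rtr ((rh t - E i (rh t)) *m logmx (rh t)) =
     rtr ((\sum_(i <- l) Mi i (rh t)) *m logmx (rh t)).
    by rewrite mulmx_suml rtr_sum /l big_enum.
  rewrite {1}/rh P2 mulmx_suml rtr_sum; apply: eq_bigr => k _.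
  by rewrite -scalemxAl rtrZ.
rewrite e2 in M1; rewrite e1 in K1.
have := aux _ _ (\sum_(k < (size l).+1) (c ^+ k - 1) * t ^+ k * x k) _ (\sum_(k < (size l).+1) (c ^+ k - 1 - k%:R * (c - 1)) * t ^+ k * x k)
  (\sum_(k < (size l).+1) B k * Bk k) (c - 1) ((c - 1) ^+ 2) (_ : _ <= en (c * t) - en t) _ M1.
rewrite subrK; apply => //.
- by rewrite enB; exact: K1.
- rewrite mulr_sumr -big_split; apply: eq_bigr => k _ /=; ring.
- by rewrite subr_ge0.
- rewrite -sumrN mulr_suml; apply: ler_sum => k _.
  have [Bk' hBk] := hB k; have /andP[h1 h2] := hBk c hc.
  have tk : t ^+ k <= 1 by rewrite exprn_ile1 //; case/andP: ht.
  apply: le_trans (ler_norm _) _; rewrite normrN !normrM.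
  rewrite (ger0_norm h1) (ger0_norm (exprn_ge0 _ t0)) -mulrA.
  have -> : B k * Bk k * (c - 1) ^+ 2 = B k * (c - 1) ^+ 2 * (1 * Bk k) by ring.
  apply: ler_pM; [exact: h1|by apply: mulr_ge0 => //; exact: exprn_ge0|exact: h2|].
  by apply: ler_pM => //; [exact: exprn_ge0|exact: bd].
- by rewrite mulrC ler_wpM2l ?sqr_ge0 // en_le.
Qed.

Theorem depolarizing_contraction r : 0 <= r <= 1 -> relent n (depl r l rho) <= r ^+ 2 * relent n rho.
Proof.
move=> hr; have /andP[r0 r1] := hr; rewrite -/(rh r) -/(en r).
have en1 : en 1 = relent n rho.
  rewrite /en /rh; congr (relent n _); elim: (l) => //= i s ->.
  by rewrite /dep rmorph1 scale1r subrr rmorph0 scale0r addr0.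
(* The iteration requires [r > 0]. At [r = 0] only weight 0 survives, the entropy production
   vanishes, and the modified inequality forces [relent] to be at most 0. *)
move: r0; rewrite le_eqVlt => /predU1P[re|r0].
  rewrite -re expr0n /= mul0r.
  have h01 : 0 <= (0 : R) <= 1 by rewrite lexx ler01.
  have [th tp te tt] := rh_facts h01.
  have te0 j : 0 < eig (rh 0) j by have /andP[h _] := te j; apply: lt_le_trans h.
  have := mlsi th te0 tt.
  have [sg [_ hsg]] := depl_poly l rho; have [_ P2] := hsg 0.
  have -> : \sum_(i < n) rtr ((rh 0 - E i (rh 0)) *m logmx (rh 0)) =
     rtr ((\sum_(i <- l) Mi i (rh 0)) *m logmx (rh 0)).
    by rewrite mulmx_suml rtr_sum /l big_enum.
  rewrite {1}/rh P2 big1 ?mul0mx ?rtr0 => [|k _]; first by rewrite -/(en 0) pmulr_rle0.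
  case: k => [[|k] hk] /=; first by rewrite mul0r rmorph0 scale0r.
  by rewrite exprS mul0r mulr0 rmorph0 scale0r.
have [K K0 hK] := en_step.
have := contraction_of_step K0 (introT andP (conj r0 r1)) hK.
by rewrite en1.
Qed.

End Fixed.
End Contraction.


(** * The Goemans-Williamson function *)

Section GoemansWilliamson.
Variable R : realType.
Implicit Types x y t e : R.

Lemma dvsin x : deriv_at (@sin R) x (cos x).
Proof. exact: is_derive_sin. Qed.
Lemma dvcos x : deriv_at (@cos R) x (- sin x).
Proof. exact: is_derive_cos. Qed.

Lemma ge0_of_deriv (f df : R -> R) : f 0 = 0 ->
  (forall x, 0 <= x -> deriv_at f x (df x)) -> (forall x, 0 <= x -> 0 <= df x) ->
  forall x, 0 <= x -> 0 <= f x.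
Proof.
move=> f0 hd h x x0; rewrite -f0.
by apply: (@derive_ge0_le _ f df 0 x x0) => y /andP[y0 _]; [exact: hd|exact: h].
Qed.

Lemma dv_cos_add (p dp : R -> R) (s : R) x : deriv_at p x (dp x) ->
  deriv_at (fun t => s * cos t + p t) x (- s * sin x + dp x).
Proof.
move=> h; apply: dvD h; apply: dv_eq; first exact: dvZ (dvcos x).
by rewrite mulrN mulNr.
Qed.

Lemma dv_sin_add (p dp : R -> R) (s : R) x : deriv_at p x (dp x) ->
  deriv_at (fun t => s * sin t + p t) x (s * cos x + dp x).
Proof. by move=> h; apply: dvD h; exact: dvZ (dvsin x). Qed.

(** The bound [cos <= 1] integrated ten times from 0, each inequality giving the derivative of the
    next. Degree 10 is accurate enough for the numerical comparison in [acos_xprime]. *)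
Lemma cos_taylor10 x : 0 <= x ->
  1 - x ^+ 2 / 2 + x ^+ 4 / 24 - x ^+ 6 / 720 + x ^+ 8 / (8 * 5040) - x ^+ 10 / (720 * 5040) <= cos x.
Proof.
have h0 y : 0 <= y -> 0 <= -1 * cos y + 1 by move=> _; have := cos_le1 y; lra.
have h1 y : 0 <= y -> 0 <= -1 * sin y + (y).
  apply: (@ge0_of_deriv (fun t => -1 * sin t + (t)) (fun t => -1 * cos t + (1))).
  - by rewrite sin0 ?expr0n /=; lra.
  - move=> z _; apply: (@dv_sin_add (fun t => (t)) (fun t => (1))).
    by apply: dv_eq; [dv|rewrite /=; field].
  - by move=> z z0; have := h0 z z0; lra.
have h2 y : 0 <= y -> 0 <= 1 * cos y + (y ^+ 2 / 2 - 1).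
  apply: (@ge0_of_deriv (fun t => 1 * cos t + (t ^+ 2 / 2 - 1)) (fun t => - 1 * sin t + (t))).
  - by rewrite cos0 ?expr0n /=; lra.
  - move=> z _; apply: (@dv_cos_add (fun t => (t ^+ 2 / 2 - 1)) (fun t => (t))).
    by apply: dv_eq; [dv|rewrite /=; field].
  - by move=> z z0; have := h1 z z0; lra.
have h3 y : 0 <= y -> 0 <= 1 * sin y + (y ^+ 3 / 6 - y).
  apply: (@ge0_of_deriv (fun t => 1 * sin t + (t ^+ 3 / 6 - t)) (fun t => 1 * cos t + (t ^+ 2 / 2 - 1))).
  - by rewrite sin0 ?expr0n /=; lra.
  - move=> z _; apply: (@dv_sin_add (fun t => (t ^+ 3 / 6 - t)) (fun t => (t ^+ 2 / 2 - 1))).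
    by apply: dv_eq; [dv|rewrite /=; field].
  - by move=> z z0; have := h2 z z0; lra.
have h4 y : 0 <= y -> 0 <= -1 * cos y + (y ^+ 4 / 24 - y ^+ 2 / 2 + 1).
  apply: (@ge0_of_deriv (fun t => -1 * cos t + (t ^+ 4 / 24 - t ^+ 2 / 2 + 1)) (fun t => - -1 * sin t + (t ^+ 3 / 6 - t))).
  - by rewrite cos0 ?expr0n /=; lra.
  - move=> z _; apply: (@dv_cos_add (fun t => (t ^+ 4 / 24 - t ^+ 2 / 2 + 1)) (fun t => (t ^+ 3 / 6 - t))).
    by apply: dv_eq; [dv|rewrite /=; field].
  - by move=> z z0; have := h3 z z0; lra.
have h5 y : 0 <= y -> 0 <= -1 * sin y + (y ^+ 5 / 120 - y ^+ 3 / 6 + y).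
  apply: (@ge0_of_deriv (fun t => -1 * sin t + (t ^+ 5 / 120 - t ^+ 3 / 6 + t)) (fun t => -1 * cos t + (t ^+ 4 / 24 - t ^+ 2 / 2 + 1))).
  - by rewrite sin0 ?expr0n /=; lra.
  - move=> z _; apply: (@dv_sin_add (fun t => (t ^+ 5 / 120 - t ^+ 3 / 6 + t)) (fun t => (t ^+ 4 / 24 - t ^+ 2 / 2 + 1))).
    by apply: dv_eq; [dv|rewrite /=; field].
  - by move=> z z0; have := h4 z z0; lra.
have h6 y : 0 <= y -> 0 <= 1 * cos y + (y ^+ 6 / 720 - y ^+ 4 / 24 + y ^+ 2 / 2 - 1).
  apply: (@ge0_of_deriv (fun t => 1 * cos t + (t ^+ 6 / 720 - t ^+ 4 / 24 + t ^+ 2 / 2 - 1)) (fun t => - 1 * sin t + (t ^+ 5 / 120 - t ^+ 3 / 6 + t))).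
  - by rewrite cos0 ?expr0n /=; lra.
  - move=> z _; apply: (@dv_cos_add (fun t => (t ^+ 6 / 720 - t ^+ 4 / 24 + t ^+ 2 / 2 - 1)) (fun t => (t ^+ 5 / 120 - t ^+ 3 / 6 + t))).
    by apply: dv_eq; [dv|rewrite /=; field].
  - by move=> z z0; have := h5 z z0; lra.
have h7 y : 0 <= y -> 0 <= 1 * sin y + (y ^+ 7 / 5040 - y ^+ 5 / 120 + y ^+ 3 / 6 - y).
  apply: (@ge0_of_deriv (fun t => 1 * sin t + (t ^+ 7 / 5040 - t ^+ 5 / 120 + t ^+ 3 / 6 - t)) (fun t => 1 * cos t + (t ^+ 6 / 720 - t ^+ 4 / 24 + t ^+ 2 / 2 - 1))).
  - by rewrite sin0 ?expr0n /=; lra.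
  - move=> z _; apply: (@dv_sin_add (fun t => (t ^+ 7 / 5040 - t ^+ 5 / 120 + t ^+ 3 / 6 - t)) (fun t => (t ^+ 6 / 720 - t ^+ 4 / 24 + t ^+ 2 / 2 - 1))).
    by apply: dv_eq; [dv|rewrite /=; field].
  - by move=> z z0; have := h6 z z0; lra.
have h8 y : 0 <= y -> 0 <= -1 * cos y + (y ^+ 8 / (8 * 5040) - y ^+ 6 / 720 + y ^+ 4 / 24 - y ^+ 2 / 2 + 1).
  apply: (@ge0_of_deriv (fun t => -1 * cos t + (t ^+ 8 / (8 * 5040) - t ^+ 6 / 720 + t ^+ 4 / 24 - t ^+ 2 / 2 + 1)) (fun t => - -1 * sin t + (t ^+ 7 / 5040 - t ^+ 5 / 120 + t ^+ 3 / 6 - t))).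
  - by rewrite cos0 ?expr0n /=; lra.
  - move=> z _; apply: (@dv_cos_add (fun t => (t ^+ 8 / (8 * 5040) - t ^+ 6 / 720 + t ^+ 4 / 24 - t ^+ 2 / 2 + 1)) (fun t => (t ^+ 7 / 5040 - t ^+ 5 / 120 + t ^+ 3 / 6 - t))).
    by apply: dv_eq; [dv|rewrite /=; field].
  - by move=> z z0; have := h7 z z0; lra.
have h9 y : 0 <= y -> 0 <= -1 * sin y + (y ^+ 9 / (72 * 5040) - y ^+ 7 / 5040 + y ^+ 5 / 120 - y ^+ 3 / 6 + y).
  apply: (@ge0_of_deriv (fun t => -1 * sin t + (t ^+ 9 / (72 * 5040) - t ^+ 7 / 5040 + t ^+ 5 / 120 - t ^+ 3 / 6 + t)) (fun t => -1 * cos t + (t ^+ 8 / (8 * 5040) - t ^+ 6 / 720 + t ^+ 4 / 24 - t ^+ 2 / 2 + 1))).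
  - by rewrite sin0 ?expr0n /=; lra.
  - move=> z _; apply: (@dv_sin_add (fun t => (t ^+ 9 / (72 * 5040) - t ^+ 7 / 5040 + t ^+ 5 / 120 - t ^+ 3 / 6 + t)) (fun t => (t ^+ 8 / (8 * 5040) - t ^+ 6 / 720 + t ^+ 4 / 24 - t ^+ 2 / 2 + 1))).
    by apply: dv_eq; [dv|rewrite /=; field].
  - by move=> z z0; have := h8 z z0; lra.
have h10 y : 0 <= y -> 0 <= 1 * cos y + (y ^+ 10 / (720 * 5040) - y ^+ 8 / (8 * 5040) + y ^+ 6 / 720 - y ^+ 4 / 24 + y ^+ 2 / 2 - 1).
  apply: (@ge0_of_deriv (fun t => 1 * cos t + (t ^+ 10 / (720 * 5040) - t ^+ 8 / (8 * 5040) + t ^+ 6 / 720 - t ^+ 4 / 24 + t ^+ 2 / 2 - 1)) (fun t => - 1 * sin t + (t ^+ 9 / (72 * 5040) - t ^+ 7 / 5040 + t ^+ 5 / 120 - t ^+ 3 / 6 + t))).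
  - by rewrite cos0 ?expr0n /=; lra.
  - move=> z _; apply: (@dv_cos_add (fun t => (t ^+ 10 / (720 * 5040) - t ^+ 8 / (8 * 5040) + t ^+ 6 / 720 - t ^+ 4 / 24 + t ^+ 2 / 2 - 1)) (fun t => (t ^+ 9 / (72 * 5040) - t ^+ 7 / 5040 + t ^+ 5 / 120 - t ^+ 3 / 6 + t))).
    by apply: dv_eq; [dv|rewrite /=; field].
  - by move=> z z0; have := h9 z z0; lra.
by move=> /h10; lra.
Qed.

Lemma cos_decr (a b : R) : 0 <= a -> a < b -> b <= pi -> cos b < cos a.
Proof.
move=> a0 ab bp; have b0 := le_trans a0 (ltW ab); have ap := le_trans (ltW ab) bp.
by rewrite ltr_cos ?in_itv /= ?a0 ?b0 ?ap ?bp.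
Qed.

Lemma acos_decr (a b : R) : -1 <= a -> a < b -> b <= 1 -> acos b < acos a.
Proof.
move=> a1 ab b1; have ar : -1 <= a <= 1 by rewrite a1 (le_trans (ltW ab)).
have br : -1 <= b <= 1 by rewrite b1 (le_trans a1 (ltW ab)).
rewrite ltNge le_eqVlt; apply/negP => /orP[/eqP e|h].
  by move: ab; rewrite -(acosK (x := a)) ?in_itv // e acosK ?in_itv // ltxx.
have := cos_decr (acos_ge0 ar) h (acos_lepi br); rewrite !acosK ?in_itv //.
by move=> /(lt_trans ab); rewrite ltxx.
Qed.

Lemma xprime_range : -1 <= - xprime R <= 1.
Proof. by rewrite /xprime; lra. Qed.

(* [sqrt (1689/311)] is the value of [tan (t / 2)] at [cos t = - xprime]. *)
Lemma acos_xprime : Num.sqrt (1689 / 311) <= acos (- xprime R).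
Proof.
have [Y eY] : exists Y : R, Y = 1689 / 311 by eexists.
rewrite -eY; have Y0 : 0 <= Y by rewrite eY; lra.
have [tau et] : exists tau, tau = Num.sqrt Y by eexists.
rewrite -et; have t0 : 0 <= tau by rewrite et; exact: sqrtr_ge0.
have t2 : tau ^+ 2 = Y by rewrite et; exact: sqr_sqrtr.
have tay x : 0 <= x -> x ^+ 2 <= Y -> -1 < cos x.
  rewrite eY => x0 hx; apply: lt_le_trans (cos_taylor10 x0).
  have e k : x ^+ (2 * k) = (x ^+ 2) ^+ k by rewrite exprM.
  rewrite (e 2%N) (e 3%N) (e 4%N) (e 5%N).
  move: (x ^+ 2) (sqr_ge0 x) hx => y y0 y1.
  have h1 : 0 <= y ^+ 4 / (8 * 5040) - y ^+ 5 / (720 * 5040).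
    have -> : y ^+ 4 / (8 * 5040) - y ^+ 5 / (720 * 5040) = y ^+ 4 * (90 - y) / (720 * 5040) by field.
    by apply: divr_ge0; [apply: mulr_ge0; [exact: exprn_ge0|lra]|lra].
  have h2 : 0 <= y ^+ 2 / 24 - y ^+ 3 / 720 - y ^+ 2 * (24 / 720).
    have -> : y ^+ 2 / 24 - y ^+ 3 / 720 - y ^+ 2 * (24 / 720) = y ^+ 2 * (6 - y) / 720 by field.
    by apply: divr_ge0; [apply: mulr_ge0; [exact: exprn_ge0|lra]|lra].
  have h3 := sqr_ge0 (y - 5); rewrite sqrrB mulr2n in h3; lra.
(* Monotonicity of the cosine is available up to pi only. The Taylor bound keeps the cosine above -1
   on [0, tau], so pi is not reached. *)
have tp : tau < pi.
  rewrite ltNge; apply/negP => hp.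
  have pi2 : (pi : R) ^+ 2 <= Y by rewrite -t2 ler_sqr ?nnegrE // pi_ge0.
  by have := tay pi (pi_ge0 _) pi2; rewrite cospi ltxx.
have hc : - xprime R <= cos tau.
  apply: le_trans (cos_taylor10 t0).
  have e k : tau ^+ (2 * k) = Y ^+ k by rewrite exprM t2.
  rewrite (e 2%N) (e 3%N) (e 4%N) (e 5%N) t2 eY /xprime; lra.
rewrite leNgt; apply/negP => h.
have ha := acos_ge0 xprime_range.
have := cos_decr ha h (ltW tp); rewrite acosK ?in_itv /= ?xprime_range // => hlt.
by have := lt_le_trans hlt hc; rewrite ltxx.
Qed.

(** The gap t sin t - (1 - cos t) has derivative t cos t, so it rises up to pi / 2 and then falls;
    its minimum on the interval is at an endpoint. At the right one the inequality amounts to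
    [acos_xprime], and this is where the value 0.689 enters. *)
Lemma tangent_gap t : 0 <= t <= acos (- xprime R) -> 1 - cos t <= t * sin t.
Proof.
pose j (t : R) := t * sin t - (1 - cos t).
have dj x : deriv_at j x (x * cos x).
  apply: dv_eq.
    apply: dvB; first by apply: dvM (dvid x) (dvsin x).
    by apply: dvB (dvcst 1 x) (dvcos x).
  by rewrite /=; ring.
move=> /andP[t0 t1]; rewrite -subr_ge0 -/(j t).
have [th|th] := leP t (pi / 2).
  have -> : 0 = j 0 by rewrite /j sin0 cos0; ring.
  apply: (@derive_ge0_le _ j (fun x => x * cos x) 0 t t0) => x /andP[x0 xt]; first exact: dj.
  rewrite mulr_ge0 // cos_ge0_pihalf //; have := pi_ge0 R; lra.
have hp := acos_lepi xprime_range.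
apply: (@le_trans _ _ (j (acos (- xprime R)))); last first.
  rewrite -lerN2.
  apply: (@derive_ge0_le _ (fun x => - j x) (fun x => - (x * cos x)) t _ t1) => x /andP[xt xa].
    exact: dvN (dj x).
  rewrite oppr_ge0 mulr_ge0_le0 //; first by rewrite (le_trans t0).
  have -> : x = (x - pi / 2) + pi / 2 by ring.
  rewrite cosDpihalf oppr_le0 sin_ge0_pi //; have := pi_ge0 R; lra.
rewrite /j acosK ?in_itv /= ?xprime_range // sin_acos ?xprime_range // subr_ge0.
have hax := acos_xprime.
have [Y eY] : exists Y : R, Y = 1689 / 311 by eexists.
have [z ez] : exists z : R, z = 1689 / 1000 by eexists.
have Y0 : 0 < Y by rewrite eY; lra.
have z0 : 0 < z by rewrite ez; lra.
have -> : 1 - (- xprime R) ^+ 2 = z ^+ 2 / Y by rewrite /xprime ez eY; field.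
have -> : 1 - - xprime R = z by rewrite /xprime ez; field.
rewrite -eY in hax.
rewrite sqrtrM ?sqr_ge0 // (sqrtrV (ltW Y0)) sqrtr_sqr gtr0_norm //.
have s0 : 0 < Num.sqrt Y by rewrite sqrtr_gt0.
by rewrite mulrCA ler_pMr // ler_pdivlMr // mul1r.
Qed.

Lemma cos_lt1 t : 0 < t <= pi -> cos t < 1 :> R.
Proof.
move=> /andP[t0 tp]; by rewrite -cos0; apply: cos_decr.
Qed.

(** In the variable t = acos x the function is a multiple of t / (1 - cos t), whose derivative has
    the sign given by [tangent_gap]. *)
Lemma gfun_mono x z : - xprime R <= x -> x <= z -> z < 1 -> gfun x <= gfun z.
Proof.
move=> hx xz z1.
have xr : -1 <= x <= 1 by rewrite /xprime in hx; lra.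
have zr : -1 <= z <= 1 by rewrite /xprime in hx; lra.
have lec (a b : R) : a <= b -> -1 <= a -> b <= 1 -> acos b <= acos a.
  by rewrite le_eqVlt => /predU1P[->//|h] h1 h2; apply: ltW; exact: acos_decr.
have az0 : 0 < acos z by apply: acos_gt0; case/andP: zr => ->.
have azx : acos z <= acos x by apply: lec => //; lra.
have axp : acos x <= acos (- xprime R).
  by apply: lec => //; [case/andP: xprime_range | lra].
have hp := acos_lepi xprime_range.
have K : acos x * (1 - x)^-1 <= acos z * (1 - z)^-1.
  rewrite -lerN2.
  pose k (t : R) := - (t * (1 - cos t)^-1).
  have kz : k (acos z) = - (acos z * (1 - z)^-1) by rewrite /k acosK ?in_itv.
  have kx : k (acos x) = - (acos x * (1 - x)^-1) by rewrite /k acosK ?in_itv.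
  rewrite -kz -kx.
  pose dk (t : R) := (t * sin t - (1 - cos t)) * (1 - cos t) ^- 2.
  apply: (@derive_ge0_le _ k dk _ _ azx) => t /andP[tz tx].
    have c1 : 0 < 1 - cos t by rewrite subr_gt0 cos_lt1 //; lra.
    apply: dv_eq.
      apply: dvN; apply: dvM (dvid t) _; apply: dvV; first by rewrite gt_eqF.
      by apply: dvB (dvcst 1 t) (dvcos t).
    by rewrite /dk; field; rewrite gt_eqF.
  rewrite mulr_ge0 ?invr_ge0 ?sqr_ge0 // subr_ge0 tangent_gap //; lra.
have gE (a : R) : gfun a = 2 / pi * (acos a * (1 - a)^-1) by rewrite /gfun invfM; ring.
by rewrite !gE ler_wpM2l // divr_ge0 // pi_ge0.
Qed.

Lemma gfun_ge0 x : -1 <= x < 1 -> 0 <= gfun x.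
Proof.
move=> /andP[x1 x2]; rewrite /gfun divr_ge0 ?mulr_ge0 ?acos_ge0 ?pi_ge0 //; lra.
Qed.

Lemma alpha_le_gfun x : -1 <= x < 1 -> alpha_GW R <= gfun x.
Proof.
move=> hx; apply: ge_inf; last by exists x => //=; rewrite in_itv.
by exists 0 => _ [y /= hy <-]; apply: gfun_ge0; move: hy; rewrite in_itv.
Qed.

Lemma alpha_ge0 : 0 <= alpha_GW R.
Proof.
apply: lb_le_inf; first by exists (gfun 0), 0 => //=; rewrite in_itv /=; lra.
by move=> _ [y /= hy <-]; apply: gfun_ge0; move: hy; rewrite in_itv.
Qed.

Lemma gfun0 : gfun 0 = 1 :> R.
Proof. by rewrite /gfun acos0 subr0 mulr1 mulrCA mulfV ?mulr1 ?divff ?(lt0r_neq0 (pi_gt0 R)) // pnatr_eq0. Qed.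

(** To the right of -e the ratio is at least g(-e), and to the left at least the minimum alpha. The
    quadratic correction interpolates the two regimes; its coefficient 1 / e^2 makes the left
    comparison an equality at x = -e. *)
Lemma edge_bound e x : 0 < e <= xprime R -> -1 <= x <= 1 ->
  ((1 - e) * gfun (- e) + e * alpha_GW R) * (1 - x)
    - (gfun (- e) - alpha_GW R) * ((x ^+ 2 - e ^+ 4) / e ^+ 2) <= 2 * acos x / pi.
Proof.
move=> /andP[e0 e1] hx.
have er : e <= 689 / 1000 by exact: e1.
have gr : -1 <= - e < 1 by lra.
have ga := alpha_le_gfun gr.
have fE : x < 1 -> 2 * acos x / pi = gfun x * (1 - x).
  move=> x1; have x1' : 1 - x != 0 by rewrite subr_eq0 eq_sym lt_eqF.
  by rewrite /gfun invfM mulrA mulfVK.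
have q1 : - e <= x -> 0 <= e * (1 - x) + (x ^+ 2 - e ^+ 4) / e ^+ 2.
  move=> _; have -> : e * (1 - x) + (x ^+ 2 - e ^+ 4) / e ^+ 2 =
    ((x - e ^+ 3 / 2) ^+ 2 + e ^+ 3 * (1 - e - e ^+ 3 / 4)) / e ^+ 2 by field; rewrite gt_eqF.
  rewrite divr_ge0 ?sqr_ge0 // addr_ge0 ?sqr_ge0 // mulr_ge0 ?exprn_ge0 ?ltW //.
  have : e ^+ 3 <= 1 by rewrite exprn_ile1 ?ltW //; lra.
  lra.
have q2 : x < - e -> 1 - x <= e * (1 - x) + (x ^+ 2 - e ^+ 4) / e ^+ 2.
  move=> h; rewrite -subr_ge0; have -> : e * (1 - x) + (x ^+ 2 - e ^+ 4) / e ^+ 2 - (1 - x) =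
    ((- e - x) * (2 * e - e ^+ 2 + e ^+ 3) + (- e - x) ^+ 2) / e ^+ 2 by field; rewrite gt_eqF.
  rewrite divr_ge0 ?sqr_ge0 // addr_ge0 ?sqr_ge0 // mulr_ge0 //; first by lra.
  have : e ^+ 2 <= e by rewrite expr2 ler_piMr ?ltW //; lra.
  have : 0 <= e ^+ 3 by rewrite exprn_ge0 // ltW.
  lra.
have [h|h] := leP (- e) x.
  have gx : gfun (- e) * (1 - x) <= 2 * acos x / pi.
    have [x1|x1] := ltP x 1; last first.
      have -> : x = 1 by lra.
      by rewrite acos1 subrr !mulr0 mul0r.
    by rewrite fE //; apply: ler_wpM2r; [lra|apply: gfun_mono; lra].
  have := mulr_ge0 (_ : 0 <= gfun (- e) - alpha_GW R) (q1 h); rewrite subr_ge0 => /(_ ga).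
  by move: gx; lra.
have gx : alpha_GW R * (1 - x) <= 2 * acos x / pi.
  by rewrite fE; [apply: ler_wpM2r; [lra|apply: alpha_le_gfun; lra] | lra].
have g0 : 0 <= gfun (- e) - alpha_GW R by rewrite subr_ge0.
have := ler_wpM2l g0 (q2 h); move: gx; lra.
Qed.

(** Since acos (-x) >= pi / 2, the last factor in [hfun] is at least 1 / (1 + x) >= 1 - x, whence
    h(x) <= 1 - (1 - x)^2. *)
Lemma hfun_bound x : 0 <= x <= xprime R -> hfun x <= 2 * x.
Proof.
rewrite /xprime => /andP[x0 x1]; rewrite /hfun.
have a0 := alpha_ge0.
have h : 1 - x <= 2 * acos (- x) / (pi * (1 + x)).
  have hp : pi / 2 <= acos (- x).
    rewrite acosN; last by lra.
    have : acos x <= pi / 2.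
      move: x0; rewrite le_eqVlt => /predU1P[<-|x0]; first by rewrite acos0.
      by rewrite -acos0; apply: ltW; apply: acos_decr => //; lra.
    lra.
  have pi0 := pi_gt0 R.
  rewrite ler_pdivlMr ?mulr_gt0 //; last by lra.
  have : (1 - x) * (pi * (1 + x)) <= pi.
    have -> : (1 - x) * (pi * (1 + x)) = pi - pi * x ^+ 2 by ring.
    by rewrite lerBlDl lerDr mulr_ge0 ?sqr_ge0 // ltW.
  lra.
have x1' : 0 <= 1 - x by lra.
have := ler_wpM2l x1' h.
have : 0 <= x * alpha_GW R by rewrite mulr_ge0.
have := sqr_ge0 x; rewrite expr2; lra.
Qed.

Lemma hfun_cvg0 : @hfun R x @[x --> (0 : R)^'+] --> 0.
Proof.
apply: cvg_at_right_filter.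
have ac : acos (- x) @[x --> (0 : R)] --> acos (- 0 : R).
  apply: (@continuous_comp _ _ _ (fun x : R => - x) (@acos R)); first exact: opp_continuous.
  by rewrite oppr0; apply: continuous_acos; lra.
have e0 : 1 - 0 * alpha_GW R - (1 - 0) * (2 * acos (- 0) / (pi * (1 + 0))) = 0 :> R.
  have := gfun0; rewrite /gfun acos0 subr0 => h.
  by rewrite oppr0 acos0 addr0 h mul0r !subr0 mul1r subrr.
rewrite -[X in _ --> X]e0; apply: cvgB.
  by apply: cvgB; [exact: cvg_cst | apply: cvgM; [exact: cvg_id|exact: cvg_cst]].
apply: cvgM; first by apply: cvgB; [exact: cvg_cst|exact: cvg_id].
apply: cvgM; first by apply: cvgM; [exact: cvg_cst|exact: ac].
apply: cvgV; first by rewrite addr0 mulr1; exact: lt0r_neq0 (pi_gt0 R).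
by apply: cvgM; [exact: cvg_cst|apply: cvgD; [exact: cvg_cst|exact: cvg_id]].
Qed.

End GoemansWilliamson.


(** * Classical entropy and pair correlations *)

Section Flip.
Variables (R : realType) (n : nat).
Implicit Types (x : bits n) (i j : 'I_n).

Definition flip x i : bits n := setbit x i (~~ x i).

Lemma flipE x i k : flip x i k = if k == i then ~~ x i else x k.
Proof. by rewrite ffunE. Qed.

Lemma flipK i : involutive (flip^~ i).
Proof.
by move=> x; apply/ffunP => k; rewrite !flipE eqxx negbK; case: eqP => // ->.
Qed.

Lemma flip_inj i : injective (flip^~ i). Proof. exact: inv_inj (flipK i). Qed.

Lemma flipC x i j : flip (flip x i) j = flip (flip x j) i.
Proof.
have [->//|ij] := eqVneq i j; apply/ffunP => k; rewrite !flipE [j == i]eq_sym (negbTE ij).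
by have [->|_] := eqVneq k i; rewrite ?(negbTE ij).
Qed.

Lemma spin_flip x i : spin R (flip x i) i = - spin R x i.
Proof. by rewrite /spin flipE eqxx; case: (x i); rewrite ?opprK. Qed.

Lemma spin_flip_neq x i j : i != j -> spin R (flip x j) i = spin R x i.
Proof. by move=> ij; rewrite /spin flipE (negbTE ij). Qed.

Lemma spin_sq x i : spin R x i * spin R x i = 1.
Proof. by rewrite /spin; case: (x i); rewrite ?mulrNN mulr1. Qed.

End Flip.

Section ClassicalEntropy.
Variables (R : realType) (n : nat).
Implicit Types (f g h : bits n -> R) (x : bits n) (i j : 'I_n).

Lemma sum_flip i f : \sum_x f (flip x i) = \sum_x f x.
Proof. by rewrite [RHS](reindex_inj (@flip_inj n i)). Qed.

(** The law in which bit [i] is replaced by an independent fair coin. *)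
Definition avg i f x : R := (f x + f (flip x i)) / 2.
Definition avgs (l : seq 'I_n) f : bits n -> R := foldr avg f l.

Lemma sum_avg i f h : (forall x, h (flip x i) = h x) -> \sum_x avg i f x * h x = \sum_x f x * h x.
Proof.
move=> hi; have e : \sum_x f (flip x i) * h x = \sum_x f x * h x.
  by rewrite -[RHS](sum_flip i); apply: eq_bigr => x _; rewrite hi.
have -> : \sum_x avg i f x * h x = (\sum_x f x * h x + \sum_x f (flip x i) * h x) / 2.
  by rewrite -big_split mulr_suml; apply: eq_bigr => x _; rewrite /avg /=; ring.
by rewrite e; field.
Qed.

Lemma sum_avgs l f h : (forall i x, i \in l -> h (flip x i) = h x) ->
  \sum_x avgs l f x * h x = \sum_x f x * h x.
Proof.
elim: l => //= i l IH hl; rewrite sum_avg => [|x]; last by rewrite hl ?mem_head.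
by apply: IH => j x jl; rewrite hl // in_cons jl orbT.
Qed.

Lemma sum_avgs1 l f : \sum_x avgs l f x = \sum_x f x.
Proof.
have := @sum_avgs l f (fun=> 1) (fun _ _ _ => erefl).
by under eq_bigr do rewrite mulr1; under [in RHS]eq_bigr do rewrite mulr1.
Qed.

Lemma avg_gt0 i f : (forall x, 0 < f x) -> forall x, 0 < avg i f x.
Proof. by move=> f0 x; rewrite divr_gt0 // addr_gt0. Qed.

Lemma avgs_gt0 l f : (forall x, 0 < f x) -> forall x, 0 < avgs l f x.
Proof. by move=> f0; elim: l => //= i l IH; exact: avg_gt0. Qed.

Lemma avg_flip i f x : avg i f (flip x i) = avg i f x.
Proof. by rewrite /avg flipK addrC. Qed.

Definition chi2 i f : R := \sum_x (f x - avg i f x) ^+ 2 / avg i f x.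

(** The two-point Pinsker inequality on each pair {x, flip x i}, where [f] equals its average times
    1 + m and 1 - m. *)
Lemma entropy_avg i f : (forall x, 0 < f x) ->
  \sum_x psi (avg i f x) + chi2 i f / 2 <= \sum_x psi (f x).
Proof.
move=> f0; have a0 := avg_gt0 i f0.
have -> : \sum_x psi (f x) = \sum_x (psi (f x) + psi (f (flip x i))) / 2.
  by rewrite -mulr_suml big_split /= (sum_flip i (fun x => psi (f x))); field.
rewrite /chi2 mulr_suml -big_split /=; apply: ler_sum => x _.
have ax := a0 x; pose m := f x / avg i f x - 1.
have e1 : f x = avg i f x * (1 + m) by rewrite /m addrC subrK mulrC divfK // gt_eqF.
have e2 : f (flip x i) = avg i f x * (1 - m).
  have : f x + f (flip x i) = 2 * avg i f x by rewrite /avg; field.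
  by rewrite {1}e1; lra.
have m1 : -1 <= m <= 1.
  have h1 := f0 x; have h2 := f0 (flip x i); rewrite e1 pmulr_rgt0 // in h1; rewrite e2 pmulr_rgt0 // in h2.
  by apply/andP; split; lra.
have pk := two_point_pinsker m1.
have ps (t : R) : 0 <= t -> psi (avg i f x * t) = avg i f x * psi t + t * psi (avg i f x).
  rewrite /psi le_eqVlt => /predU1P[<-|t0]; first by rewrite !mulr0 !mul0r addr0 mulr0.
  by rewrite lnM ?posrE //; ring.
have /andP[m2 m3] := m1.
have E1 : psi (f x) = avg i f x * psi (1 + m) + (1 + m) * psi (avg i f x) by rewrite {1}e1 ps //; lra.
have E2 : psi (f (flip x i)) = avg i f x * psi (1 - m) + (1 - m) * psi (avg i f x) by rewrite e2 ps //; lra.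
rewrite E1 E2.
have -> : (f x - avg i f x) ^+ 2 / avg i f x = avg i f x * m ^+ 2.
  by rewrite e1; field; rewrite gt_eqF.
by move: pk => /(ler_wpM2l (ltW ax)); lra.
Qed.

(** The chain rule with each conditional entropy replaced by its chi-square lower bound: when bit
    [i] is treated, the bits of the tail are already uniform. *)
Fixpoint chain (l : seq 'I_n) f : R :=
  if l is i :: l' then chi2 i (avgs l' f) + chain l' f else 0.

Lemma entropy_chain l f : (forall x, 0 < f x) ->
  \sum_x psi (avgs l f x) + chain l f / 2 <= \sum_x psi (f x).
Proof.
move=> f0; elim: l => [|i l IH] /=; first by rewrite mul0r addr0.
have := entropy_avg i (avgs_gt0 l f0); lra.
Qed.

Lemma card_bits : #|{: bits n}| = (2 ^ n)%N.
Proof. by rewrite card_ffun card_bool card_ord. Qed.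

Lemma entropy_uniform_ge f : (forall x, 0 <= f x) -> \sum_x f x = 1 ->
  - (n%:R * ln 2) <= \sum_x psi (f x).
Proof.
move=> f0 f1; pose t : R := (2 ^+ n)^-1.
have t0 : 0 < t by rewrite invr_gt0 exprn_gt0.
have N : (#|{: bits n}|)%:R * t = 1.
  by rewrite card_bits natrX mulfV // gt_eqF // exprn_gt0.
have lnt : ln t = - (n%:R * ln 2).
  by rewrite lnV ?posrE ?exprn_gt0 // lnXn // mulr_natl.
have : \sum_x (psi t + (f x - t) * (1 + ln t)) <= \sum_x psi (f x).
  by apply: ler_sum => x _; exact: psi_tangent.
rewrite big_split /= sumr_const -[X in _ + X <= _]mulr_suml sumrB sumr_const f1.
rewrite -[t *+ _]mulr_natl N subrr mul0r addr0 -[psi t *+ _]mulr_natl (_ : psi t = t * ln t) // mulrA N mul1r lnt.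
by apply.
Qed.

Lemma weighted_CS f h : (forall x, 0 < f x) -> \sum_x f x = 1 ->
  (\sum_x h x) ^+ 2 <= \sum_x h x ^+ 2 / f x.
Proof.
move=> f0 f1; set s := \sum_x h x.
have : 0 <= \sum_x f x * (h x / f x - s) ^+ 2.
  by apply: sumr_ge0 => x _; rewrite mulr_ge0 ?sqr_ge0 // ltW.
have -> : \sum_x f x * (h x / f x - s) ^+ 2 =
    \sum_x h x ^+ 2 / f x - 2 * s * \sum_x h x + s ^+ 2 * \sum_x f x.
  have aux (a b c : R) : 0 < a -> a * (b / a - c) ^+ 2 = b ^+ 2 / a - 2 * c * b + c ^+ 2 * a.
    by move=> a0; field; rewrite gt_eqF.
  rewrite (eq_bigr _ (fun x _ => aux _ (h x) s (f0 x))) big_split sumrB /=.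
  by rewrite -!mulr_sumr.
by rewrite f1 -/s; lra.
Qed.

Definition corr f i j : R := \sum_x f x * (spin R x i * spin R x j).

(** Averaging over the bits of [l] leaves the correlation of [i] and [j] unchanged, and averaging
    over [i] destroys it. The correlation is thus carried by the difference measured by [chi2], and
    Cauchy-Schwarz applies. *)
Lemma corr_sq_le f l i j : (forall x, 0 < f x) -> \sum_x f x = 1 -> i \notin l -> j \notin l -> i != j ->
  corr f i j ^+ 2 <= chi2 i (avgs l f).
Proof.
move=> f0 f1 il jl ij; have g0 := avgs_gt0 l f0.
pose h x : R := spin R x i * spin R x j.
have -> : corr f i j = \sum_x (avgs l f x - avg i (avgs l f) x) * h x.
  have e : \sum_x avg i (avgs l f) x * h x = 0.
    have : \sum_x avg i (avgs l f) x * h x = - \sum_x avg i (avgs l f) x * h x.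
      rewrite -{1}(sum_flip i) -sumrN; apply: eq_bigr => x _.
      by rewrite avg_flip /h spin_flip spin_flip_neq 1?eq_sym // mulNr mulrN.
    lra.
  under [RHS]eq_bigr do rewrite mulrBl.
  rewrite sumrB e subr0 sum_avgs // => k x kl.
  by rewrite /h !spin_flip_neq //; apply: contraTneq kl => <-.
have s1 : \sum_x avg i (avgs l f) x = 1 by rewrite -(sum_avgs1 (i :: l) f) in f1.
apply: le_trans (weighted_CS _ (avg_gt0 i g0) s1) _; rewrite /chi2.
apply: ler_sum => x _; rewrite exprMn; have -> : h x ^+ 2 = 1.
  by rewrite /h expr2 mulrACA !spin_sq mulr1.
by rewrite mulr1.
Qed.

Lemma card_neighbours (e : rel 'I_n) Delta : regular e Delta -> forall i, #|e i| = Delta.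
Proof.
move=> h i; rewrite -(h i); apply: eq_card => j.
by apply/idP/idP => [hh|/set_mem //]; exact/mem_set.
Qed.

(** When [j] is treated only larger indices have been averaged, so one [chi2] term serves all
    smaller neighbours of [j], of which there are at most [Delta]. *)
Lemma sum_corr_sq_list (e : rel 'I_n) Delta f l : (forall x, 0 < f x) -> \sum_x f x = 1 ->
  regular e Delta -> (forall i j, e i j = e j i) ->
  pairwise (fun i j : 'I_n => i < j)%N l ->
  \sum_(j <- l) \sum_(i < n | (i < j)%N && e i j) corr f j i ^+ 2 <= Delta%:R * chain l f.
Proof.
move=> f0 f1 hD hs; elim: l => [_|j l IH] /=; first by rewrite big_nil mulr0.
move=> /andP[/allP jl /IH {}IH]; rewrite big_cons mulrDr; apply: lerD IH.
have c0 : 0 <= chi2 j (avgs l f).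
  by apply: sumr_ge0 => x _; rewrite divr_ge0 ?sqr_ge0 // ltW // avg_gt0 //; exact: avgs_gt0.
apply: (@le_trans _ _ (\sum_(i < n | (i < j)%N && e i j) chi2 j (avgs l f))).
  apply: ler_sum => i /andP[ij _]; apply: corr_sq_le => //.
  - by apply/negP => /jl; rewrite ltnn.
  - by apply/negP => /jl /ltn_trans /(_ ij); rewrite ltnn.
  - by apply: contraTneq ij => ->; rewrite ltnn.
rewrite sumr_const -[leLHS]mulr_natl; apply: ler_wpM2r => //; rewrite ler_nat -(card_neighbours hD j).
by apply: subset_leq_card; apply/fintype.subsetP => i /andP[_]; rewrite hs.
Qed.

Theorem sum_corr_sq_le (e : rel 'I_n) Delta f : simple_graph e -> regular e Delta ->
  (forall x, 0 < f x) -> \sum_x f x = 1 ->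
  \sum_(i < n) \sum_(j < n | (i < j)%N && e i j) corr f i j ^+ 2 <=
    2 * Delta%:R * (\sum_x psi (f x) + n%:R * ln 2).
Proof.
move=> [hs _] hD f0 f1.
have pw : pairwise (fun i j : 'I_n => i < j)%N (enum 'I_n).
  have := iota_ltn_sorted 0 n; rewrite -val_enum_ord sorted_pairwise; last exact: ltn_trans.
  by rewrite pairwise_map.
have := sum_corr_sq_list f0 f1 hD hs pw; rewrite big_enum /= => h.
have -> : \sum_(i < n) \sum_(j < n | (i < j)%N && e i j) corr f i j ^+ 2 =
    \sum_(j < n) \sum_(i < n | (i < j)%N && e i j) corr f j i ^+ 2.
  rewrite (exchange_big_dep xpredT) //=; apply: eq_bigr => j _; apply: eq_bigr => i _.
  by congr (_ ^+ 2); apply: eq_bigr => x _; rewrite [spin _ _ i * _]mulrC.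
apply: le_trans h _; rewrite -mulrA mulrCA ler_wpM2l //.
have h1 := entropy_chain (enum 'I_n) f0.
have h2 := entropy_uniform_ge (fun x => ltW (avgs_gt0 (enum 'I_n) f0 x)) (etrans (sum_avgs1 _ _) f1).
lra.
Qed.

Lemma edge_count (e : rel 'I_n) Delta : simple_graph e -> regular e Delta ->
  2 * (\sum_(i < n) \sum_(j < n | (i < j)%N && e i j) 1) = n%:R * Delta%:R :> R.
Proof.
move=> [hs hi] hD.
have -> : n%:R * Delta%:R = \sum_(i < n) \sum_(j < n | e i j) 1 :> R.
  have h i : \sum_(j < n | e i j) 1 = Delta%:R :> R by rewrite sumr_const -(card_neighbours hD i).
  by under eq_bigr do rewrite h; rewrite sumr_const card_ord mulr_natl.
have -> : \sum_(i < n) \sum_(j < n | e i j) 1 = \sum_(i < n) \sum_(j < n | (i < j)%N && e i j) 1 +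
    \sum_(i < n) \sum_(j < n | (j < i)%N && e i j) 1 :> R.
  rewrite -big_split /=; apply: eq_bigr => i _.
  rewrite (bigID (fun j : 'I_n => i < j)%N) /=; congr (_ + _); apply: eq_bigl => j; first by rewrite andbC.
  case eij: (e i j) => /=; last by rewrite andbF.
  rewrite andbT -leqNgt leq_eqVlt; case: eqVneq => [h|//].
  by move: eij; rewrite (val_inj h) (negbTE (hi i)).
rewrite [X in _ = _ + X](exchange_big_dep xpredT) //= mulr2n mulrDl mul1r; congr (_ + _).
by apply: eq_bigr => i _; apply: eq_bigl => j; rewrite hs.
Qed.

End ClassicalEntropy.


(** * Qubit operators and noisy circuits *)

Section Qubits.
Local Open Scope complex_scope.
Variables (R : realType) (n : nat).
Local Notation C := R[i].
Implicit Types (A B : op R n) (x y z : bits n) (i j : 'I_n).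

Lemma ent_mkop (f : bits n -> bits n -> C) x y : Defs.ent (mkop f) x y = f x y.
Proof. by rewrite /Defs.ent mxE !enum_rankK. Qed.

Lemma op_ext A B : (forall x y, Defs.ent A x y = Defs.ent B x y) -> A = B.
Proof.
move=> h; apply/matrixP => k l.
by have := h (enum_val k) (enum_val l); rewrite /Defs.ent !enum_valK.
Qed.

Lemma sum_bits (F : 'I_(Defs.dim n) -> C) : \sum_k F k = \sum_x F (enum_rank x).
Proof. by rewrite (reindex (@enum_rank _)) //=; apply: onW_bij; exact: enum_rank_bij. Qed.

Lemma entM A B x y : Defs.ent (A *m B) x y = \sum_z Defs.ent A x z * Defs.ent B z y.
Proof. by rewrite /Defs.ent mxE sum_bits. Qed.

Lemma entD A B x y : Defs.ent (A + B) x y = Defs.ent A x y + Defs.ent B x y.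
Proof. by rewrite /Defs.ent mxE. Qed.

Lemma entN A x y : Defs.ent (- A) x y = - Defs.ent A x y.
Proof. by rewrite /Defs.ent mxE. Qed.

Lemma entZ (k : C) A x y : Defs.ent (k *: A) x y = k * Defs.ent A x y.
Proof. by rewrite /Defs.ent mxE. Qed.

Lemma ent1 x y : Defs.ent (1%:M : op R n) x y = (x == y)%:R.
Proof. by rewrite /Defs.ent mxE (inj_eq enum_rank_inj). Qed.

Lemma ent_adj A x y : Defs.ent A^H x y = Num.conj (Defs.ent A y x).
Proof. by rewrite /Defs.ent !mxE. Qed.

Definition Xop i : op R n := mkop (fun x y => (x == flip y i)%:R).
Local Notation Z := (@Zop R n).

Lemma entZl i A x y : Defs.ent (Z i *m A) x y = (spin R x i)%:C * Defs.ent A x y.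
Proof.
rewrite entM (bigD1 x) //= ent_mkop eqxx mul1r big1 ?addr0 // => z zx.
by rewrite ent_mkop eq_sym (negbTE zx) !mul0r.
Qed.

Lemma entZr i A x y : Defs.ent (A *m Z i) x y = Defs.ent A x y * (spin R y i)%:C.
Proof.
rewrite entM (bigD1 y) //= ent_mkop eqxx mul1r big1 ?addr0 // => z zy.
by rewrite ent_mkop (negbTE zy) mul0r mulr0.
Qed.

Lemma flip_eq x y i : (flip x i == y) = (x == flip y i).
Proof. by rewrite -(inj_eq (@flip_inj n i)) flipK. Qed.

Lemma entXl i A x y : Defs.ent (Xop i *m A) x y = Defs.ent A (flip x i) y.
Proof.
rewrite entM (bigD1 (flip x i)) //= ent_mkop flipK eqxx mul1r big1 ?addr0 // => z zx.
by rewrite ent_mkop -flip_eq eq_sym (negbTE zx) mul0r.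
Qed.

Lemma entXr i A x y : Defs.ent (A *m Xop i) x y = Defs.ent A x (flip y i).
Proof.
rewrite entM (bigD1 (flip y i)) //= ent_mkop eqxx mulr1 big1 ?addr0 // => z zy.
by rewrite ent_mkop (negbTE zy) mulr0.
Qed.

Lemma conj_rmorphC (a : R) : Num.conj (a%:C) = a%:C :> C.
Proof. by apply/eqP; rewrite eq_complex /= oppr0 !eqxx. Qed.

Lemma Zop_herm i : adjmx (Z i) = Z i.
Proof.
apply: op_ext => x y; rewrite ent_adj !ent_mkop rmorphM /= conj_rmorphC conjC_nat.
by rewrite eq_sym; case: eqP => [->|]; rewrite ?mul0r.
Qed.

Lemma Xop_herm i : adjmx (Xop i) = Xop i.
Proof. by apply: op_ext => x y; rewrite ent_adj !ent_mkop conjC_nat eq_sym flip_eq. Qed.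

Lemma ZopK i : Z i *m Z i = 1%:M.
Proof.
apply: op_ext => x y; rewrite entZl ent_mkop ent1; case: eqP => _; last by rewrite mul0r mulr0.
by rewrite mul1r -rmorphM spin_sq rmorph1.
Qed.

Lemma XopK i : Xop i *m Xop i = 1%:M.
Proof. by apply: op_ext => x y; rewrite entXl ent_mkop ent1 (inj_eq (@flip_inj n i)). Qed.

Lemma XopZop i : Xop i *m Z i = - (Z i *m Xop i).
Proof.
apply: op_ext => x y; rewrite entN entXl entZl !ent_mkop flip_eq spin_flip rmorphN mulrN.
by rewrite mulrC.
Qed.

Lemma ZopC i j : Z i *m Z j = Z j *m Z i.
Proof. by apply: op_ext => x y; rewrite !entZl !ent_mkop mulrCA [RHS]mulrCA [X in _ * X]mulrC. Qed.

Lemma ZopXop i j : i != j -> Z i *m Xop j = Xop j *m Z i.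
Proof.
by move=> ij; apply: op_ext => x y; rewrite entZl entXl !ent_mkop flip_eq spin_flip_neq // mulrC.
Qed.

Lemma XopC i j : Xop i *m Xop j = Xop j *m Xop i.
Proof. by apply: op_ext => x y; rewrite !entXl !ent_mkop !flip_eq flipC. Qed.

Lemma conj_fixed (z : C) : Num.conj z = z -> z = (Re z)%:C.
Proof.
case: z => a b /eqP; rewrite eq_complex /= => /andP[_ /eqP h].
by apply/eqP; rewrite eq_complex /= eqxx; apply/eqP; lra.
Qed.

Lemma dg_spec (a : 'I_(Defs.dim n) -> R) : spec 1%:M a (dg a).
Proof. by split; [exact: unitary1|rewrite mul1mx adjmx1 mulmx1]. Qed.

Lemma spin_inj x y : (forall i, spin R x i = spin R y i) -> x = y.
Proof.
move=> h; apply/ffunP => i; have := h i; rewrite /spin; do 2!case: (_ i) => //; lra.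
Qed.

(** The signs determine a bit string, so [A] has at most one nonzero entry, and that entry is
    diagonal. *)
Lemma joint_eigenspace A (s : 'I_n -> R) : psd A ->
  (forall i, Z i *m A = (s i)%:C *: A /\ A *m Z i = (s i)%:C *: A) ->
  trf eta A = psi (rtr (A *m A)).
Proof.
move=> pA hs; have hA := psd_herm pA.
have hl x y i : Defs.ent A x y != 0 -> spin R x i = s i /\ spin R y i = s i.
  have [h1 h2] := hs i; move=> nz; split.
    have := congr1 (fun B => Defs.ent B x y) h1; rewrite entZl entZ => /(mulIf nz).
    by move=> /(congr1 (@complex.Re R)).
  have := congr1 (fun B => Defs.ent B x y) h2; rewrite entZr entZ mulrC => /(mulIf nz).
  by move=> /(congr1 (@complex.Re R)).
have [x0 hx0] : exists x0, forall x y, Defs.ent A x y != 0 -> x = x0 /\ y = x0.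
  have [[x y] nz|h] := pickP (fun p : bits n * bits n => Defs.ent A p.1 p.2 != 0).
    exists x => x' y' nz'; split; apply: spin_inj => i.
      by have [-> _] := hl _ _ i nz'; have [-> _] := hl _ _ i nz.
    by have [_ ->] := hl _ _ i nz'; have [-> _] := hl _ _ i nz.
  by exists [ffun=> false] => x y nz; have := h (x, y); rewrite /= nz.
pose a := Re (Defs.ent A x0 x0).
have ra : Defs.ent A x0 x0 = a%:C.
  by apply: conj_fixed; rewrite -ent_adj hA.
have eA : A = dg (fun k => if k == enum_rank x0 then a else 0).
  apply: op_ext => x y; rewrite {2}/Defs.ent /dg !mxE (inj_eq enum_rank_inj).
  have [nz|nz] := boolP (Defs.ent A x y != 0).
    by have [-> ->] := hx0 _ _ nz; rewrite !eqxx ra mulr1n.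
  move: nz; rewrite negbK => /eqP h; rewrite h (inj_eq enum_rank_inj).
  have [e|_] := eqVneq x y; last by rewrite mulr0n.
  have [e'|_] := eqVneq x x0; last by rewrite mulr1n.
  by rewrite mulr1n -ra -h -e e'.
have sA := dg_spec (fun k => if k == enum_rank x0 then a else 0); rewrite -eA in sA.
rewrite trf_sq // (trfE _ sA) (trfE _ sA).
rewrite (bigD1 (enum_rank x0)) //= eqxx big1 ?addr0 => [|k /negbTE -> ]; last by rewrite eta0.
by rewrite (bigD1 (enum_rank x0)) //= eqxx big1 ?addr0 // => k /negbTE ->; rewrite expr0n.
Qed.

Lemma qubit_modified_log_sobolev A : herm A -> (forall k, 0 < eig A k) -> rtr A = 1 ->
  2 * relent n A <= \sum_(i < n) rtr ((A - Eq Z Xop i A) *m logmx A).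
Proof.
apply: modified_log_sobolev; [exact: Zop_herm|exact: Xop_herm|exact: ZopK|exact: XopK
  |exact: XopZop|exact: ZopC|exact: ZopXop|exact: joint_eigenspace].
Qed.

Lemma pinch_psd (U : op R n) A : adjmx U = U -> psd A -> psd (pinch U A).
Proof.
move=> hU pA; rewrite /pinch; apply: psdZ; first by rewrite invr_ge0.
by apply: psdD => //; rewrite -{2}hU; exact: psd_conj.
Qed.

Lemma pinch_rtr (U A : op R n) : U *m U = 1%:M -> rtr (pinch U A) = rtr A.
Proof.
move=> UU; rewrite /pinch rtrZ rtrD; have -> : rtr (U *m A *m U) = rtr A.
  by rewrite /rtr mxtrace_mulC mulmxA UU mul1mx.
by field.
Qed.

Lemma pinch1 (U : op R n) : U *m U = 1%:M -> pinch U 1%:M = 1%:M.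
Proof.
move=> UU; rewrite /pinch mulmx1 UU -[1%:M in X in _ *: (X + _)]scale1r -[X in _ *: (_ + X)]scale1r.
by rewrite -scalerDl scalerA -(rmorph1 (real_complex R)) -rmorphD -rmorphM mulVf ?rmorph1 ?scale1r ?pnatr_eq0.
Qed.

(** The partial trace followed by tensoring with I / 2 is the Pauli twirl, so strength [p]
    corresponds to the parameter r = 1 - p. *)
Lemma depol1E (p : R) i A : depol1 p i A = dep (Eq Z Xop) (1 - p) i A.
Proof.
have eE : Eq Z Xop i A = _ := pinch2E (Z i) (Xop i) A.
apply: op_ext => x y; rewrite ent_mkop /dep eE entD !entZ; congr (_ + _); rewrite !entD !mulmxA !(entZr, entXr) -!mulmxA !(entZl, entXl).
have -> : 1 - (1 - p) = p by ring.
have b2 : (2^-1)%:C = 2^-1 :> C by rewrite rmorphV ?unitfE ?pnatr_eq0 //= rmorph_nat.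
have bp : (p / 2)%:C = p%:C / 2 :> C by rewrite rmorphM /= b2.
rewrite b2 bp; have sb b x' : setbit x' i b = if x' i == b then x' else flip x' i.
  apply/ffunP => k; rewrite ffunE; have [->|ki] := eqVneq k i.
    by have [//|ne] := eqVneq (x' i) b; rewrite flipE eqxx; case: (x' i) b ne => -[].
  by case: ifP => // _; rewrite flipE (negbTE ki).
rewrite !sb /spin ?flipE ?eqxx; case: (x i); case: (y i) => /=; rewrite ?rmorphN ?rmorph1; field; rewrite ?pnatr_eq0 //.
Qed.

Lemma foldr_ext (S U : Type) (f g : S -> U -> U) u l : (forall a b, f a b = g a b) -> foldr f u l = foldr g u l.
Proof. by move=> h; elim: l => //= a l ->. Qed.

Lemma depolE (p : R) A : depol p A = depl (Eq Z Xop) (1 - p) (enum 'I_n) A.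
Proof. by apply: foldr_ext => i B; exact: depol1E. Qed.

(** [e] relates strings that agree off the support of the gate, [f] reads the local bits and [g]
    writes them. Each class of [e] is thus a copy of 'I_m on which the matrix acts as [U]. *)
Lemma local_unitary m (U : 'M[C]_m) (f : bits n -> 'I_m) (g : bits n -> 'I_m -> bits n) (e : rel (bits n)) :
  equivalence_rel e -> (forall x k, e x (g x k)) -> (forall x k, f (g x k) = k) ->
  (forall x z, e x z -> g x (f z) = z) -> unitary U ->
  unitary (mkop (fun x y => U (f x) (f y) * (e x y)%:R)).
Proof.
move=> he h1 h2 h3 hU; apply: op_ext => x y; rewrite entM ent1.
under eq_bigr do rewrite ent_adj !ent_mkop rmorphM /= conjC_nat.
have er z : e z z by have [] := he z z z.
have es a b c : e a b -> e a c = e b c by have [_] := he a b c.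
have [exy|nexy] := boolP (e x y); last first.
  rewrite big1 => [|z _].
    by have [xy|//] := eqVneq x y; rewrite xy er in nexy.
  have [xz|] := boolP (e x z); last by rewrite mulr0 mul0r.
  have [yz|] := boolP (e y z); last by rewrite !mulr0.
  by move: nexy; rewrite (es _ _ _ xz) -(es _ _ y yz) er.
rewrite (bigID (e x)) /= [X in _ + X]big1 ?addr0 => [|z /negbTE ->]; last by rewrite mulr0 mul0r.
rewrite (reindex_onto (g x) f) /=; last by move=> z; exact: h3.
under eq_bigl do rewrite h1 h2 eqxx.
have -> : (x == y) = (f x == f y).
  apply/eqP/eqP => [->//|fxy]; by rewrite -(h3 x x (er x)) fxy h3.
have := congr1 (fun B : 'M[C]_m => B (f x) (f y)) hU; rewrite /= !mxE => <-.
apply: eq_bigr => k _; rewrite h2 h1 mulr1 -(es _ _ _ exy) h1 mulr1.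
by rewrite /adjmx !mxE.
Qed.

Lemma gate_unitary (g : gate R n) : gate_wf g -> unitary (gate_mx g).
Proof.
case: g => [i U|i j U] /=; [move=> hU | move=> [ij hU]].
  pose g x (k : 'I_2) := setbit x i (val k == 1%N).
  apply: (@local_unitary 2 U (fun x => bit2 (x i)) g
    (fun x y => [forall k, (k != i) ==> (x k == y k)])) => //.
  - move=> x y z; split; first by apply/forallP => k; rewrite eqxx implybT.
    move=> /forallP h; apply/forallP/forallP => h' k; apply/implyP => ki; have := h k; have := h' k;
      by rewrite ki /= => /eqP -> /eqP ->.
  - by move=> x k; apply/forallP => l; apply/implyP => li; rewrite ffunE (negbTE li).
  - move=> x k; rewrite ffunE eqxx /bit2; apply: val_inj; rewrite /= inordK; by case: k => [[|[|]]].
  - move=> x z /forallP h; apply/ffunP => k; rewrite ffunE; have [->|ki] := eqVneq k i.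
      by rewrite /bit2 /= inordK; case: (z i).
    by have := h k; rewrite ki => /eqP.
pose g x (k : 'I_4) := setbit (setbit x i (1 < val k)%N) j (odd (val k)).
apply: (@local_unitary 4 U (fun x => bit4 (x i) (x j)) g
    (fun x y => [forall k, ((k != i) && (k != j)) ==> (x k == y k)])) => //.
- move=> x y z; split; first by apply/forallP => k; rewrite eqxx implybT.
  move=> /forallP h; apply/forallP/forallP => h' k; apply/implyP => ki; have := h k; have := h' k;
      by rewrite ki /= => /eqP -> /eqP ->.
- by move=> x k; apply/forallP => l; apply/implyP => /andP[li lj]; rewrite !ffunE (negbTE li) (negbTE lj).
- move=> x k; rewrite !ffunE !eqxx (negbTE ij) /bit4; apply: val_inj; rewrite /= inordK; by case: k => [[|[|[|[|]]]]].
- move=> x z /forallP h; apply/ffunP => k; rewrite !ffunE.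
  have [->|kj] := eqVneq k j.
    by rewrite /bit4 /= inordK; case: (z i); case: (z j).
  have [->|ki] := eqVneq k i.
    by rewrite /bit4 /= inordK; case: (z i); case: (z j).
  by have := h k; rewrite ki kj => /eqP.
Qed.

Lemma layer_unitary (L : layer R n) : layer_wf L -> unitary (layer_mx L).
Proof.
move=> [h _]; rewrite /layer_mx; elim: L h => [_|g L IH h]; first by rewrite big_nil; exact: unitary1.
rewrite big_cons; apply: unitaryM; first by apply: gate_unitary; apply: h; left.
by apply: IH => g' hg'; apply: h; right.
Qed.

End Qubits.

Section ComplexEntries.
Local Open Scope complex_scope.

Lemma sum_bits_real (R : realType) n (F : 'I_(Defs.dim n) -> R) : \sum_k F k = \sum_(x : bits n) F (enum_rank x).
Proof. by rewrite (reindex (@enum_rank _)) //=; apply: onW_bij; exact: enum_rank_bij. Qed.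

Lemma ReD_real (R : realType) (z w : R[i]) : Re (z + w) = Re z + Re w.
Proof. by case: z; case: w. Qed.

Lemma ReB_real (R : realType) (z : R[i]) (a : R) : Re (z - a%:C) = Re z - a.
Proof. by case: z. Qed.

Lemma diag_spec (R : realType) m (U : 'M[R[i]]_m) (a : 'I_m -> R) k :
  Re ((U *m dg a *m U^H) k k) = \sum_l a l * nsq (U k l).
Proof.
rewrite mxE Re_sum; apply: eq_bigr => l _.
by rewrite /dg mul_mx_diag !mxE mulrAC mulCJ -rmorphM /= mulrC.
Qed.

Lemma scalar_spec (R : realType) m (d : R) : spec (1%:M : 'M[R[i]]_m) (fun=> d) (d%:C%:M).
Proof.
split; first exact: unitary1.
by rewrite mul1mx adjmx1 mulmx1; apply/matrixP => k l; rewrite !mxE.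
Qed.

End ComplexEntries.

(** * Entropy and correlations at the output of a noisy circuit *)

Section NoisyCircuit.
Local Open Scope complex_scope.
Variables (R : realType) (n : nat) (p : R).
Hypothesis hp : 0 <= p <= 1.
Local Notation C := R[i].
Implicit Types (A B : op R n) (x y z : bits n) (i j : 'I_n).
Local Notation Z := (@Zop R n).
Local Notation X := (@Xop R n).
Local Notation E := (Eq Z X).

Lemma Eq_psd i A : psd A -> psd (E i A).
Proof. by move=> h; apply: pinch_psd (Zop_herm R i) _; apply: pinch_psd (Xop_herm R i) h. Qed.

Lemma Eq_rtr i A : rtr (E i A) = rtr A.
Proof. by rewrite /Eq (pinch_rtr _ (ZopK R i)) (pinch_rtr _ (XopK R i)). Qed.

Lemma Eq_one i : E i 1%:M = 1%:M.
Proof. by rewrite /Eq (pinch1 (XopK R i)) (pinch1 (ZopK R i)). Qed.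

Let r01 : 0 <= 1 - p <= 1.
Proof. by move: hp => /andP[a b]; apply/andP; split; lra. Qed.

Lemma depol_psd A : psd A -> psd (depol p A).
Proof.
move=> hA; rewrite depolE /depl; elim: (enum _) => //= i l IH.
have [a b] := andP hp; rewrite {1}/dep; apply: psdD; apply: psdZ => //; [lra|lra|exact: Eq_psd].
Qed.

Lemma depol_rtr A : rtr (depol p A) = rtr A.
Proof.
rewrite depolE /depl; elim: (enum _) => //= i l IH.
by rewrite {1}/dep rtrD rtrZ rtrZ Eq_rtr IH; ring.
Qed.

Lemma dep_lin (r : R) i (a b : C) A B :
  dep E r i (a *: A + b *: B) = a *: dep E r i A + b *: dep E r i B.
Proof.
rewrite /dep EqD EqZ EqZ; move: (Eq Z X i A) (Eq Z X i B) => A1 B1.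
rewrite !scalerDr !scalerA [LHS]addrACA.
by congr (_ + _); congr (_ + _); congr (_ *: _); rewrite mulrC.
Qed.

Lemma depol_lin (a b : C) A B : depol p (a *: A + b *: B) = a *: depol p A + b *: depol p B.
Proof. by rewrite !depolE /depl; elim: (enum _) => //= i l ->; exact: dep_lin. Qed.

Lemma depol_one : depol p (1%:M : op R n) = 1%:M.
Proof.
rewrite depolE /depl; elim: (enum _) => //= i l ->.
by rewrite /dep Eq_one -scalerDl -rmorphD addrC subrK rmorph1 scale1r.
Qed.

Definition step (L : layer R n) A := depol p (layer_mx L *m A *m (layer_mx L)^H).

Lemma step_lin L (a b : C) A B : step L (a *: A + b *: B) = a *: step L A + b *: step L B.
Proof. by rewrite /step mulmxDr mulmxDl -!scalemxAr -!scalemxAl depol_lin. Qed.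

Lemma step_psd L A : psd A -> psd (step L A).
Proof. by move=> h; apply: depol_psd; exact: psd_conj. Qed.

Lemma step_one L : layer_wf L -> step L 1%:M = 1%:M.
Proof. by move=> /layer_unitary h; rewrite /step mulmx1 h depol_one. Qed.

Lemma step_rtr L A : layer_wf L -> rtr (step L A) = rtr A.
Proof.
move=> /layer_unitary /unitaryV h; rewrite /step depol_rtr /rtr mxtrace_mulC mulmxA.
by rewrite h mul1mx.
Qed.

Lemma step_posdef L A (d : R) : layer_wf L -> psd (A - d%:C%:M) -> psd (step L A - d%:C%:M).
Proof.
move=> hL; have e B : B - d%:C%:M = 1 *: B + (- d%:C) *: 1%:M.
  by rewrite scale1r scaleNr scalemx1.
have s1 : step L A - d%:C%:M = step L (A - d%:C%:M).
  by rewrite (e A) (e (step L A)) step_lin (step_one hL).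
by rewrite s1 => h; exact: step_psd.
Qed.

Lemma step_relent L A (d : R) : layer_wf L -> 0 < d -> psd A -> psd (A - d%:C%:M) -> rtr A = 1 ->
  relent n (step L A) <= (1 - p) ^+ 2 * relent n A.
Proof.
move=> hL d0 hA hd tA; have hU := layer_unitary hL.
have eR : relent n (layer_mx L *m A *m (layer_mx L)^H) = relent n A.
  by rewrite /relent trf_conj //; exact: psd_herm.
have hd' : psd (layer_mx L *m A *m (layer_mx L)^H - d%:C%:M).
  have -> : d%:C%:M = layer_mx L *m d%:C%:M *m (layer_mx L)^H.
    by rewrite -scalemx1 -scalemxAr -scalemxAl mulmx1 hU.
  by rewrite -mulmxBl -mulmxBr; exact: psd_conj.
have tr' : rtr (layer_mx L *m A *m (layer_mx L)^H) = 1.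
  by rewrite -tA /rtr mxtrace_mulC mulmxA (unitaryV hU) mul1mx.
have K := depolarizing_contraction (EqD Z X) (EqZ Z X) (Eq_idem (@ZopK R n) (@XopK R n) (@XopZop R n))
  (Eq_com (@XopZop R n) (@ZopC R n) (@ZopXop R n) (@XopC R n)) Eq_psd Eq_rtr Eq_one
  (@qubit_modified_log_sobolev R n) d0 (psd_conj _ hA) hd' tr' r01.
rewrite eR in K.
have eD : step L A = depl E (1 - p) (enum 'I_n) (layer_mx L *m A *m (layer_mx L)^H) by exact: depolE.
rewrite eD.
exact: K.
Qed.

Implicit Types c : circuit R n.

Lemma circuit_wf_cons L c : circuit_wf (L :: c) -> layer_wf L /\ circuit_wf c.
Proof. by move=> h; split; [apply: h; left|move=> L' hL'; apply: h; right]. Qed.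

Lemma noisy_psd c A : psd A -> psd (noisy_state p c A).
Proof. by elim: c A => [|L c IH] A h; [exact: h|exact: (IH (step L A) (step_psd L h))]. Qed.

Lemma noisy_rtr c A : circuit_wf c -> rtr (noisy_state p c A) = rtr A.
Proof.
rewrite /noisy_state; elim: c A => //= L c IH A /circuit_wf_cons[hL hc].
by rewrite IH //; exact: step_rtr.
Qed.

Lemma noisy_mix c A (a b : C) : circuit_wf c ->
  noisy_state p c (a *: A + b *: 1%:M) = a *: noisy_state p c A + b *: 1%:M.
Proof.
rewrite /noisy_state; elim: c A => //= L c IH A /circuit_wf_cons[hL hc].
have e : depol p (layer_mx L *m (a *: A + b *: 1%:M) *m adjmx (layer_mx L)) =
    a *: step L A + b *: step L 1%:M by exact: step_lin.
rewrite (step_one hL) in e.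
by rewrite e IH.
Qed.

Lemma noisy_posdef c A (d : R) : circuit_wf c -> psd (A - d%:C%:M) -> psd (noisy_state p c A - d%:C%:M).
Proof.
elim: c A => [|L c IH] A; first by [].
by move=> /circuit_wf_cons[hL hc] h; exact: (IH (step L A) hc (step_posdef hL h)).
Qed.

Lemma noisy_relent c A (d : R) : circuit_wf c -> 0 < d -> psd A -> psd (A - d%:C%:M) -> rtr A = 1 ->
  relent n (noisy_state p c A) <= ((1 - p) ^+ 2) ^+ size c * relent n A.
Proof.
rewrite /noisy_state; move=> + d0; elim: c A => [|L c IH] A /=; first by rewrite expr0 mul1r.
move=> /circuit_wf_cons[hL hc] hA hd tA.
have h := IH _ hc (step_psd L hA) (step_posdef hL hd) (etrans (step_rtr A hL) tA).
apply: le_trans h _; rewrite [_ ^+ (size c).+1]exprSr -mulrA; apply: ler_wpM2l; first by rewrite exprn_ge0 // sqr_ge0.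
exact: (step_relent hL d0 hA hd tA).
Qed.

Lemma relent_le A : psd A -> rtr A = 1 -> relent n A <= n%:R * ln 2.
Proof.
move=> hA tA; rewrite /relent gerDr; apply: sumr_le0 => j _.
have e0 k : 0 <= eig A k by exact: psd_eig.
have e1 : eig A j <= 1.
  rewrite -tA (trf_id (psd_herm hA)) /trf (bigD1 j) //= lerDl.
  by apply: sumr_ge0 => k _; exact: e0.
by rewrite /psi mulr_ge0_le0 // ln_le0.
Qed.

Definition pdist A x : R := Re (Defs.ent A x x).

Lemma pdist_sum A : \sum_x pdist A x = rtr A.
Proof. by rewrite /rtr /mxtrace Re_sum sum_bits_real. Qed.

Lemma diag_ge0 A x : psd A -> 0 <= pdist A x.
Proof.
move=> hA; have [_ e] := hermP (psd_herm hA); rewrite /pdist /Defs.ent; set k := enum_rank x.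
rewrite {1}e diag_spec; apply: sumr_ge0 => l _.
by rewrite mulr_ge0 ?nsq_ge0 //; exact: psd_eig.
Qed.

(** A diagonal entry is an average of eigenvalues with doubly stochastic weights, so Jensen's
    inequality applies, here through the tangent of [psi] at that entry. *)
Lemma diag_entropy A : psd A -> (forall x, 0 < pdist A x) -> \sum_x psi (pdist A x) <= trf psi A.
Proof.
move=> hA h0; have [hU e] := hermP (psd_herm hA).
have pE k : Re (A k k) = \sum_l eig A l * nsq (eigv A k l) by rewrite {1}e diag_spec.
have -> : \sum_x psi (pdist A x) = \sum_k psi (Re (A k k)).
  by rewrite (sum_bits_real (fun k => psi (Re (A k k)))).
have J k : psi (Re (A k k)) <= \sum_l nsq (eigv A k l) * psi (eig A l).
  have t0 : 0 < Re (A k k) by have := h0 (enum_val k); rewrite /pdist /Defs.ent enum_valK.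
  set t := Re (A k k).
  apply: (@le_trans _ _ (\sum_l nsq (eigv A k l) * (psi t + (eig A l - t) * (1 + ln t)))); last first.
    by apply: ler_sum => l _; rewrite ler_wpM2l ?nsq_ge0 // psi_tangent // psd_eig.
  have -> : \sum_l nsq (eigv A k l) * (psi t + (eig A l - t) * (1 + ln t)) =
     (\sum_l nsq (eigv A k l)) * (psi t - t * (1 + ln t)) + (\sum_l eig A l * nsq (eigv A k l)) * (1 + ln t).
    by rewrite !mulr_suml -big_split; apply: eq_bigr => l _ /=; ring.
  by rewrite (unitary_row k hU) -pE -/t mul1r subrK.
apply: le_trans (ler_sum _ (fun k _ => J k)) _; rewrite exchange_big /=.
apply: ler_sum => l _; by rewrite -mulr_suml (unitary_col l hU) mul1r.
Qed.

Lemma SigmaE A i j : Sigma A i j = corr (pdist A) i j.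
Proof.
rewrite /Sigma /mxtrace Re_sum sum_bits_real; apply: eq_bigr => x _.
have -> : (A *m (Z i *m Z j)) (enum_rank x) (enum_rank x) =
   (spin R x i * spin R x j)%:C * Defs.ent A x x.
  have h : Defs.ent (A *m Z i *m Z j) x x = Defs.ent A x x * (spin R x i)%:C * (spin R x j)%:C.
    by rewrite !entZr.
  by rewrite mulmxA -/(Defs.ent (A *m Z i *m Z j) x x) h -mulrA -rmorphM mulrC.
by rewrite ReZ mulrC.
Qed.

Lemma corr_const i j : i != j -> corr (fun _ : bits n => 1 : R) i j = 0.
Proof.
move=> ij; have : corr (fun _ : bits n => 1 : R) i j = - corr (fun=> 1) i j.
  rewrite {1}/corr -(sum_flip i) -sumrN; apply: eq_bigr => x _.
  by rewrite spin_flip spin_flip_neq 1?eq_sym // mulNr mulrN.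
lra.
Qed.

Theorem sum_Sigma_sq_le (e : rel 'I_n) Delta c A : simple_graph e -> regular e Delta ->
  circuit_wf c -> psd A -> rtr A = 1 ->
  \sum_(i < n) \sum_(j < n | (i < j)%N && e i j) Sigma (noisy_state p c A) i j ^+ 2 <=
    2 * Delta%:R * (((1 - p) ^+ 2) ^+ size c * (n%:R * ln 2)).
Proof.
move=> sg rg hc hA tA; set S := \sum_(i < n) _; set B := 2 * _ * _.
have S0 : 0 <= S by apply: sumr_ge0 => i _; apply: sumr_ge0 => j _; exact: sqr_ge0.
have pos2 : 0 < (2 ^ n)%:R :> R by rewrite ltr0n expn_gt0.
(* The input is mixed with weight [t] of the maximally mixed state. The uniform law has no
   correlations between distinct bits, so the mixture only scales each one by [1 - t]. *)
have mix (t : R) : 0 < t -> t <= 1 -> (1 - t) ^+ 2 * S <= B.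
  move=> t0 t1; pose d := t / (2 ^ n)%:R; have d0 : 0 < d by rewrite divr_gt0.
  have [A' eA'] : exists A', A' = (1 - t)%:C *: A + d%:C *: 1%:M by eexists.
  have t1' : 0 <= 1 - t by rewrite subr_ge0.
  have hd : psd (A' - d%:C%:M) by rewrite eA' scalemx1 addrK; exact: psdZ.
  have p1 : psd (d%:C%:M : op R n).
    by apply: (@spec_psd _ _ 1%:M (fun=> d)) => [|k]; [exact: scalar_spec|exact: ltW].
  have hA' : psd A' by rewrite -[A'](subrK (d%:C%:M)); exact: psdD.
  have tr1 : rtr (1%:M : op R n) = (2 ^ n)%:R.
    rewrite -pdist_sum; under eq_bigr do rewrite /pdist ent1 eqxx.
    by rewrite sumr_const card_bits.
  have tA' : rtr A' = 1 by rewrite eA' rtrD !rtrZ tA tr1 /d; field; rewrite gt_eqF.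
  have nA := noisy_psd c hA'; have nd := noisy_posdef hc hd.
  have nE : noisy_state p c A' = (1 - t)%:C *: noisy_state p c A + d%:C *: 1%:M by rewrite eA' noisy_mix.
  have pd0 x : 0 < pdist (noisy_state p c A') x.
    have := diag_ge0 x nd; rewrite /pdist /Defs.ent !mxE eqxx mulr1n ReB_real subr_ge0.
    exact: lt_le_trans.
  have ps : \sum_x pdist (noisy_state p c A') x = 1 by rewrite pdist_sum noisy_rtr.
  have pl x : pdist (noisy_state p c A') x = (1 - t) * pdist (noisy_state p c A) x + d * 1.
    by rewrite /pdist nE entD !entZ ent1 eqxx ReD_real !ReZ.
  have K := sum_corr_sq_le sg rg pd0 ps.
  have -> : (1 - t) ^+ 2 * S = \sum_(i < n) \sum_(j < n | (i < j)%N && e i j)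
      corr (pdist (noisy_state p c A')) i j ^+ 2.
    rewrite /S mulr_sumr; apply: eq_bigr => i _; rewrite mulr_sumr; apply: eq_bigr => j /andP[ij _].
    rewrite -exprMn SigmaE; congr (_ ^+ 2).
    have ne : i != j by apply: contraTneq ij => ->; rewrite ltnn.
    have -> : corr (pdist (noisy_state p c A')) i j =
       (1 - t) * corr (pdist (noisy_state p c A)) i j + d * corr (fun=> 1) i j.
      by rewrite /corr !mulr_sumr -big_split; apply: eq_bigr => x _ /=; rewrite pl; ring.
    by rewrite corr_const // mulr0 addr0.
  apply: le_trans K _; rewrite /B; apply: ler_wpM2l; first by rewrite mulr_ge0.
  apply: (@le_trans _ _ (relent n (noisy_state p c A'))).
    by rewrite /relent lerD2r; exact: diag_entropy.
  apply: le_trans (noisy_relent hc d0 hA' hd tA') _; apply: ler_wpM2l; last exact: relent_le.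
  by rewrite exprn_ge0 // sqr_ge0.
(* With [t = 1 / N], expanding the square leaves S - B <= 2 S / N. *)
rewrite -subr_le0; apply: (@le0_of_le_divn _ _ (2 * S) 1) => [|N N1 _]; first by rewrite mulr_ge0.
have N0 : 0 < N%:R :> R by rewrite ltr0n.
have := mix N%:R^-1; rewrite invr_gt0 N0 invf_le1 // ler1n N1 => /(_ isT isT).
set u := N%:R^-1; have u0 : 0 <= u ^+ 2 * S by rewrite mulr_ge0 // sqr_ge0.
by rewrite -/u; lra.
Qed.

End NoisyCircuit.


(** * Gaussian rounding *)

Lemma limr_le_norm (R : realType) (M : R) (u : nat -> R) l :
  u k @[k --> \oo] --> l -> (forall k, `|u k| <= M) -> `|l| <= M.
Proof.
move=> ul uM; have h : `|u k| @[k --> \oo] --> `|l| by exact: cvg_norm.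
rewrite -(cvg_lim (@Rhausdorff R) h); apply: limr_le; first by apply/cvg_ex; eexists; exact: h.
exact: nearW.
Qed.

Section Rounding.
Context (R : realType) (d : measure_display) (T : measurableType d) (P : probability T R).
Implicit Types f g : T -> R.

Definition bm f := measurable_fun setT f /\ exists M, forall t, `|f t| <= M.
Definition Ex f : R := fine (\int[P]_t (f t)%:E).

Lemma ExE f : Ex f = fine (\int[P]_t (f t)%:E).
Proof. by []. Qed.

Lemma bm_integrable f : bm f -> P.-integrable setT (EFin \o f).
Proof.
move=> [mf [M hM]]; apply: measurable_bounded_integrable => //.
  by rewrite (le_lt_trans (probability_le1 P measurableT)) // ltry.
exists M; split; first exact: num_real.
by move=> x Mx y _; apply: le_trans (hM y) (ltW Mx).
Qed.

Lemma Ex_fin f : bm f -> (\int[P]_t (f t)%:E = (Ex f)%:E)%E.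
Proof. by move=> /bm_integrable h; rewrite /Ex fineK // integrable_fin_num. Qed.

Lemma bmD f g : bm f -> bm g -> bm (fun t => f t + g t).
Proof.
move=> [mf [M hM]] [mg [N hN]]; split; first exact: measurable_funD.
by exists (M + N) => t; apply: le_trans (ler_normD _ _) (lerD _ _).
Qed.

Lemma bmZ k f : bm f -> bm (fun t => k * f t).
Proof.
move=> [mf [M hM]]; split; first by apply: measurable_funM => //; exact: measurable_cst.
by exists (`|k| * M) => t; rewrite normrM ler_wpM2l.
Qed.

Lemma bmM f g : bm f -> bm g -> bm (fun t => f t * g t).
Proof.
move=> [mf [M hM]] [mg [N hN]]; split; first exact: measurable_funM.
by exists (M * N) => t; rewrite normrM; apply: ler_pM.
Qed.

Lemma bm_cst k : bm (fun=> k).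
Proof. by split; [exact: measurable_cst|exists `|k| => t]. Qed.

Lemma ExD f g : bm f -> bm g -> Ex (fun t => f t + g t) = Ex f + Ex g.
Proof.
move=> hf hg; apply: EFin_inj; rewrite -(Ex_fin (bmD hf hg)) EFinD -!Ex_fin //.
by under eq_integral do rewrite EFinD; rewrite integralD //; exact: bm_integrable.
Qed.

Lemma ExZ k f : bm f -> Ex (fun t => k * f t) = k * Ex f.
Proof.
move=> hf; apply: EFin_inj; rewrite -(Ex_fin (bmZ k hf)) EFinM -!Ex_fin //.
by under eq_integral do rewrite EFinM; rewrite integralZl //; exact: bm_integrable.
Qed.

Lemma Ex_cst k : Ex (fun=> k) = k.
Proof.
apply: EFin_inj; rewrite -(Ex_fin (bm_cst k)) integral_cst //.
by rewrite [X in (_ * X)%E]probability_setT mule1.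
Qed.

Lemma Ex_ge0 f : (forall t, 0 <= f t) -> 0 <= Ex f.
Proof. by move=> h; apply: fine_ge0; apply: integral_ge0 => t _; rewrite lee_fin. Qed.

Lemma bm_sum (I : Type) (r : seq I) (F : I -> T -> R) :
  (forall i, bm (F i)) -> bm (fun t => \sum_(i <- r) F i t).
Proof.
move=> h; elim: r => [|i r IH].
  by under eq_fun do rewrite big_nil; exact: bm_cst.
by under eq_fun do rewrite big_cons; exact: bmD.
Qed.

Lemma Ex_sum (I : Type) (r : seq I) (F : I -> T -> R) :
  (forall i, bm (F i)) -> Ex (fun t => \sum_(i <- r) F i t) = \sum_(i <- r) Ex (F i).
Proof.
move=> h; elim: r => [|i r IH].
  by rewrite big_nil; under eq_fun do rewrite big_nil; exact: Ex_cst.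
rewrite big_cons -IH -ExD //; last exact: bm_sum.
by congr Ex; apply/funext => t; rewrite big_cons.
Qed.

Lemma Ex_cvg (F : nat -> T -> R) f (M : R) :
  (forall k, measurable_fun setT (F k)) -> (forall k t, `|F k t| <= M) ->
  measurable_fun setT f -> (forall t, F k t @[k --> \oo] --> f t) ->
  Ex (F k) @[k --> \oo] --> Ex f.
Proof.
move=> mF bF mf cF.
have h : (\int[P]_t (F k t)%:E @[k --> \oo] --> \int[P]_t (f t)%:E)%E.
  apply: (@dominated_cvg _ _ _ P setT measurableT (fun k t => (F k t)%:E) (fun t => (f t)%:E) (fun=> M%:E)).
  - by move=> k; apply/measurable_EFinP; exact: mF.
  - by move=> t _; apply: cvg_EFin; [exact: nearW|exact: cF].
  - by [].
  - exact: (bm_integrable (bm_cst M)).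
  - by move=> k t _ /=; rewrite lee_fin.
apply: fine_cvg; rewrite fineK //; apply: integrable_fin_num => //.
apply: bm_integrable; split=> //; exists M => t.
by apply: (@limr_le_norm _ M (fun k => F k t)).
Qed.

End Rounding.

(** * Approximation of signs by trigonometric sums *)

Section TrigonometricSums.
Context (R : realType).
Implicit Types (F G : R -> R -> R) (a b c f : R).

(** Test functions whose expectations depend only on the laws of the linear combinations of u and v.
    Product-to-sum formulas make the class closed under products, hence under polynomials in
    sines. *)
Inductive trigsum : (R -> R -> R) -> Prop :=
| trigsum0 : trigsum (fun _ _ => 0)
| trigsumS c a b f F : trigsum F -> trigsum (fun u v => c * cos (a * u + b * v + f) + F u v).

Lemma trigsum_eq F G : (forall u v, F u v = G u v) -> trigsum F -> trigsum G.
Proof. by move=> h; have -> : F = G by apply/funext => u; apply/funext => v. Qed.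

Lemma trigsumD F G : trigsum F -> trigsum G -> trigsum (fun u v => F u v + G u v).
Proof.
move=> hF hG; elim: hF => [|c a b f F' _ IH].
  by apply: trigsum_eq hG => u v; rewrite add0r.
by apply: trigsum_eq (trigsumS c a b f IH) => u v; rewrite addrA.
Qed.

Lemma trigsum_cos c a b f : trigsum (fun u v => c * cos (a * u + b * v + f)).
Proof. by apply: trigsum_eq (trigsumS c a b f trigsum0) => u v; rewrite addr0. Qed.

Lemma trigsum_cosM c a b f G : trigsum G ->
  trigsum (fun u v => c * cos (a * u + b * v + f) * G u v).
Proof.
elim=> [|c' a' b' f' G' _ IH].
  by apply: trigsum_eq trigsum0 => u v; rewrite mulr0.
have h1 := trigsum_cos (c * c' / 2) (a + a') (b + b') (f + f').
have h2 := trigsum_cos (c * c' / 2) (a - a') (b - b') (f - f').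
apply: trigsum_eq (trigsumD (trigsumD h1 h2) IH) => u v.
have -> : (a + a') * u + (b + b') * v + (f + f') = (a * u + b * v + f) + (a' * u + b' * v + f') by ring.
have -> : (a - a') * u + (b - b') * v + (f - f') = (a * u + b * v + f) - (a' * u + b' * v + f') by ring.
by rewrite cosB cosD; field.
Qed.

Lemma trigsumM F G : trigsum F -> trigsum G -> trigsum (fun u v => F u v * G u v).
Proof.
move=> hF hG; elim: hF => [|c a b f F' _ IH].
  by apply: trigsum_eq trigsum0 => u v; rewrite mul0r.
by apply: trigsum_eq (trigsumD (trigsum_cosM c a b f hG) IH) => u v; rewrite mulrDl.
Qed.

Lemma trigsumZ k F : trigsum F -> trigsum (fun u v => k * F u v).
Proof.
move=> hF; apply: trigsum_eq (trigsumM (trigsum_cos k 0 0 0) hF) => u v.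
by rewrite !mul0r !addr0 cos0 mulr1.
Qed.

(* [smoothstep] pushes every nonzero point of [-1, 1] towards its sign. *)
Definition smoothstep (t : R) : R := (3 * t - t ^+ 3) / 2.

Lemma trigsum_smoothstep m F : trigsum F -> trigsum (fun u v => iter m smoothstep (F u v)).
Proof.
move=> hF; elim: m => //= m IH.
have h := trigsumM IH (trigsumM IH IH).
apply: trigsum_eq (trigsumD (trigsumZ (3 / 2) IH) (trigsumZ (- 2^-1) h)) => u v.
by rewrite /smoothstep; set x := iter _ _ _; field.
Qed.

Lemma smoothstepN t : smoothstep (- t) = - smoothstep t.
Proof. by rewrite /smoothstep; field. Qed.

Lemma iter_smoothstepN m t : iter m smoothstep (- t) = - iter m smoothstep t.
Proof. by elim: m => //= m ->; rewrite smoothstepN. Qed.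

Lemma iter_smoothstep0 m : iter m smoothstep 0 = 0.
Proof. by elim: m => //= m ->; rewrite /smoothstep mulr0 expr0n /= subr0 mul0r. Qed.

(** The distance to 1 is multiplied at each step by (1 - x)(2 + x) / 2, which is at most 1 - t / 2
    since the iterates x stay above [t]. *)
Lemma iter_smoothstep_ge m t : 0 <= t <= 1 ->
  t <= iter m smoothstep t <= 1 /\ 1 - iter m smoothstep t <= (1 - t / 2) ^+ m.
Proof.
move=> /andP[t0 t1]; elim: m => [|m [/andP[]]] /=.
  by rewrite lexx t1 expr0; split=> //; lra.
set x := iter _ _ _ => tx x1 IH.
have x0 : 0 <= x by exact: le_trans tx.
have e1 : smoothstep x - x = x * (1 - x) * (1 + x) / 2 by rewrite /smoothstep; field.
have e2 : 1 - smoothstep x = (1 - x) * ((1 - x) * (2 + x) / 2) by rewrite /smoothstep; field.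
have y0 : 0 <= 1 - x by lra.
have p1 : 0 <= (1 - x) * (2 + x) / 2 <= 1 - t / 2.
  apply/andP; split; first by rewrite divr_ge0 // mulr_ge0 //; lra.
  have := mulr_ge0 x0 x0; lra.
have q1 : 0 <= smoothstep x - x.
  by rewrite e1 divr_ge0 // mulr_ge0 ?mulr_ge0 //; lra.
have /andP[p2 p3] := p1.
have q2 : 0 <= 1 - smoothstep x by rewrite e2 mulr_ge0.
split; first by apply/andP; split; lra.
by rewrite e2 exprSr; apply: ler_pM.
Qed.

Lemma iter_smoothstep_norm m t : `|t| <= 1 -> `|iter m smoothstep t| <= 1.
Proof.
have h s : 0 <= s <= 1 -> `|iter m smoothstep s| <= 1.
  move=> s0; have [/andP[a b] _] := iter_smoothstep_ge m s0.
  by rewrite ger0_norm // (le_trans _ a) //; case/andP: s0.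
move=> t1; have [t0|t0] := leP 0 t; first by apply: h; rewrite t0 (le_trans (ler_norm _) t1).
rewrite -[t]opprK iter_smoothstepN normrN; apply: h.
by rewrite oppr_ge0 (ltW t0) /= -(ltr0_norm t0).
Qed.

Lemma iter_smoothstep_cvg t : `|t| <= 1 -> iter m smoothstep t @[m --> \oo] --> Num.sg t.
Proof.
have pos s : 0 < s <= 1 -> iter m smoothstep s @[m --> \oo] --> (1 : R).
  move=> /andP[s0 s1]; have s0' : 0 <= s <= 1 by rewrite (ltW s0).
  apply: (@squeeze_cvgr _ _ _ _ (fun m => 1 - (1 - s / 2) ^+ m) (fun=> 1)).
  - apply: nearW => m; have [/andP[_ a] b] := iter_smoothstep_ge m s0'.
    by rewrite a andbT; lra.
  - rewrite -[X in _ --> X]subr0; apply: cvgB; first exact: cvg_cst.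
    by apply: cvg_expr; rewrite ltr_norml; apply/andP; split; lra.
  - exact: cvg_cst.
move=> t1; have [t0|t0|t0] := ltgtP 0 t; last rewrite -t0.
- by rewrite gtr0_sg //; apply: pos; rewrite t0 (le_trans (ler_norm _) t1).
- rewrite ltr0_sg //.
  have -> : (fun m => iter m smoothstep t) = (fun m => - iter m smoothstep (- t)).
    by apply/funext => m; rewrite iter_smoothstepN opprK.
  by apply: cvgN; apply: pos; rewrite oppr_gt0 t0 /= -(ltr0_norm t0).
- rewrite sgr0; have -> : (fun m => iter m smoothstep (0 : R)) = fun=> 0.
    by apply/funext => m; rewrite iter_smoothstep0.
  exact: cvg_cst.
Qed.

Definition rsign (x : R) : R := if 0 <= x then 1 else -1.

Lemma rsign_norm x : `|rsign x| <= 1.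
Proof. by rewrite /rsign; case: ifP => _; rewrite ?normrN normr1. Qed.

(* The shift by [k.+1^-1] makes the approximants converge to [1] at [u = 0]. *)
Definition usign k u : R := sin (k.+1%:R^-1 * u + k.+1%:R^-1 ^+ 2).

(** For fixed [u] the sequence is eventually constant: once [k] is large the argument of the sine
    lies within (-pi, pi), and it has the sign of u + 1 / (k + 1). *)
Lemma sg_usign_cvg u : Num.sg (usign k u) @[k --> \oo] --> rsign u.
Proof.
have dk : @GRing.inv R k.+1%:R @[k --> \oo] --> 0.
  exact: cvg_harmonic.
have pi0 := pi_gt0 R.
have small (e : R) : 0 < e -> \forall k \near \oo, k.+1%:R^-1 < e.
  move=> e0; move/cvgrPdist_lt: dk => /(_ e e0); apply: filterS => k.
  by rewrite sub0r normrN ger0_norm // invr_ge0.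
have bnd : 0 < Num.min 1 (pi / (`|u| + 1)).
  by rewrite lt_min ltr01 divr_gt0 // ltr_pwDr.
apply: cvg_near_cst; rewrite /rsign.
have key k : k.+1%:R^-1 < Num.min 1 (pi / (`|u| + 1)) -> k.+1%:R^-1 * (`|u| + k.+1%:R^-1) < pi.
  rewrite lt_min => /andP[h1 h2].
  apply: lt_le_trans (_ : k.+1%:R^-1 * (`|u| + 1) <= _).
    by rewrite ltr_pM2l ?ltrD2l // invr_gt0.
  by rewrite -ler_pdivlMr ?(ltW h2) // ltr_pwDr.
case: ifPn => [u0|]; [|rewrite -ltNge => u0].
  apply: filterS (small _ bnd) => k /key; rewrite (ger0_norm u0) => h.
  rewrite /usign expr2 -mulrDr gtr0_sg // sin_gt0_pi // h andbT mulr_gt0 ?invr_gt0 //.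
  by rewrite ltr_wpDl // invr_gt0.
have u1 : 0 < - u by rewrite oppr_gt0.
near=> k.
have h1 : k.+1%:R^-1 < Num.min 1 (pi / (`|u| + 1)) by near: k; exact: small.
have h2 : k.+1%:R^-1 < - u by near: k; exact: small.
have h3 := key _ h1; rewrite (ltr0_norm u0) in h3.
have k0 : 0 < k.+1%:R^-1 :> R by rewrite invr_gt0.
rewrite /usign expr2 -mulrDr -[X in sin X]opprK sinN sgrN gtr0_sg // sin_gt0_pi //.
rewrite -mulrN opprD mulr_gt0 //=; last by rewrite subr_gt0.
by apply: le_lt_trans h3; rewrite ler_pM2l // lerD2l (le_trans _ (ltW k0)) // oppr_le0 ltW.
Unshelve. all: by end_near.
Qed.

Lemma trigsum_signs m k : trigsum (fun u v => iter m smoothstep (usign k u) * iter m smoothstep (usign k v)).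
Proof.
apply: trigsumM; apply: trigsum_smoothstep.
  apply: trigsum_eq (trigsum_cos 1 k.+1%:R^-1 0 (k.+1%:R^-1 ^+ 2 - pi / 2)) => u v.
  by rewrite mul0r addr0 mul1r addrA cosBpihalf.
apply: trigsum_eq (trigsum_cos 1 0 k.+1%:R^-1 (k.+1%:R^-1 ^+ 2 - pi / 2)) => u v.
by rewrite mul0r add0r mul1r addrA cosBpihalf.
Qed.

End TrigonometricSums.

(** * Pairs with the same laws of linear combinations *)

Section SameLaw.
Context (R : realType) (d : measure_display) (T : measurableType d) (P : probability T R).
Local Notation bm := (@bm R d T).
Local Notation Ex := (Ex P).

Definition same_law (X Y : T -> R) := forall A : set R, measurable A -> P (X @^-1` A) = P (Y @^-1` A).

Lemma Ex_same_law (h X Y : _ -> R) (M : R) : measurable_fun setT h -> (forall x, `|h x| <= M) ->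
  measurable_fun setT X -> measurable_fun setT Y -> same_law X Y ->
  Ex (fun t => h (X t)) = Ex (fun t => h (Y t)).
Proof.
move=> mh hM mX mY XY.
have int Z : measurable_fun setT Z -> P.-integrable setT ((EFin \o h) \o Z).
  move=> mZ; apply: bm_integrable; split; last by exists M.
  exact: measurableT_comp.
have mEh : measurable_fun setT (EFin \o h) by exact/measurable_EFinP.
congr fine.
have := @integral_pushforward _ _ _ _ R X mX P setT (EFin \o h) mEh.
rewrite preimage_setT => /(_ (int _ mX) measurableT) <-.
have := @integral_pushforward _ _ _ _ R Y mY P setT (EFin \o h) mEh.
rewrite preimage_setT => /(_ (int _ mY) measurableT) <-.
by apply: eq_measure_integral => A mA _; exact: XY.
Qed.

Context (U V U' V' : T -> R).
Hypotheses (mU : measurable_fun setT U) (mV : measurable_fun setT V).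
Hypotheses (mU' : measurable_fun setT U') (mV' : measurable_fun setT V').
Hypothesis laws : forall a b : R,
  same_law (fun t => a * U t + b * V t) (fun t => a * U' t + b * V' t).

Let det (F : R -> R -> R) := [/\ bm (fun t => F (U t) (V t)), bm (fun t => F (U' t) (V' t))
  & Ex (fun t => F (U t) (V t)) = Ex (fun t => F (U' t) (V' t))].

Lemma measurable_lin (a b : R) (X Y : T -> R) : measurable_fun setT X -> measurable_fun setT Y ->
  measurable_fun setT (fun t => a * X t + b * Y t).
Proof.
move=> mX mY; apply: measurable_funD; apply: measurable_funM => //; exact: measurable_cst.
Qed.

Let det_trigsum F : trigsum F -> det F.
Proof.
elim=> [|c a b f F' _ [h1 h2 h3]]; first by split=> //; exact: bm_cst.
have mcos : measurable_fun setT (fun x : R => cos (x + f)).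
  apply: continuous_measurable_fun => x; apply: continuous_comp; last exact: continuous_cos.
  by apply: cvgD; [exact: cvg_id|exact: cvg_cst].
have bcos x : `|cos (x + f)| <= 1 by rewrite ler_norml cos_geN1 cos_le1.
have hb X Y : measurable_fun setT X -> measurable_fun setT Y ->
    bm (fun t => c * cos (a * X t + b * Y t + f)).
  move=> mX mY; apply: bmZ; split; last by exists 1.
  by apply: (measurableT_comp mcos); exact: measurable_lin.
split; [by apply: bmD => //; exact: hb | by apply: bmD => //; exact: hb |].
rewrite !ExD ?h3 //; try exact: hb.
have hb' X Y : measurable_fun setT X -> measurable_fun setT Y ->
    bm (fun t => cos (a * X t + b * Y t + f)).
  move=> mX mY; split; last by exists 1.
  by apply: (measurableT_comp mcos); exact: measurable_lin.
rewrite !ExZ; [|exact: hb'|exact: hb'].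
congr (_ * _ + _); apply: (Ex_same_law mcos bcos) => //; exact: measurable_lin.
Qed.

Let det_cvg (F : nat -> R -> R -> R) G : (forall k, det (F k)) ->
  (forall k u v, `|F k u v| <= 1) -> (forall u v, F k u v @[k --> \oo] --> G u v) -> det G.
Proof.
move=> hF bF cF.
have mG X Y : (forall k, bm (fun t => F k (X t) (Y t))) -> measurable_fun setT (fun t => G (X t) (Y t)).
  move=> h; apply: (measurable_fun_cvg (h := fun k t => F k (X t) (Y t))) => [k|t _]; first by have [] := h k.
  exact: cF.
have m1 : measurable_fun setT (fun t => G (U t) (V t)) by apply: mG => k; have [] := hF k.
have m2 : measurable_fun setT (fun t => G (U' t) (V' t)) by apply: mG => k; have [] := hF k.
have bG u v : `|G u v| <= 1 by apply: (limr_le_norm (cF u v)).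
split; [by split=> //; exists 1|by split=> //; exists 1|].
have c1 : Ex (fun t => F k (U t) (V t)) @[k --> \oo] --> Ex (fun t => G (U t) (V t)).
  by apply: (@Ex_cvg _ _ _ P _ _ 1) => // k; have [[]] := hF k.
have c2 : Ex (fun t => F k (U' t) (V' t)) @[k --> \oo] --> Ex (fun t => G (U' t) (V' t)).
  by apply: (@Ex_cvg _ _ _ P _ _ 1) => // k; have [_ []] := hF k.
have e : (fun k => Ex (fun t => F k (U t) (V t))) = (fun k => Ex (fun t => F k (U' t) (V' t))).
  by apply/funext => k; have [] := hF k.
by rewrite e in c1; apply: (cvg_unique (@Rhausdorff R) c1 c2).
Qed.

(** Two successive dominated limits: the number of smoothing steps tends to infinity first, turning
    the sines into their signs, and then the frequency parameter. *)
Lemma Ex_rsign_same_law :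
  Ex (fun t => rsign (U t) * rsign (V t)) = Ex (fun t => rsign (U' t) * rsign (V' t)).
Proof.
have us1 k (u : R) : `|usign k u| <= 1 by rewrite ler_norml sin_geN1 sin_le1.
have h : det (fun u v => rsign u * rsign v).
  apply: (@det_cvg (fun k u v => Num.sg (usign k u) * Num.sg (usign k v))).
  - move=> k; apply: (@det_cvg (fun m u v => iter m (@smoothstep R) (usign k u) * iter m (@smoothstep R) (usign k v))).
    + by move=> m; apply: det_trigsum; exact: trigsum_signs.
    + by move=> m u v; rewrite normrM mulr_ile1 // iter_smoothstep_norm.
    + by move=> u v; apply: cvgM; exact: iter_smoothstep_cvg.
  - by move=> k u v; rewrite normrM mulr_ile1 // normr_sg lern1 leq_b1.
  - by move=> u v; apply: cvgM; exact: sg_usign_cvg.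
by case: h.
Qed.

End SameLaw.

(** Additivity and the relation between [v] and [pi - v] give q(pi / N) >= 1 / N. Since [q] is
    nonnegative and additive, comparing [th] with multiples of pi / N loses at most 1 / N. *)
Lemma angle_lower_bound (R : realType) (q : R -> R) (th : R) : (forall v, 0 <= q v) ->
  (forall v1 v2, 0 < v1 -> 0 < v2 -> v1 + v2 < pi -> q (v1 + v2) = q v1 + q v2) ->
  (forall v, 1 <= q v + q (pi - v)) -> 0 < th < pi -> th / pi <= q th.
Proof.
move=> q_ge0 qD qpi /andP[th0 thpi].
have pi0 := pi_gt0 R.
have qn k v : 0 < v -> k.+1%:R * v < pi -> q (k.+1%:R * v) = k.+1%:R * q v.
  move=> v0; elim: k => [_|k IH h]; first by rewrite !mul1r.
  rewrite -natr1 mulrDl mul1r in h *.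
  rewrite qD ?IH // ?mulrDl ?mul1r //; [by apply: le_lt_trans h; rewrite lerDl ltW|by rewrite mulr_gt0].
rewrite -subr_le0; apply: (@le0_of_le_divn _ _ 1 2) => // N N2 N0.
have NR : 0 < N%:R :> R by rewrite ltr0n.
have v0 : 0 < pi / N%:R :> R by rewrite divr_gt0.
have qN : 1 / N%:R <= q (pi / N%:R).
  have := qpi (pi / N%:R); case: N N2 N0 NR v0 => // -[//|N] _ _ NR v0.
  have -> : pi - pi / N.+2%:R = N.+1%:R * (pi / N.+2%:R) :> R.
    have aux (a z : R) : a + 1 != 0 -> z - z / (a + 1) = a * (z / (a + 1)) by move=> h; field.
    by rewrite -[N.+2%:R]natr1; apply: aux; rewrite natr1 gt_eqF.
  rewrite qn //; last first.
    by rewrite mulrCA gtr_pMr // ltr_pdivrMr // mul1r ltr_nat.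
  set v := pi / _ => h.
  by rewrite ler_pdivrMr // -[N.+2%:R]natr1 mulrDr mulr1 addrC [q v * _]mulrC.
have [k hk1 hk2] : exists2 k : nat, k%:R * (pi / N%:R) <= th & th < k.+1%:R * (pi / N%:R).
  have t0 : 0 <= th / (pi / N%:R) by rewrite divr_ge0 // ltW.
  exists (Num.truncn (th / (pi / N%:R))).
    by rewrite -ler_pdivlMr //; have /andP[] := truncn_itv t0.
  by rewrite -ltr_pdivrMr //; have /andP[] := truncn_itv t0.
have kq : k%:R / N%:R <= q th.
  case: k hk1 hk2 => [_ _|k hk1 _]; first by rewrite mul0r.
  have h1 : k.+1%:R / N%:R <= q (k.+1%:R * (pi / N%:R)).
    rewrite (qn _ _ v0 (le_lt_trans hk1 thpi)); apply: ler_wpM2l => //.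
    by move: qN; rewrite mul1r.
  apply: le_trans h1 _; move: hk1; rewrite le_eqVlt => /predU1P[->//|hk1].
  have := qD (k.+1%:R * (pi / N%:R)) (th - k.+1%:R * (pi / N%:R)).
  rewrite [_ + (th - _)]addrC subrK subr_gt0 (mulr_gt0 (ltr0Sn R k) v0) => /(_ isT hk1 thpi) ->.
  by rewrite lerDl.
have : th / pi <= k.+1%:R / N%:R.
  rewrite ler_pdivrMr // mulrAC; apply: ltW; apply: lt_le_trans hk2 _.
  by rewrite mulrA mulrAC.
rewrite -[k.+1%:R]natr1 mulrDl; lra.
Qed.

(** * Sign disagreement of a Gaussian pair *)

Section GaussianPair.
Context (R : realType) (d : measure_display) (T : measurableType d) (P : probability T R).
Local Notation bm := (@bm R d T).
Local Notation Ex := (Ex P).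

Lemma rsign_measurable (X : T -> R) : measurable_fun setT X -> measurable_fun setT (fun t => rsign (X t)).
Proof.
move=> mX; have m0 : measurable_fun setT (@rsign R).
  have -> : @rsign R = (fun x => 2 * \1_(`[0, +oo[%classic : set R) x + (-1) * 1).
    apply/funext => x; rewrite /rsign indicE mem_setE /= in_itv /= andbT.
    by case: (0 <= x) => /=; lra.
  apply: measurable_lin; last exact: measurable_cst.
  by apply: measurable_indic; exact: measurable_itv.
exact: (measurableT_comp m0 mX).
Qed.

Lemma bm_rsign (X : T -> R) : measurable_fun setT X -> bm (fun t => rsign (X t)).
Proof. by move=> /rsign_measurable h; split=> //; exists 1 => t; exact: rsign_norm. Qed.

Lemma Ex_le f g : bm f -> bm g -> (forall t, f t <= g t) -> Ex f <= Ex g.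
Proof.
move=> bf bg fg; rewrite -subr_ge0.
have -> : Ex g - Ex f = Ex (fun t => g t + (-1) * f t).
  by rewrite ExD // ?ExZ // ?mulN1r //; exact: bmZ.
by apply: Ex_ge0 => t; rewrite mulN1r subr_ge0.
Qed.

(** Adding the indicator of a null event leaves expectations unchanged, so pointwise inequalities
    need to hold only outside ties. *)
Lemma Ex_preimage (X : T -> R) (A : set R) : measurable_fun setT X -> measurable A ->
  P (X @^-1` A) = 0%E -> bm (fun t => \1_A (X t) : R) /\ Ex (fun t => \1_A (X t)) = 0.
Proof.
move=> mX mA h; have mXA : measurable (X @^-1` A).
  by rewrite -[_ @^-1` _]setTI; exact: mX.
have e : (fun t => \1_A (X t) : R) = \1_(X @^-1` A).
  by apply/funext => t; rewrite !indicE; congr (_%:R); rewrite !mem_setE.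
have bI : bm (\1_(X @^-1` A) : T -> R).
  split; first exact: measurable_indic.
  by exists 1 => t; rewrite indicE normr_nat lern1 leq_b1.
split; first by rewrite e.
by rewrite e ExE integral_indic // setIT; exact: (congr1 fine h).
Qed.

Context (U V : T -> R) (rho : R).
Hypotheses (mU : measurable_fun setT U) (mV : measurable_fun setT V).
Hypothesis law : forall (a b : R) (A : set R), measurable A ->
  P ((fun t => a * U t + b * V t) @^-1` A) = gauss_law (a ^+ 2 + 2 * a * b * rho + b ^+ 2) A.

Let dis (X Y : T -> R) t : R := (1 - rsign (X t) * rsign (Y t)) / 2.

Let bm_dis X Y : measurable_fun setT X -> measurable_fun setT Y -> bm (dis X Y).
Proof.
move=> mX mY.
have -> : dis X Y = fun t => 2^-1 + (- 2^-1) * (rsign (X t) * rsign (Y t)).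
  by apply/funext => t; rewrite /dis; field.
by apply: bmD; [exact: bm_cst|apply: bmZ; apply: bmM; exact: bm_rsign].
Qed.

Let dis_ge0 X Y t : 0 <= dis X Y t.
Proof. by rewrite /dis /rsign; do 2!case: ifP => _; lra. Qed.

Let Ex_dis X Y : measurable_fun setT X -> measurable_fun setT Y ->
  Ex (dis X Y) = (1 - Ex (fun t => rsign (X t) * rsign (Y t))) / 2.
Proof.
move=> mX mY.
have -> : dis X Y = fun t => 2^-1 + (- 2^-1) * (rsign (X t) * rsign (Y t)).
  by apply/funext => t; rewrite /dis; field.
have bM : bm (fun t => rsign (X t) * rsign (Y t)) by apply: bmM; exact: bm_rsign.
by rewrite ExD ?ExZ ?Ex_cst //; [field|exact: bm_cst|exact: bmZ].
Qed.

Let normal_null (s : R) : s != 0 -> gauss_law s [set 0] = 0%E.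
Proof.
move=> s0; rewrite /gauss_law (negbTE s0).
apply: (@normal_prob_dominates R 0 (Num.sqrt s) [set 0]) => //.
by apply/measure0_null_setP; [exact: measurable_set1|exact: lebesgue_measure_set1].
Qed.

Let acos_div_le : -1 < rho < 1 -> acos rho / pi <= Ex (dis U V).
Proof.
move=> hr; have hr' : -1 <= rho <= 1 by lra.
pose s := Num.sqrt (1 - rho ^+ 2).
have s2 : s ^+ 2 = 1 - rho ^+ 2.
  rewrite sqr_sqrtr //; have : 0 <= (1 - rho) * (1 + rho) by [rewrite mulr_ge0; lra]; lra.
have s0 : 0 < s.
  by rewrite sqrtr_gt0; have : 0 < (1 - rho) * (1 + rho) by [rewrite mulr_gt0; lra]; lra.
(* The Gaussian in direction [b] of the plane: cos b times U plus sin b times the normalized part of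
   V orthogonal to U. U sits at angle 0 and V at angle [acos rho]. *)
pose W b t := (cos b - rho * (sin b / s)) * U t + (sin b / s) * V t.
have mW b : measurable_fun setT (W b) by exact: measurable_lin.
(* Rotation invariance: the law involves the difference [v] of the two angles and not [u]. *)
have lawW (a b u v : R) A : measurable A ->
    P ((fun t => a * W u t + b * W (u + v) t) @^-1` A) = gauss_law (a ^+ 2 + b ^+ 2 + 2 * a * b * cos v) A.
  move=> mA; pose p := a * cos u + b * cos (u + v); pose q := a * sin u + b * sin (u + v).
  have -> : (fun t => a * W u t + b * W (u + v) t) =
      (fun t => (p - rho * (q / s)) * U t + (q / s) * V t).
    by apply/funext => t; rewrite /W /p /q; ring.
  have -> : a ^+ 2 + b ^+ 2 + 2 * a * b * cos v =
      (p - rho * (q / s)) ^+ 2 + 2 * (p - rho * (q / s)) * (q / s) * rho + (q / s) ^+ 2.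
    have -> : (p - rho * (q / s)) ^+ 2 + 2 * (p - rho * (q / s)) * (q / s) * rho + (q / s) ^+ 2 =
       p ^+ 2 + (1 - rho ^+ 2) * (q ^+ 2 / s ^+ 2) by field; rewrite gt_eqF.
    rewrite -s2 mulrCA mulfV ?mulr1; last by rewrite expf_neq0 // gt_eqF.
    have cs := cos2Dsin2 u; have cs' := cos2Dsin2 (u + v).
    have -> : cos v = cos (u + v) * cos u + sin (u + v) * sin u by rewrite -cosB addrC addKr.
    have -> : p ^+ 2 + q ^+ 2 = a ^+ 2 * (cos u ^+ 2 + sin u ^+ 2) + b ^+ 2 * (cos (u + v) ^+ 2 + sin (u + v) ^+ 2)
       + 2 * a * b * (cos (u + v) * cos u + sin (u + v) * sin u) by rewrite /p /q; ring.
    by rewrite cs cs' !mulr1.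
  exact: (law _ _ mA).
pose q v := Ex (dis (W 0) (W v)).
have qE u v : Ex (dis (W u) (W (u + v))) = q v.
  rewrite /q !Ex_dis //; congr ((1 - _) / 2).
  apply: Ex_rsign_same_law => // a b A mA.
  by rewrite lawW // -[W v](congr1 W (add0r v)) lawW.
have q_ge0 v : 0 <= q v by apply: Ex_ge0.
have qD v1 v2 : 0 < v1 -> 0 < v2 -> v1 + v2 < pi -> q (v1 + v2) = q v1 + q v2.
  move=> v10 v20 vpi; rewrite -{1}(qE v1 v2) /q -ExD; [|exact: bm_dis|exact: bm_dis].
  congr Ex; apply/funext => t.
  have S1 : 0 < sin v1 by apply: sin_gt0_pi; apply/andP; split=> //; lra.
  have S2 : 0 < sin v2 by apply: sin_gt0_pi; apply/andP; split=> //; lra.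
  have S3 : 0 < sin (v1 + v2) by apply: sin_gt0_pi; apply/andP; split=> //; lra.
  (* The middle direction is a positive combination of the outer two, so it shares their sign
     whenever they agree. Disagreements are therefore additive at every sample point. *)
  have key : sin (v1 + v2) * W v1 t = sin v2 * W 0 t + sin v1 * W (v1 + v2) t.
    have e1 : sin (v1 + v2) * cos v1 = sin v2 + sin v1 * cos (v1 + v2).
      rewrite sinD cosD; have := cos2Dsin2 v1 => c1.
      have -> : (sin v1 * cos v2 + cos v1 * sin v2) * cos v1 =
        sin v2 * (cos v1 ^+ 2 + sin v1 ^+ 2) + sin v1 * (cos v1 * cos v2 - sin v1 * sin v2) by ring.
      by rewrite c1 mulr1.
    rewrite /W cos0 sin0 mul0r mulr0 subr0 mul0r addr0 mul1r mulrDr mulrA mulrBr e1; ring.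
  have nn : 0 <= W 0 t -> 0 <= W (v1 + v2) t -> 0 <= W v1 t.
    by move=> h1 h2; rewrite -(pmulr_rge0 _ S3) key addr_ge0 // mulr_ge0 // ltW.
  have np : W 0 t < 0 -> W (v1 + v2) t < 0 -> W v1 t < 0.
    by move=> h1 h2; rewrite -(pmulr_rlt0 _ S3) key; apply: ltr_nDl; rewrite ?pmulr_rlt0 // pmulr_rle0 // ltW.
  rewrite /dis /rsign; case: (leP 0 (W 0 t)) => h0; case: (leP 0 (W (v1 + v2) t)) => h2.
  - by rewrite (nn h0 h2); field.
  - by case: (0 <= W v1 t); field.
  - by case: (0 <= W v1 t); field.
  - by rewrite leNgt (np h0 h2) /=; field.
(* [W pi] is the opposite of [W 0], so unless [W 0] vanishes, a null event, [W v] disagrees with one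
   of the two. *)
have qpi v : 1 <= q v + q (pi - v).
  rewrite -(qE v (pi - v)) [v + (pi - v)]addrC subrK /q.
  have n0 : P ((W 0) @^-1` [set 0]) = 0%E.
    have -> : W 0 = (fun t => 1 * W 0 t + 0 * W (0 + 0) t) by apply/funext => t; rewrite mul1r mul0r addr0.
    by rewrite lawW //; apply: normal_null; rewrite expr1n expr0n /= mulr0 mul0r !addr0 oner_eq0.
  have [b0 e0] := Ex_preimage (mW 0) (measurable_set1 0) n0.
  have b1 := bm_dis (mW 0) (mW v); have b2 := bm_dis (mW v) (mW pi).
  have e3 := ExD P (bmD b1 b2) b0; have e4 := ExD P b1 b2; rewrite e4 e0 addr0 in e3.
  rewrite -e3 -[leLHS](Ex_cst P); apply: Ex_le => [||t]; [exact: bm_cst|exact: bmD (bmD b1 b2) b0|].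
  have -> : dis (W v) (W pi) t = (1 - rsign (W v t) * rsign (- W 0 t)) / 2.
    by rewrite /dis; congr ((1 - _ * rsign _) / 2); rewrite /W cospi sinpi cos0 sin0; ring.
  rewrite /dis /rsign indicE oppr_ge0; have [h|h|h] := ltgtP (W 0 t) 0.
  - by case: (0 <= W v t); case: (_ \in _) => /=; lra.
  - by case: (0 <= W v t); case: (_ \in _) => /=; lra.
  - by rewrite mem_set //=; case: (0 <= W v t); lra.
pose th := acos rho.
have th0 : 0 < th by apply: acos_gt0; lra.
have thpi : th < pi by apply: acos_ltpi; lra.
have -> : Ex (dis U V) = q th.
  rewrite /q; congr (Ex (dis _ _)); apply/funext => t; rewrite /W.
    by rewrite cos0 sin0 mul0r mulr0 subr0 mul0r addr0 mul1r.
  rewrite /th acosK; last by rewrite in_itv.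
  rewrite sin_acos // -/s divff ?gt_eqF //; ring.
by apply: angle_lower_bound => //; rewrite th0.
Qed.

Lemma gaussian_rounding_ge : -1 <= rho <= 1 ->
  2 * acos rho / pi <= 1 - Ex (fun t => rsign (U t) * rsign (V t)).
Proof.
move=> /andP[r1 r2].
suff : acos rho / pi <= Ex (dis U V) by rewrite Ex_dis // -mulrA; lra.
move: r2; rewrite le_eqVlt => /predU1P[->|r2]; first by rewrite acos1 mul0r; apply: Ex_ge0.
move: r1; rewrite le_eqVlt => /predU1P[r1|r1]; last by apply: acos_div_le; rewrite r1.
(* At [rho = -1] the variance of U + V is 0, its law is a Dirac mass, and V = -U almost surely. Off
   the null event U = 0 the two signs differ. *)
rewrite -r1 acosN1 divff ?gt_eqF ?pi_gt0 //.
have mUV : measurable_fun setT (fun t => 1 * U t + 1 * V t) by exact: measurable_lin.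
have mU1 : measurable_fun setT (fun t => 1 * U t + 0 * V t) by exact: measurable_lin.
have n0 : P ((fun t => 1 * U t + 0 * V t) @^-1` [set 0]) = 0%E.
  by rewrite law //; apply: normal_null; rewrite expr1n expr0n /= mulr0 mul0r !addr0 oner_eq0.
have mC : measurable (~` [set 0] : set R) by apply: measurableC; exact: measurable_set1.
have n1 : P ((fun t => 1 * U t + 1 * V t) @^-1` (~` [set 0])) = 0%E.
  rewrite law // /gauss_law -r1; have -> : 1 ^+ 2 + 2 * 1 * 1 * -1 + 1 ^+ 2 = 0 :> R by ring.
  by rewrite eqxx diracE memNset //= => /(_ erefl).
have [b0 e0] := Ex_preimage mU1 (measurable_set1 0) n0.
have [b1 e1] := Ex_preimage mUV mC n1.
have b2 := bm_dis mU mV.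
have e3 := ExD P (bmD b2 b0) b1; have e4 := ExD P b2 b0; rewrite e4 e0 e1 !addr0 in e3.
rewrite -e3 -[leLHS](Ex_cst P); apply: Ex_le => [||t]; [exact: bm_cst|exact: bmD (bmD b2 b0) b1|].
rewrite !indicE !mul1r mul0r addr0.
have [h|h] := eqVneq (U t + V t) 0; last first.
  have -> : (U t + V t \in (~` [set 0] : set R)) = true by apply/mem_set => /=; exact/eqP.
  by have := dis_ge0 U V t; case: (_ \in _) => /=; lra.
have [h0|h0] := eqVneq (U t) 0.
  have -> : (U t \in ([set 0] : set R)) = true by apply/mem_set.
  by have := dis_ge0 U V t; case: (_ \in _) => /=; lra.
have -> : dis U V t = 1.
  have -> : dis U V t = (1 - rsign (U t) * rsign (- U t)) / 2.
    by rewrite /dis; congr ((1 - _ * rsign _) / 2); lra.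
  move: h0; rewrite neq_lt => /orP[h0|h0].
    by rewrite /rsign oppr_ge0 (ltW h0) [0 <= _]leNgt h0 /=; lra.
  by rewrite /rsign oppr_ge0 (ltW h0) [U t <= 0]leNgt h0 /=; lra.
by do 2!case: (_ \in _) => /=; lra.
Qed.

End GaussianPair.


(** * The approximation ratio *)

Section Expectations.
Context (R : realType) (n : nat).
Implicit Types (e : rel 'I_n) (i j : 'I_n) (f : bits n -> R).

Lemma corr_bound f i j : (forall x, 0 <= f x) -> \sum_x f x = 1 -> -1 <= corr f i j <= 1.
Proof.
move=> f0 f1; rewrite -ler_norml; apply: le_trans (ler_norm_sum _ _ _) _.
rewrite -f1; apply: ler_sum => x _; rewrite normrM (ger0_norm (f0 x)) normrM /spin.
by do 2!case: ifP => _; rewrite ?normrN normr1 !mulr1.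
Qed.

Lemma corrC f i j : corr f i j = corr f j i.
Proof. by apply: eq_bigr => x _; rewrite [spin R x i * _]mulrC. Qed.

Lemma corr_diag f i : corr f i i = \sum_x f x.
Proof. by apply: eq_bigr => x _; rewrite spin_sq mulr1. Qed.

Lemma meas_expectE e (w : R) (A : op R n) : rtr A = 1 ->
  meas_expect e w A = 2^-1 * \sum_(i < n) \sum_(j < n | (i < j)%N && e i j) w * (1 - Sigma A i j).
Proof.
move=> tA; rewrite /meas_expect /maxcut_cost -/(pdist A).
under eq_bigr do rewrite mulrCA.
rewrite -mulr_sumr; congr (_ * _).
under eq_bigr do rewrite mulr_sumr.
rewrite exchange_big /=; apply: eq_bigr => i _.
under eq_bigr do rewrite mulr_sumr.
rewrite exchange_big /=; apply: eq_bigr => j _.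
have -> : w * (1 - Sigma A i j) = w * (\sum_x pdist A x - corr (pdist A) i j).
  by rewrite SigmaE pdist_sum tA.
rewrite /corr -sumrB mulr_sumr; apply: eq_bigr => x _.
by rewrite /pdist; ring.
Qed.

Context (d : measure_display) (T : measurableType d) (P : probability T R).

Lemma Ex_sum_cond (I : Type) (r : seq I) (Q : pred I) (F : I -> T -> R) : (forall k, bm (F k)) ->
  bm (fun t => \sum_(k <- r | Q k) F k t) /\
  Ex P (fun t => \sum_(k <- r | Q k) F k t) = \sum_(k <- r | Q k) Ex P (F k).
Proof.
move=> h; have e : (fun t => \sum_(k <- r | Q k) F k t) = (fun t => \sum_(k <- seq.filter Q r) F k t).
  by apply/funext => t; rewrite big_filter.
by rewrite e; split; [exact: bm_sum|rewrite Ex_sum // big_filter].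
Qed.

Lemma rounding_expectE e (w : R) (y : 'I_n -> T -> R) : (forall i, measurable_fun setT (y i)) ->
  (\int[P]_t (maxcut_cost e w (round_sign (fun i => y i t)))%:E)%E =
  (2^-1 * \sum_(i < n) \sum_(j < n | (i < j)%N && e i j)
     w * (1 - Ex P (fun t => rsign (y i t) * rsign (y j t))))%:E.
Proof.
move=> my.
have bM i j : bm (fun t => rsign (y i t) * rsign (y j t)) by apply: bmM; exact: bm_rsign.
have bF i j : bm (fun t => w * 1 + (- w) * (rsign (y i t) * rsign (y j t))).
  by apply: bmD; [exact: bm_cst|exact: bmZ].
have h1 i := Ex_sum_cond (index_enum _) (fun j : 'I_n => (i < j)%N && e i j) (bF i).
have h2 := Ex_sum_cond (index_enum _) xpredT (fun i => (h1 i).1).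
have -> : (fun t => (maxcut_cost e w (round_sign (fun i => y i t)))%:E) = (fun t => (2^-1 *
   \sum_(i < n) \sum_(j < n | (i < j)%N && e i j) (w * 1 + (- w) * (rsign (y i t) * rsign (y j t))))%:E).
  apply/funext => t; congr ((_ * _)%:E); apply: eq_bigr => i _; apply: eq_bigr => j _.
  by rewrite mulrDr mulrN mulNr.
rewrite (Ex_fin P (bmZ 2^-1 h2.1)) (ExZ P 2^-1 h2.1) h2.2; congr ((_ * _)%:E).
apply: eq_bigr => i _; rewrite (h1 i).2; apply: eq_bigr => j _.
rewrite (ExD P (bm_cst _ (w * 1)) (bmZ (- w) (bM i j))) (ExZ P (- w) (bM i j)) Ex_cst.
by rewrite mulrDr mulrN mulNr.
Qed.

Lemma sum_delta (i : 'I_n) (a : R) (F : 'I_n -> R) : \sum_k a * (k == i)%:R * F k = a * F i.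
Proof.
rewrite (bigD1 i) //= eqxx mulr1 big1 ?addr0 // => k /negbTE ->.
by rewrite mulr0 mul0r.
Qed.

Lemma sum_delta2 (i j : 'I_n) (a b : R) (F : 'I_n -> R) :
  \sum_k (a * (k == i)%:R + b * (k == j)%:R) * F k = a * F i + b * F j.
Proof.
rewrite -(sum_delta i) -(sum_delta j) -big_split; apply: eq_bigr => k _ /=.
by rewrite mulrDl.
Qed.

Lemma gaussian_pair_law (y : 'I_n -> T -> R) (S : 'I_n -> 'I_n -> R) (i j : 'I_n) (a b : R) (A : set R) :
  gaussian_vector P y S -> S i i = 1 -> S j j = 1 -> S j i = S i j -> measurable A ->
  P ((fun t => a * y i t + b * y j t) @^-1` A) = gauss_law (a ^+ 2 + 2 * a * b * S i j + b ^+ 2) A.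
Proof.
move=> [_ h] si sj sij mA; pose c k : R := a * (k == i)%:R + b * (k == j)%:R.
have -> : (fun t => a * y i t + b * y j t) = (fun t => \sum_k c k * y k t).
  by apply/funext => t; rewrite sum_delta2.
have -> : a ^+ 2 + 2 * a * b * S i j + b ^+ 2 = \sum_k \sum_l c k * c l * S k l.
  have e k : \sum_l c k * c l * S k l = c k * (a * S k i + b * S k j).
    by rewrite -sum_delta2 mulr_sumr; apply: eq_bigr => l _; rewrite mulrA.
  under eq_bigr do rewrite e.
  by rewrite sum_delta2 si sj sij; ring.
exact: h.
Qed.

Lemma rounding_edge_ge (y : 'I_n -> T -> R) (S : 'I_n -> 'I_n -> R) (i j : 'I_n) :
  gaussian_vector P y S -> S i i = 1 -> S j j = 1 -> S j i = S i j -> -1 <= S i j <= 1 ->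
  2 * acos (S i j) / pi <= 1 - Ex P (fun t => rsign (y i t) * rsign (y j t)).
Proof.
move=> gv si sj sij; have [my _] := gv.
by apply: gaussian_rounding_ge => // a b A mA; exact: gaussian_pair_law.
Qed.

End Expectations.

Lemma sqrt2_sq4 (R : realType) (x q : R) : x ^+ 2 = 2 * Num.sqrt 2 * q -> x ^+ 4 = 8 * q ^+ 2.
Proof.
move=> h; have -> : x ^+ 4 = (x ^+ 2) ^+ 2 by rewrite -exprM.
have s2 : Num.sqrt 2 ^+ 2 = 2 :> R by rewrite sqr_sqrtr.
by rewrite h exprMn exprMn s2; ring.
Qed.

Unset Implicit Arguments.

(** The ratio is multiplied out, so a vanishing measured expectation is covered as well. *)
Theorem theorem4 (R : realType) (n Delta : nat) (e : rel 'I_n) (w : R)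
    (p : R) (c : circuit R n) (rho0 : op R n) (eps : R)
    (d : measure_display) (T : measurableType d) (P : probability T R)
    (y : 'I_n -> T -> R) :
  simple_graph e -> regular e Delta -> 0 < w ->
  0 <= p <= 1 ->
  circuit_wf c -> density rho0 ->
  gaussian_vector P y (Sigma (noisy_state p c rho0)) ->
  0 <= eps -> eps ^+ 2 = 2 * Num.sqrt 2 * (1 - p) ^+ size c ->
  eps <= xprime R ->
  ((\int[P]_t (maxcut_cost e w (round_sign (fun i => y i t)))%:E)%E >=
     (((1 - eps) * gfun (- eps) + eps * alpha_GW R)
        * meas_expect e w (noisy_state p c rho0))%:E)%E
  /\ (1 - eps) * gfun (- eps) + eps * alpha_GW R >= 1 - hfun eps
  /\ hfun eps <= 1 - alpha_GW R
  /\ (exists K : R, forall x : R, 0 <= x <= xprime R -> hfun x <= K * x)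
  /\ (@hfun R x @[x --> (0 : R)^'+] --> 0).
Proof.
move=> sg rg w0 hp hc [psd0 tr0] gv eps0 epsE epsx.
have e1 : eps <= 689 / 1000 by exact: epsx.
have hfE : 1 - hfun eps = (1 - eps) * gfun (- eps) + eps * alpha_GW R.
  by rewrite /hfun /gfun opprK; ring.
have ga : alpha_GW R <= gfun (- eps) by apply: alpha_le_gfun; apply/andP; split; lra.
split; last split; [|by rewrite hfE|split; [|split; [exists 2; exact: hfun_bound|exact: hfun_cvg0]]]; last first.
  have /(ler_wpM2l (_ : 0 <= 1 - eps)) : alpha_GW R <= gfun (- eps) by [].
  by move=> /(_ ltac:(lra)); lra.
have [rho eR] : exists rho, rho = noisy_state p c rho0 by eexists.
rewrite -eR; rewrite -eR in gv.
have tr1 : rtr rho0 = 1 by rewrite /rtr tr0.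
have prho : psd rho by rewrite eR; exact: noisy_psd.
have trho : rtr rho = 1 by rewrite eR noisy_rtr.
have f0 x : 0 <= pdist rho x by exact: diag_ge0.
have f1 : \sum_x pdist rho x = 1 by rewrite pdist_sum.
have Sii i : Sigma rho i i = 1 by rewrite SigmaE corr_diag.
have Sb i j : -1 <= Sigma rho i j <= 1 by rewrite SigmaE; exact: corr_bound.
have Sc i j : Sigma rho j i = Sigma rho i j by rewrite !SigmaE corrC.
have ent_bd := sum_Sigma_sq_le hp sg rg hc psd0 tr1; rewrite -eR in ent_bd.
have [my _] := gv; rewrite rounding_expectE // meas_expectE // lee_fin.
have rd i j := rounding_edge_ge gv (Sii i) (Sii j) (Sc i j) (Sb i j).
set q := (1 - p) ^+ size c in epsE.
have q2 : ((1 - p) ^+ 2) ^+ size c = q ^+ 2 by rewrite -!exprM mulnC.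
rewrite q2 in ent_bd.
have e4 := sqrt2_sq4 epsE; have ec := edge_count R sg rg.
have ln2 : 0 <= ln (2 : R) <= 1.
  by rewrite ln_ge0 ?ler1n //=; have := @ln_le_sub1 R 2 ltac:(lra); lra.
have tot : \sum_(i < n) \sum_(j < n | (i < j)%N && e i j) (Sigma rho i j ^+ 2 - eps ^+ 4) <= 0.
  under eq_bigr do rewrite sumrB.
  have -> : \sum_(i < n) (\sum_(j < n | (i < j)%N && e i j) Sigma rho i j ^+ 2 -
      \sum_(j < n | (i < j)%N && e i j) eps ^+ 4) =
    \sum_(i < n) \sum_(j < n | (i < j)%N && e i j) Sigma rho i j ^+ 2 -
    eps ^+ 4 * \sum_(i < n) \sum_(j < n | (i < j)%N && e i j) 1.
    rewrite sumrB mulr_sumr; congr (_ - _); apply: eq_bigr => i _; rewrite mulr_sumr.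
    by apply: eq_bigr => j _; rewrite mulr1.
  have -> : eps ^+ 4 * \sum_(i < n) \sum_(j < n | (i < j)%N && e i j) 1 = 4 * q ^+ 2 * (n%:R * Delta%:R).
    by rewrite e4 -ec; ring.
  rewrite subr_le0; apply: le_trans ent_bd _.
  (* Both sides are multiples of q^2 n Delta, and the claim reduces to 2 ln 2 <= 4. *)
  have -> : 2 * Delta%:R * (q ^+ 2 * (n%:R * ln 2)) = 2 * ln 2 * (q ^+ 2 * (n%:R * Delta%:R)) by ring.
  have -> : 4 * q ^+ 2 * (n%:R * Delta%:R) = 4 * (q ^+ 2 * (n%:R * Delta%:R)) by ring.
  by apply: ler_wpM2r; [rewrite mulr_ge0 ?sqr_ge0 ?mulr_ge0|lra].
(* [kap] is a Lagrange multiplier for the constraint [tot] on the squared correlations. *)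
have [kap [k0 edge]] : exists kap : R, 0 <= kap /\ forall i j : 'I_n, (i < j)%N && e i j ->
    ((1 - eps) * gfun (- eps) + eps * alpha_GW R) * (1 - Sigma rho i j)
      - kap * (Sigma rho i j ^+ 2 - eps ^+ 4) <= 2 * acos (Sigma rho i j) / pi.
  move: eps0; rewrite le_eqVlt => /predU1P[z|pe].
    (* For [eps = 0] the constraint makes every edge correlation vanish, and both sides equal 1. *)
    exists 0; split=> // i j hij.
    have S0 : Sigma rho i j = 0.
      apply/eqP; rewrite -sqrf_eq0.
      have zz i' j' : 0 <= Sigma rho i' j' ^+ 2 - eps ^+ 4 by rewrite -z expr0n /= subr0 sqr_ge0.
      have /eqP : \sum_(i < n) \sum_(j < n | (i < j)%N && e i j) (Sigma rho i j ^+ 2 - eps ^+ 4) = 0.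
        by apply/eqP; rewrite eq_le tot; apply: sumr_ge0 => i' _; exact: sumr_ge0.
      rewrite psumr_eq0 => [|i' _]; last exact: sumr_ge0.
      move=> /allP /(_ i (mem_index_enum _)) /=; rewrite psumr_eq0 // => /allP /(_ j (mem_index_enum _)).
      by rewrite hij -z expr0n /= subr0.
    have pi2 : 2 * (pi / 2) / pi = 1 :> R.
      by rewrite mulrCA mulfV ?mulr1 ?divff ?(lt0r_neq0 (pi_gt0 R)) // pnatr_eq0.
    by rewrite S0 -z oppr0 gfun0 acos0 pi2; lra.
  exists ((gfun (- eps) - alpha_GW R) / eps ^+ 2); split.
    by rewrite divr_ge0 ?sqr_ge0 // subr_ge0.
  move=> i j _; have := @edge_bound R eps (Sigma rho i j) (introT andP (conj pe epsx)) (Sb i j).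
  have -> : (gfun (- eps) - alpha_GW R) / eps ^+ 2 * (Sigma rho i j ^+ 2 - eps ^+ 4) =
     (gfun (- eps) - alpha_GW R) * ((Sigma rho i j ^+ 2 - eps ^+ 4) / eps ^+ 2) by rewrite mulrA mulrAC.
  by [].
rewrite mulrCA; apply: ler_wpM2l; first by rewrite invr_ge0.
set B := (1 - eps) * gfun (- eps) + eps * alpha_GW R in edge *.
(* By [tot] the subtracted term is nonpositive, so it may be inserted before comparing edge by
   edge. *)
apply: (@le_trans _ _ (B * \sum_(i < n) \sum_(j < n | (i < j)%N && e i j) w * (1 - Sigma rho i j) -
  w * kap * \sum_(i < n) \sum_(j < n | (i < j)%N && e i j) (Sigma rho i j ^+ 2 - eps ^+ 4))).
  by rewrite lerDl oppr_ge0; apply: mulr_ge0_le0 => //; rewrite mulr_ge0 // ltW.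
rewrite !mulr_sumr -sumrB; apply: ler_sum => i _; rewrite !mulr_sumr -sumrB; apply: ler_sum => j hij.
have -> : B * (w * (1 - Sigma rho i j)) - w * kap * (Sigma rho i j ^+ 2 - eps ^+ 4) =
  w * (B * (1 - Sigma rho i j) - kap * (Sigma rho i j ^+ 2 - eps ^+ 4)) by ring.
by apply: ler_wpM2l; [exact: ltW|exact: le_trans (edge i j hij) (rd i j)].
Qed.
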